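(* Let $a>0$ be a constant, let $p\ge 1$ be an integer, and let $g_0\in\mathcal G_a$ be the true density with coefficient sequence $\boldsymbol\theta=(\theta_0,\theta_1,\dots)\in\Omega^{\mathcal G_a}$. Let $g=g(\cdot|\boldsymbol\eta)\in\mathcal G_a$ denote a generic element, with coefficient sequence $\boldsymbol\eta=(\eta_0,\eta_1,\dots)\in\Omega^{\mathcal G_a}$, and let $\pi$ be a prior on $\boldsymbol\eta$. For any $\varepsilon_n\ge n^{-p/(2p+1)}$, suppose that there exists a constant $C_3>0$, independent of $n$, such that $$\pi\Big(\Big\{\boldsymbol\eta\in\Omega^{\mathcal G_a}\,\Big|\,\sum_{j=0}^\infty(\eta_j-\theta_j)^2\gamma_j\le aC_3\varepsilon_n^2\Big\}\Big)\gtrsim\exp(-2C_3n\varepsilon_n^2)$$ and $$\pi\Big(\Big\{\boldsymbol\eta\in\Omega^{\mathcal G_a}\,\Big|\,\sum_{j=0}^\infty\eta_j^2\tilde\gamma_j>n^{\frac1{2p+1}}\Big\}\Big)\lesssim\exp(-C_3n\varepsilon_n^2).$$ If $n\varepsilon_n^2\to\infty$, then for all sufficiently large $K>0$, $$\pi(A_{a,n}^c|\mathbf Y^n)\lesssim\exp\Big(-\frac{nK^2\varepsilon_n^2}{2}\Big)+\exp(-4C_3n\varepsilon_n^2)\to0,$$ except on a set of probability tending to $0$, where $A_{a,n}^c:=\{\boldsymbol\eta\in\Omega^{\mathcal G_a}\mid d_H(g(\cdot|\boldsymbol\eta),g_0)\ge K\varepsilon_n\}$.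
   Context: Setting. $I\subseteq\mathbb R$ is an interval, possibly unbounded (e.g. $\mathbb R$ or $\mathbb R^+$), and $w$ is a weight function on $I$ with associated orthogonal polynomial system $\{q_j\}_{j\ge0}$, $q_0\equiv1$, $\int_I q_iq_jw\,dx=\delta_{ij}\gamma_j$. $L_{2,w}$ is the $L_2$ space on $I$ for the measure $w(x)dx$. $W^p_{2,w}(I)$ is the weighted Sobolev space with norm $\|g\|^2_{W^p_{2,w}}=\sum_{l=0}^p\int_I|g^{(l)}|^2w\,dx$ (weak derivatives). All densities are with respect to $w(x)dx$. It is assumed that the densities considered have a unique expansion $g=g(\cdot|\boldsymbol\eta)=\sum_{j\ge0}\eta_jq_j$, $\eta_j=\gamma_j^{-1}\int_I gq_jw\,dx$. $\mathcal G_a:=\{g\in W^p_{2,w}(I): g\ge a,\ \int_I g\,w\,dx=1\}$. $\Omega^{\mathcal G_a}$ is the set of coefficient sequences of elements of $\mathcal G_a$; functions and their coefficient sequences are identified. The constants $\tilde\gamma_j$: with $a_{ij}^{(l)}=\gamma_i^{-1}\int_I q_j^{(l)}q_iw\,dx$, for each $j\ge1$, $\tilde\gamma_j$ is any fixed constant with $$\tilde\gamma_j\ge\max\Big\{\max_{0\le l\le\min(j,p)}\sum_{i=0}^{j-1}(a_{ij}^{(l)})^4\gamma_i,\ j^4\max_{0\le i\le j-1}\gamma_i\Big\},$$ and $\tilde\gamma_0=\gamma_0$. Hellinger distance: $d_H^2(g_1,g_2)=\int_I(\sqrt{g_1}-\sqrt{g_2})^2w\,dx$. Data and posterior: $\mathbf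 Y^n=(Y_1,\dots,Y_n)$ are i.i.d. with density $g_0$ with respect to $w(x)dx$, and for measurable $A$, $$\pi(A|\mathbf Y^n)=\frac{\int_A\prod_{i=1}^n\frac{g(Y_i|\boldsymbol\eta)}{g_0(Y_i)}d\pi(\boldsymbol\eta)}{\int_{\Omega^{\mathcal G_a}}\prod_{i=1}^n\frac{g(Y_i|\boldsymbol\eta)}{g_0(Y_i)}d\pi(\boldsymbol\eta)}.$$ ''Except on a set of probability tending to $0$'' refers to the law of $\mathbf Y^n$ under $g_0$. $x_n\lesssim y_n$ (resp. $x_n\gtrsim y_n$) means there is a constant $C>0$ with $x_n\le Cy_n$ (resp. $x_n\ge Cy_n$) for all large $n$. *)

(* Defs.v *)
From HB Require Import structures.
From mathcomp Require Import all_boot all_order all_algebra finmap.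
From mathcomp Require Import all_classical all_reals all_analysis.

Set Implicit Arguments.
Unset Strict Implicit.
Unset Printing Implicit Defensive.

Import Order.TTheory GRing.Theory Num.Theory.
Import numFieldNormedType.Exports.

Local Open Scope classical_set_scope.
Local Open Scope ring_scope.

(* Nonnegative rather than almost everywhere positive; finiteness of all the
   moments is what makes the orthogonal polynomials meaningful. *)
Definition weight_function (R : realType) (I : interval R) (w : R -> R) : Prop :=
  [/\ measurable_fun [set` I] w,
      forall x, x \in I -> 0 <= w x,
      (0 < \int[lebesgue_measure]_(x in [set` I]) (w x)%:E)%E &
      forall k, (\int[lebesgue_measure]_(x in [set` I]) (`|x| ^+ k * w x)%:E
                 < +oo)%E].

Definition gamma (R : realType) (I : interval R) (w : R -> R)
    (q : nat -> {poly R}) (j : nat) : R :=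
  \int[lebesgue_measure]_(x in [set` I]) ((q j).[x] ^+ 2 * w x).

Definition orthogonal_polynomials (R : realType) (I : interval R) (w : R -> R)
    (q : nat -> {poly R}) : Prop :=
  [/\ forall j, size (q j) = j.+1,
      q 0%N = 1 &
      forall i j, \int[lebesgue_measure]_(x in [set` I])
                    ((q i).[x] * (q j).[x] * w x)
                  = (i == j)%:R * gamma I w q j].

Definition coef (R : realType) (I : interval R) (w : R -> R)
    (q : nat -> {poly R}) (g : R -> R) (j : nat) : R :=
  (gamma I w q j)^-1 *
  \int[lebesgue_measure]_(x in [set` I]) (g x * (q j).[x] * w x).

(* g = \sum_j eta_j q_j, with convergence of the series in L_{2,w} *)
Definition expands (R : realType) (I : interval R) (w : R -> R)
    (q : nat -> {poly R}) (g : R -> R) (eta : nat -> R) : Prop :=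
  (\int[lebesgue_measure]_(x in [set` I])
     ((g x - \sum_(j < n) eta j * (q j).[x]) ^+ 2 * w x)%:E)%E
    @[n --> \oo] --> 0%E.

Definition unique_expansion (R : realType) (I : interval R) (w : R -> R)
    (q : nat -> {poly R}) (g : R -> R) : Prop :=
  expands I w q g (coef I w q g) /\
  forall eta, expands I w q g eta -> eta = coef I w q g.

Definition test_function (R : realType) (D : set R) (phi : R -> R) : Prop :=
  (forall (l : nat) (x : R), derivable (derive1n l phi) x 1) /\
  exists K : set R, [/\ compact K, K `<=` D & forall x, ~ K x -> phi x = 0].

Definition weak_derivative (R : realType) (D : set R) (l : nat)
    (g h : R -> R) : Prop :=
  [/\ locally_integrable D g, locally_integrable D h &
      forall phi, test_function D phi ->
        \int[lebesgue_measure]_(x in D) (g x * derive1n l phi x) =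
        (-1) ^+ l * \int[lebesgue_measure]_(x in D) (h x * phi x)].

(* The condition l = 0 says that g itself is in L_{2,w}. *)
Definition sobolev (R : realType) (I : interval R) (w : R -> R) (p : nat)
    (g : R -> R) : Prop :=
  measurable_fun [set` I] g /\
  forall l, (l <= p)%N -> exists h : R -> R,
    [/\ measurable_fun [set` I] h,
        weak_derivative [set` I]° l g h &
        (\int[lebesgue_measure]_(x in [set` I]) (h x ^+ 2 * w x)%:E < +oo)%E].

(* The bound g >= a is imposed everywhere on I, not only almost everywhere: this
   fixes versions that may be divided by, and does not change [Omega_G]. *)
Definition G_ (R : realType) (I : interval R) (w : R -> R) (p : nat) (a : R) :
    set (R -> R) :=
  [set g | [/\ sobolev I w p g,
               forall x, x \in I -> a <= g x &
               (\int[lebesgue_measure]_(x in [set` I]) (g x * w x)%:E = 1)%E]].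

Definition Omega_G (R : realType) (I : interval R) (w : R -> R)
    (q : nat -> {poly R}) (p : nat) (a : R) : set (nat -> R) :=
  coef I w q @` G_ I w p a.

(* Generators of the sigma-algebra carrying the prior: the coordinate maps and
   the support Omega. Probabilities on it giving mass 1 to Omega correspond
   exactly to probabilities on Omega with the trace of the product
   sigma-algebra, so that no measurability of Omega has to be assumed. *)
Definition coef_system (R : realType) (Omega : set (nat -> R)) :
    set (set (nat -> R)) :=
  [set A | A = Omega \/ exists j (B : set R),
             measurable B /\ A = (fun eta : nat -> R => eta j) @^-1` B].

Notation coef_space Omega := (g_sigma_algebraType (coef_system Omega)).

(* Measurable choice of a version of the density g(.|eta) for every eta in
   Omega_G: eta determines g(.|eta) only as an element of L_{2,w}, whereas the
   posterior evaluates it at the data points and integrates over eta. *)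
Definition density_family (R : realType) (I : interval R) (w : R -> R)
    (q : nat -> {poly R}) (p : nat) (a : R) (g : (nat -> R) -> R -> R) : Prop :=
  (forall eta, Omega_G I w q p a eta ->
     G_ I w p a (g eta) /\ coef I w q (g eta) = eta) /\
  measurable_fun
    (Omega_G I w q p a `*` [set` I]
       : set (coef_space (Omega_G I w q p a) * R)%type)
    (fun z => g z.1 z.2).

Definition deriv_coef (R : realType) (I : interval R) (w : R -> R)
    (q : nat -> {poly R}) (l i j : nat) : R :=
  (gamma I w q i)^-1 *
  \int[lebesgue_measure]_(x in [set` I])
     ((derivn l (q j)).[x] * (q i).[x] * w x).

(* All the maxima are over nonempty ranges of nonnegative numbers, hence the
   neutral element 0. *)
Definition admissible_gammat (R : realType) (I : interval R) (w : R -> R)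
    (q : nat -> {poly R}) (p : nat) (gammat : nat -> R) : Prop :=
  gammat 0%N = gamma I w q 0 /\
  forall j, (1 <= j)%N ->
    Num.max
      (\big[Num.max/0]_(0 <= l < (minn j p).+1)
          \sum_(0 <= i < j) deriv_coef I w q l i j ^+ 4 * gamma I w q i)
      (j%:R ^+ 4 * \big[Num.max/0]_(0 <= i < j) gamma I w q i)
    <= gammat j.

Definition hellinger (R : realType) (I : interval R) (w : R -> R)
    (g1 g2 : R -> R) : R :=
  Num.sqrt (\int[lebesgue_measure]_(x in [set` I])
              ((Num.sqrt (g1 x) - Num.sqrt (g2 x)) ^+ 2 * w x)).

Definition mutually_independent d (T : measurableType d) (R : realType)
    (P : probability T R) (Y : nat -> {RV P >-> R}) : Prop :=
  forall (J : {fset nat}) (B : nat -> set R), (forall i, measurable (B i)) ->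
    P (\bigcap_(i in [set` J]) (Y i @^-1` B i)) =
    (\prod_(i <- J) P (Y i @^-1` B i))%E.

(* distribution of X = f(x) w(x) dx on I *)
Definition has_density d (T : measurableType d) (R : realType)
    (P : probability T R) (X : {RV P >-> R}) (I : interval R)
    (w f : R -> R) : Prop :=
  forall B : set R, measurable B ->
    distribution P X B =
    (\int[lebesgue_measure]_(x in B `&` [set` I]) (f x * w x)%:E)%E.

Definition likelihood_ratio (R : realType) (g0 : R -> R)
    (g : (nat -> R) -> R -> R) (n : nat) (y : 'I_n -> R) (eta : nat -> R) : R :=
  \prod_(i < n) (g eta (y i) / g0 (y i)).

(* The quotient is the total one of extended reals: with the convention
   +oo^-1 = 0, it is 0 on the null event where the evidence is infinite. *)
Definition posterior (R : realType) (Omega : set (nat -> R))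
    (pi : probability (coef_space Omega) R) (g0 : R -> R)
    (g : (nat -> R) -> R -> R) (n : nat) (y : 'I_n -> R)
    (A : set (nat -> R)) : \bar R :=
  ((\int[pi]_(eta in A) (likelihood_ratio g0 g y eta)%:E) /
   (\int[pi]_(eta in Omega) (likelihood_ratio g0 g y eta)%:E))%E.

Definition lesssim (R : realType) (x : nat -> \bar R) (y : nat -> R) : Prop :=
  exists2 C : R, 0 < C & \forall n \near \oo, (x n <= (C * y n)%:E)%E.

Definition gtrsim (R : realType) (x : nat -> \bar R) (y : nat -> R) : Prop :=
  exists2 C : R, 0 < C & \forall n \near \oo, ((C * y n)%:E <= x n)%E.

(* x_n(omega) is bounded up to a deterministic constant by y_n, for all large n
   and all omega outside events E_n of probability tending to 0 *)
Definition lesssim_whp d (T : measurableType d) (R : realType)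
    (P : probability T R) (x : nat -> T -> \bar R) (y : nat -> R) : Prop :=
  exists2 C : R, 0 < C & exists E : nat -> set T,
    [/\ forall n, measurable (E n),
        P (E n) @[n --> \oo] --> 0%E &
        \forall n \near \oo, forall omega, ~ E n omega ->
          (x n omega <= (C * y n)%:E)%E].

(* Main.v *)
(** Let [mu] be the measure [w dx] and [f n = n * eps n ^+ 2], so that
[f n >= n^(1/(2p+1))].

The prior is concentrated on the sieve [sum_j eta_j^2 gammat_j <= M^2] with [M^2] of
order [f n]: applying the tail hypothesis at a sample size [n'] for which
[n'^(1/(2p+1))] is about [9 * f n] gives the complement prior mass
[O(exp(- 9 C3 f n))].

The sieve has entropy [O(f n)] for an arbitrary weight, because of a Poincare
inequality for orthogonal polynomials. The polynomial [q_j] has [j] distinct real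
roots [z_i]. Comparing [h^p |q^(p) / q|] at [x + i h] with a power of
[h sum_i 1 / (x + i h - z_i)] by means of Newton's identities, and noting that the
imaginary parts of the latter terms all have the same sign, one sees that a bound on
the derivative at scale [h] leaves boundedly many roots within distance [h] of [x],
and that [q_j] is close to a polynomial of bounded degree near [x]. Averaging over
[x] shows that on a cell of diameter [rho] the [L2] distance of [q_j] to polynomials
of bounded degree is [O(rho^p)] times a quantity whose square integral is twice that
of [q_j^(p)], which the choice of [gammat_j] controls. Thus piecewise polynomials,
the first few [q_j] and the leading directions of a Hilbert-Schmidt remainder span a
space of dimension polynomial in [m], with a small exponent, that approximates the
sieve in [L2] on [-m, m[; a packing argument in this space gives a finite net.

The posterior is then bounded through square roots of likelihood ratios. The
denominator is at least [exp(- 4 C3 f n)] up to a constant, from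
[W >= 2 s - s^2 / W] and a chi-square bound on the prior ball (here [g >= a] enters).
For a net point [g_i] at Hellinger distance of order [K eps n] from [g0], the test
[prod sqrt (g_i / g0) > exp(- K^2 f n / 4)] has exponentially small error under
[g0], and its error under any [g] approximated by [g_i] is governed by
[int g sqrt (g0 / g_i) <= 1 + O(eps n ^+ 2 + 1/n)]. *)

Require Import Defs.
From HB Require Import structures.
From mathcomp Require Import all_boot all_order all_algebra finmap.
From mathcomp Require Import all_classical all_reals all_analysis.
From mathcomp Require Import measurable_realfun complex polyrcf.
From mathcomp Require Import ring lra zify.

Set Implicit Arguments.
Unset Strict Implicit.
Unset Printing Implicit Defensive.

Import Order.TTheory GRing.Theory Num.Theory.
Import numFieldNormedType.Exports Normc.

Local Open Scope classical_set_scope.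
Local Open Scope ring_scope.

(** * Power sums and real-rooted polynomials *)

(** An arbitrary weight offers no Markov or Bernstein inequality and no asymptotics for the [q j].
    Their oscillation is controlled only through two consequences of orthogonality: the roots are
    real and simple, and the cofactors of distinct roots are orthogonal.

    At sample size [n] the tail hypothesis gives mass [exp(- C3 f n)] to the complement of the
    sieve, while the evidence is only bounded below by [exp(- 4 C3 f n)]; this is why the sieve
    comes from a larger sample size. In units of [C3 f n] the budget is 4 for the evidence and 4 for
    the claim, hence 8 for the numerator, and 9 for the prior mass of the complement: the last unit
    makes the exceptional probability tend to 0.

    The net has [L2] radius of order [eps n], yet its effect on one factor of a test must be of
    order [eps n ^+ 2]. The linear effect is removed by recording the total mass of a function as
    one more coordinate in the packing; what remains is quadratic. *)

Section newton_identities.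
Variables (F : comNzRingType) (n : nat) (b : 'I_n -> F).

Lemma deriv_prod_ord (I : finType) (P : I -> {poly F}) :
  (\prod_i P i)^`() = \sum_i (P i)^`() * \prod_(j | j != i) P j.
Proof.
have := index_enum_uniq I.
elim: (index_enum I) => [|x s IHs] /=; first by rewrite !big_nil derivC.
move=> /andP[xs us]; rewrite !big_cons derivM (IHs us) eqxx /=; congr (_ * _ + _).
  rewrite [RHS]big_seq_cond [LHS]big_seq; apply: eq_bigl => i.
  by case: (boolP (i \in s)) => //= iS; apply/esym; apply: contraNneq xs => <-.
rewrite mulr_sumr [LHS]big_seq [RHS]big_seq; apply: eq_bigr => i iS.
rewrite big_cons; have -> : x != i by apply: contraNneq xs => ->.
by rewrite mulrCA.
Qed.

(** Its coefficients are the elementary symmetric functions of the [b i]. *)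
Definition recip_poly : {poly F} := \prod_i (1 + b i *: 'X).
Definition power_sum k : F := \sum_i b i ^+ k.

(** The cofactor is [recip_poly] divided by [1 + b i *: 'X]; the sum comes from the geometric series
    of that inverse. *)
Lemma coef_recip_poly_cofactor i k :
  (\prod_(j | j != i) (1 + b j *: 'X))`_k =
  \sum_(l < k.+1) (- b i) ^+ l * recip_poly`_(k - l).
Proof.
have E : recip_poly = (1 + b i *: 'X) * \prod_(j | j != i) (1 + b j *: 'X).
  by rewrite /recip_poly (bigD1 i).
elim: k => [|k IHk].
  rewrite big_ord1 expr0 mul1r E mulrDl mul1r coefD -scalerAl coefZ coefXM.
  by rewrite eqxx mulr0 addr0.
rewrite big_ord_recl expr0 mul1r subn0.
under [in RHS]eq_bigr => l _ do rewrite lift0 exprS -mulrA subSS.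
by rewrite -mulr_sumr -IHk E mulrDl mul1r coefD -scalerAl coefZ coefXM mulNr addrK.
Qed.

Lemma newton_recip_poly k : recip_poly`_k.+1 *+ k.+1 =
  \sum_(l < k.+1) (-1) ^+ l * power_sum l.+1 * recip_poly`_(k - l).
Proof.
rewrite -coef_deriv {1}/recip_poly deriv_prod_ord coef_sum.
transitivity (\sum_i \sum_(l < k.+1)
    b i * ((- b i) ^+ l * recip_poly`_(k - l))).
  apply: eq_bigr => i _.
  rewrite derivD derivC add0r derivZ derivX -scalerAl mul1r coefZ.
  by rewrite coef_recip_poly_cofactor mulr_sumr.
rewrite exchange_big /=; apply: eq_bigr => l _.
rewrite /power_sum mulr_sumr mulr_suml; apply: eq_bigr => i _.
by rewrite (exprNn (b i)) exprS; ring.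
Qed.

Lemma coef0_recip_poly : recip_poly`_0 = 1.
Proof.
rewrite -horner_coef0 /recip_poly horner_prod big1 // => i _.
by rewrite hornerD hornerC hornerZ hornerX mulr0 addr0.
Qed.

End newton_identities.

Section newton_bounds.
Variables (C : numFieldType) (n : nat) (b : 'I_n -> C).

(** Strong induction on Newton's identities: each of the [k.+1] terms is at most [Q ^+ k.+1], and
    the factor [k.+1] on the left cancels their number. *)
Lemma recip_poly_coef_le (Q : C) : 1 <= Q ->
  (forall k, `|power_sum b k.+1| <= Q) ->
  forall k, `|(recip_poly b)`_k| <= Q ^+ k.
Proof.
move=> Q1 hQ; have Q0 : 0 <= Q by apply: le_trans Q1.
elim/ltn_ind => -[|k] IHk; first by rewrite coef0_recip_poly normr1 expr0.
suff : `|(recip_poly b)`_k.+1 *+ k.+1| <= Q ^+ k.+1 *+ k.+1.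
  by rewrite normrMn lerMn2r.
have -> : Q ^+ k.+1 *+ k.+1 = \sum_(l < k.+1) Q ^+ k.+1.
  by rewrite sumr_const card_ord.
rewrite newton_recip_poly.
apply: le_trans (ler_norm_sum _ _ _) _; apply: ler_sum => l _.
rewrite normrM normrM normrX normrN1 expr1n mul1r exprS.
apply: ler_pM => //; apply: le_trans (IHk _ _) _.
  by rewrite ltnS leq_subr.
by apply: ler_weXn2l => //; rewrite leq_subr.
Qed.

(** When the first power sum has the largest modulus [L], it dominates Newton's identities. A bound
    on a single coefficient then bounds [L] itself, which is how [soft_count] uses it. *)
Lemma recip_poly_coef_pow_sub (L : C) : 1 <= L ->
  `|power_sum b 1| = L ->
  (forall k, `|power_sum b k.+2| <= L) ->
  forall k, `|(recip_poly b)`_k.+1 *+ (k.+1)`! - power_sum b 1 ^+ k.+1|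
    <= L ^+ k *+ (k.+1)`!.
Proof.
move=> L1 e1 hL; have L0 : 0 <= L by apply: le_trans L1.
have hc := @recip_poly_coef_le L L1.
have {}hc : forall k, `|(recip_poly b)`_k| <= L ^+ k.
  by apply: hc => -[|k]; rewrite ?e1 // hL.
elim=> [|k IHk].
  have := newton_recip_poly b 0.
  rewrite big_ord1 expr0 mul1r subn0 coef0_recip_poly mulr1 mulr1n => ->.
  by rewrite expr1 (_ : 1`! = 1)%N // !mulr1n subrr normr0 ?expr0 ler01.
rewrite factS mulrnA newton_recip_poly big_ord_recl /= expr0 mul1r subn0.
set S := \sum_(i < k.+1) _.
have hS : `|S| <= L ^+ k.+1 *+ k.+1.
  have -> : L ^+ k.+1 *+ k.+1 = \sum_(l < k.+1) L ^+ k.+1.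
    by rewrite sumr_const card_ord.
  apply: le_trans (ler_norm_sum _ _ _) _; apply: ler_sum => l _.
  rewrite normrM normrM normrX normrN1 expr1n mul1r exprS.
  apply: ler_pM => //; apply: le_trans (hc _) _.
  by apply: ler_weXn2l => //; rewrite /bump leq0n add1n subSS leq_subr.
rewrite mulrnDl -mulrnAr exprS addrAC -mulrBr.
apply: le_trans (ler_normD _ _) _; rewrite normrM e1 normrMn.
have -> : L ^+ k.+1 *+ (k.+2 * (k.+1)`!) =
  L * (L ^+ k *+ (k.+1)`!) + L ^+ k.+1 *+ k.+1 *+ (k.+1)`!.
  by rewrite mulrnAr -exprS -mulrnA -mulrnDr mulSn.
by apply: lerD; [apply: ler_wpM2l | exact: ler_wMn2r].
Qed.

End newton_bounds.

Section affine_comp.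
Variable F : comNzRingType.

Lemma coef_comp_affine (P : {poly F}) (c h : F) k :
  (P \Po (c%:P + h *: 'X))`_k = P^`N(k).[c] * h ^+ k.
Proof.
rewrite /comp_poly nderiv_taylor; last exact: mulrC.
rewrite size_map_polyC.
under eq_bigr => i _.
  rewrite nderivn_map horner_map /= exprZn -scalerAr mul_polyC scalerA.
  over.
rewrite coef_sum.
under eq_bigr => i _ do rewrite coefZ coefXn.
case: (ltnP k (size P)) => kP.
  rewrite (bigD1 (Ordinal kP)) //= eqxx mulr1 big1 ?addr0 1?mulrC // => i.
  by rewrite -val_eqE /= eq_sym => /negbTE ->; rewrite mulr0.
rewrite big1 => [|i _]; last first.
  by rewrite gtn_eqF ?mulr0 // (leq_trans (ltn_ord i)).
have -> : P^`N(k) = 0.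
  by apply/polyP => i; rewrite coef_nderivn nth_default ?mul0rn ?coef0 // (leq_trans kP) // leq_addr.
by rewrite horner0 mul0r.
Qed.

End affine_comp.

Section root_products.
Variables (F : fieldType) (n : nat) (z : 'I_n -> F).

Definition root_poly : {poly F} := \prod_i ('X - (z i)%:P).
Definition root_cofactor i : {poly F} := \prod_(j | j != i) ('X - (z j)%:P).

Lemma root_polyD i : root_poly = ('X - (z i)%:P) * root_cofactor i.
Proof. by rewrite /root_poly (bigD1 i). Qed.

Lemma horner_root_poly x : root_poly.[x] = \prod_i (x - z i).
Proof. by rewrite horner_prod; apply: eq_bigr => i _; rewrite !hornerE. Qed.

Lemma horner_root_cofactor i x : x != z i ->
  (root_cofactor i).[x] = root_poly.[x] / (x - z i).
Proof.
by move=> xz; rewrite (root_polyD i) !hornerE mulrC mulKf // subr_eq0.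
Qed.

Lemma root_root_cofactor i j : i != j -> (root_cofactor i).[z j] = 0.
Proof.
move=> ij; rewrite /root_cofactor horner_prod (bigD1 j) 1?eq_sym //=.
by rewrite !hornerE subrr mul0r.
Qed.

Lemma size_root_poly : size root_poly = n.+1.
Proof.
rewrite size_prod_XsubC; congr _.+1.
by rewrite -[RHS]card_ord cardT enumT.
Qed.

Lemma size_root_cofactor i : size (root_cofactor i) = n.
Proof.
have c0 : root_cofactor i != 0.
  by apply/prodf_neq0 => j _; rewrite polyXsubC_eq0.
have := size_root_poly; rewrite (root_polyD i) size_mul ?polyXsubC_eq0 //.
by rewrite size_XsubC /= => -[].
Qed.

Lemma size_derivn_root_poly p : (0 < p)%N -> (size root_poly^`(p) <= n)%N.
Proof.
move=> p0; apply/leq_sizeP => j hj; rewrite coef_derivn nth_default ?mul0rn //.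
by rewrite size_root_poly -addn1 addnC leq_add.
Qed.

Hypothesis z_inj : injective z.

Lemma lagrange_root_cofactor (r : {poly F}) : (size r <= n)%N ->
  r = \sum_i (r.[z i] / (root_cofactor i).[z i]) *: root_cofactor i.
Proof.
move=> rn; apply/eqP; rewrite -subr_eq0; set d := _ - _.
have dn : (size d <= n)%N.
  apply: leq_trans (size_polyD _ _) _; rewrite size_polyN geq_max rn /=.
  apply: (leq_trans (size_sum _ _ _)); apply/bigmax_leqP => i _.
  by rewrite (leq_trans (size_scale_leq _ _)) // size_root_cofactor.
have droot i : root d (z i).
  rewrite /root /d !hornerE horner_sum (bigD1 i) //= !hornerE.
  rewrite big1 => [|j ji]; last by rewrite hornerZ (root_root_cofactor ji) mulr0.
  rewrite addr0 divfK ?subrr //.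
  rewrite /root_cofactor horner_prod; apply/prodf_neq0 => j ji.
  by rewrite !hornerE subr_eq0 (inj_eq z_inj) eq_sym.
apply: contraTT dn => d0; rewrite -ltnNge.
have := @max_poly_roots _ d [seq z i | i <- enum 'I_n] d0.
rewrite size_map size_enum_ord; apply.
  by apply/allP => _ /mapP[i _ ->].
by rewrite map_inj_uniq // enum_uniq.
Qed.

End root_products.

(** * Counting the roots near a point by a complex shift *)

Section soft_count.
Variables (R : rcfType) (n : nat) (z : 'I_n -> R) (x h : R).
Hypothesis h0 : 0 < h.

Local Notation zeta := (Complex x h).

(** A smooth substitute for the indicator of [|x - z i| < h]. It is both the squared modulus of
    [upper_recip i] and, up to sign, its imaginary part. *)
Definition soft_weight i : R := h ^+ 2 / ((x - z i) ^+ 2 + h ^+ 2).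

(* h / (zeta - z i) for zeta = x + i h *)
Definition upper_recip i : R[i] :=
  Complex (h * (x - z i) / ((x - z i) ^+ 2 + h ^+ 2)) (- soft_weight i).

Let den_gt0 i : 0 < (x - z i) ^+ 2 + h ^+ 2.
Proof. by rewrite ltr_wpDl ?sqr_ge0 ?exprn_gt0. Qed.

Lemma soft_weight_ge0 i : 0 <= soft_weight i.
Proof. by rewrite divr_ge0 ?sqr_ge0 // ltW. Qed.

Lemma soft_weight_le1 i : soft_weight i <= 1.
Proof. by rewrite ler_pdivrMr // mul1r lerDr sqr_ge0. Qed.

Lemma upper_recipM i : (zeta - (z i)%:C%C) * upper_recip i = h%:C%C.
Proof.
have := den_gt0 i; rewrite lt0r => /andP[d0 _].
apply/eqP; rewrite eq_complex /=; apply/andP; split; apply/eqP;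
  rewrite /soft_weight; field; exact: d0.
Qed.

Lemma normcX2 (y : R[i]) : normc y ^+ 2 = complex.Re y ^+ 2 + complex.Im y ^+ 2.
Proof. by case: y => a b /=; rewrite sqr_sqrtr // addr_ge0 ?sqr_ge0. Qed.

Lemma normc_ge0 (y : R[i]) : 0 <= normc y.
Proof. by case: y => a b; rewrite /= sqrtr_ge0. Qed.

Lemma normr_normc (y : R[i]) : `|y| = (normc y)%:C%C.
Proof. by case: y => a b; rewrite normc_def. Qed.

Lemma normcX (y : R[i]) k : normc (y ^+ k) = normc y ^+ k.
Proof. by elim: k => [|k IHk]; rewrite ?expr0 ?normc1 // !exprS normcM IHk. Qed.

Lemma normc_sum (I : Type) (r : seq I) (P : pred I) (F : I -> R[i]) :
  normc (\sum_(i <- r | P i) F i) <= \sum_(i <- r | P i) normc (F i).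
Proof.
apply: (big_ind2 (fun y c => normc y <= c)) => // [|y1 c1 y2 c2 h1 h2].
  by rewrite normc0.
by apply: le_trans (le_normcD _ _) _; apply: lerD.
Qed.

Lemma normc_ge_Im (y : R[i]) : `|complex.Im y| <= normc y.
Proof.
rewrite -(@ler_pXn2r _ 2) ?nnegrE ?normc_ge0 //.
by rewrite normcX2 real_normK ?num_real // lerDr sqr_ge0.
Qed.

Lemma normc_upper_recip i : normc (upper_recip i) ^+ 2 = soft_weight i.
Proof.
have := den_gt0 i; rewrite lt0r => /andP[d0 _].
by rewrite normcX2 /= /soft_weight; field.
Qed.

Lemma Im_sum (I : Type) (r : seq I) (P : pred I) (F : I -> R[i]) :
  complex.Im (\sum_(i <- r | P i) F i) = \sum_(i <- r | P i) complex.Im (F i).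
Proof. by apply: (big_morph (@complex.Im R)) => // -[a b] [c d]. Qed.

(* All roots lie on one side of the line Im = h, so that no cancellation occurs
   in the imaginary part of the logarithmic derivative at zeta. *)
Lemma soft_weight_le_power_sum :
  \sum_i soft_weight i <= normc (power_sum upper_recip 1).
Proof.
apply: le_trans (normc_ge_Im _); rewrite /power_sum.
rewrite Im_sum.
have -> : \sum_i complex.Im (upper_recip i ^+ 1) = - \sum_i soft_weight i.
  by rewrite -sumrN; apply: eq_bigr.
by rewrite normrN ler_norm.
Qed.

Lemma power_sum_upper_recip_le k :
  normc (power_sum upper_recip k.+2) <= \sum_i soft_weight i.
Proof.
apply: le_trans (normc_sum _ _ _) _; apply: ler_sum => i _.
rewrite normcX -addn2 exprD normc_upper_recip ler_piMl ?soft_weight_ge0 //.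
rewrite exprn_ile1 ?normc_ge0 // -(@ler_pXn2r _ 2) ?nnegrE ?normc_ge0 //.
by rewrite normc_upper_recip expr1n soft_weight_le1.
Qed.

Hypothesis x_root : forall i, x != z i.
Hypothesis z_inj : injective z.
Variable p : nat.
Hypothesis p_gt0 : (0 < p)%N.
Hypothesis pn : (p <= n)%N.

Let Q := root_poly z.
Let r := Q^`(p).
Let c i := r.[z i] / (root_cofactor z i).[z i].

Hypothesis small :
  h ^+ p.*2 * (r.[x] ^+ 2 + \sum_i (c i * (root_cofactor z i).[x]) ^+ 2) <= Q.[x] ^+ 2.

Let toC := real_complex R.

(** With [b_i = upper_recip i], expansion around [zeta] reads [Q(zeta + h X) = Q(zeta) * \prod_i (1
    + b_i X)]; the coefficients of degree [p] are compared. *)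
Let derivn_upper : (map_poly toC r).[zeta] * h%:C%C ^+ p =
  (map_poly toC Q).[zeta] * (recip_poly upper_recip)`_p *+ p`!.
Proof.
have comp : map_poly toC Q \Po (zeta%:P + h%:C%C *: 'X) =
    (map_poly toC Q).[zeta] *: recip_poly upper_recip.
  rewrite /Q /root_poly !rmorph_prod horner_prod /=.
  rewrite /recip_poly -scaler_prod; apply: eq_bigr => i _.
  rewrite rmorphB /= map_polyX map_polyC /= comp_polyB comp_polyX comp_polyC.
  rewrite !hornerE scalerDr alg_polyC scalerA upper_recipM polyCB.
  by rewrite addrAC.
have := coef_comp_affine (map_poly toC Q) zeta h%:C%C p.
rewrite comp coefZ => ->; rewrite /r -derivn_map nderivn_def hornerMn.
by rewrite mulrnAl.
Qed.

Let CauchySchwarz_half (I : finType) (u v : I -> R) :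
  \sum_i `|u i| * `|v i| <= (\sum_i u i ^+ 2 + \sum_i v i ^+ 2) / 2.
Proof.
rewrite -big_split /= mulr_suml; apply: ler_sum => i _.
rewrite -(real_normK (num_real (u i))) -(real_normK (num_real (v i))).
have := sqr_ge0 (`|u i| - `|v i|); nra.
Qed.

Let Qx0 : Q.[x] != 0.
Proof.
by rewrite /Q horner_root_poly; apply/prodf_neq0 => i _; rewrite subr_eq0.
Qed.

Let a i := (x - z i)^-1.

Let horner_cofactor_x i : (root_cofactor z i).[x] = Q.[x] * a i.
Proof. by rewrite horner_root_cofactor. Qed.

Let rE : r = \sum_i c i *: root_cofactor z i.
Proof.
by apply: lagrange_root_cofactor => //; apply: size_derivn_root_poly.
Qed.

Let rx : r.[x] = Q.[x] * \sum_i c i * a i.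
Proof.
rewrite rE horner_sum mulr_sumr; apply: eq_bigr => i _.
by rewrite hornerZ horner_cofactor_x mulrCA.
Qed.

Let small_a : (h ^+ p * \sum_i c i * a i) ^+ 2 + \sum_i (h ^+ p * (c i * a i)) ^+ 2 <= 1.
Proof.
have Q2 : 0 < Q.[x] ^+ 2 by rewrite exprn_even_gt0 /= ?Qx0.
rewrite -(ler_pM2r Q2) mul1r; apply: le_trans small; rewrite le_eqVlt; apply/orP; left.
apply/eqP; rewrite rx -addnn exprD -expr2 mulrDl mulrDr; congr (_ + _); first by ring.
rewrite mulr_suml mulr_sumr; apply: eq_bigr => i _.
by rewrite horner_cofactor_x; ring.
Qed.

Let zeta_root i : zeta - (z i)%:C%C != 0.
Proof.
apply/eqP => e; have := upper_recipM i; rewrite e mul0r => /(@complexI R)/esym/eqP.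
by rewrite gt_eqF.
Qed.

(** Transfers the derivative from [zeta] back to the real point [x], since
    [1 / (zeta - z i) = a i * (1 - 'i * b_i)] with [b_i = upper_recip i]. The sum of the [c i * a i]
    is [r(x) / Q(x)]; the correction is bounded by Cauchy-Schwarz, which is why [small] also
    contains the individual squares. *)
Let coefE : (recip_poly upper_recip)`_p *+ p`! =
  \sum_i (h ^+ p * (c i * a i))%:C%C * (1 - 'i%C * upper_recip i).
Proof.
have QC0 : (map_poly toC Q).[zeta] != 0.
  rewrite /Q /root_poly rmorph_prod horner_prod; apply/prodf_neq0 => i _.
  by rewrite rmorphB /= map_polyX map_polyC /= !hornerE.
apply: (mulfI QC0); rewrite mulrnAr -derivn_upper rE rmorph_sum horner_sum.
rewrite mulr_suml mulr_sumr; apply: eq_bigr => i _ /=.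
have -> : map_poly toC Q = ('X - (z i)%:C%C%:P) * map_poly toC (root_cofactor z i).
  by rewrite /Q (root_polyD z i) rmorphM rmorphB /= map_polyX map_polyC.
rewrite map_polyZ hornerZ hornerM hornerXsubC.
have xz : x - z i != 0 by rewrite subr_eq0.
have -> : 1 - 'i%C * upper_recip i = (x - z i)%:C%C * (zeta - (z i)%:C%C)^-1.
  apply: (mulIf (zeta_root i)); rewrite mulfVK // mulrBl -mulrA [upper_recip i * _]mulrC.
  rewrite upper_recipM mul1r; apply/eqP; rewrite eq_complex /=; apply/andP.
  by split; apply/eqP; ring.
have -> : (h ^+ p * (c i * a i))%:C%C =
    h%:C%C ^+ p * ((c i)%:C%C * ((x - z i)%:C%C)^-1).
  by rewrite /a; move: (c i) => ci; rewrite !rmorphM rmorphXn fmorphV.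
have xzC : (x - z i)%:C%C != 0 :> R[i] by rewrite -(inj_eq (@complexI R)) in xz.
have step (cC A H B D : R[i]) : D != 0 -> B != 0 ->
    cC * A * H = D * A * (H * (cC / B) * (B / D)).
  by move=> D0 B0; field; rewrite ?D0 ?B0.
exact: step.
Qed.

(** A contribution 1 from the real sum and [(1 + W) / 2] from the correction, where the total soft
    weight [W] is at most the modulus of the first power sum. *)
Let coef_le : normc ((recip_poly upper_recip)`_p *+ p`!) <=
  3 / 2 + normc (power_sum upper_recip 1) / 2.
Proof.
rewrite coefE; under eq_bigr do rewrite mulrBr mulr1.
rewrite sumrB; apply: le_trans (le_normcD _ _) _; rewrite normcN.
have : 0 <= \sum_i (h ^+ p * (c i * a i)) ^+ 2.
  by apply: sumr_ge0 => i _; apply: sqr_ge0.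
have := small_a; have := soft_weight_le_power_sum.
set S2 := \sum_i _ ^+ 2; set W := \sum_i soft_weight i.
have -> : \sum_i (h ^+ p * (c i * a i))%:C%C = (h ^+ p * \sum_i c i * a i)%:C%C :> R[i].
  by rewrite mulr_sumr rmorph_sum.
have le1 (y : R) : y ^+ 2 <= 1 -> normc y%:C%C <= 1.
  by move=> y1; rewrite -(@ler_pXn2r _ 2) ?nnegrE ?normc_ge0 // normcX2 /= expr0n addr0 expr1n.
have le2 : normc (\sum_i (h ^+ p * (c i * a i))%:C%C * ('i%C * upper_recip i)) <= (S2 + W) / 2.
  apply: le_trans (normc_sum _ _ _) _.
  have := CauchySchwarz_half (fun i => h ^+ p * (c i * a i)) (fun i => normc (upper_recip i)).
  have -> : \sum_i normc (upper_recip i) ^+ 2 = W.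
    by apply: eq_bigr => i _; rewrite normc_upper_recip.
  rewrite -/S2; apply: le_trans; apply: ler_sum => i _.
  rewrite !normcM /= expr0n expr1n /= add0r sqrtr1 mul1r addr0 sqrtr_sqr.
  by rewrite ler_wpM2l // ler_norm.
move=> hW hs S20; have h1 : normc (h ^+ p * \sum_i c i * a i)%:C%C <= 1.
  by apply: le1; apply: le_trans hs; rewrite lerDl.
have := sqr_ge0 (h ^+ p * \sum_i c i * a i).
move: hs le2 h1 hW S20; set X := normc _; set Y := normc _; set Z := normc _.
by set V := _ ^+ 2; lra.
Qed.

(** With [L] the modulus of the first power sum, [recip_poly_coef_pow_sub] and [coef_le] give [L ^+
    p - p! * L ^+ (p - 1) <= 3 / 2 + L / 2], which fails as soon as [L > 2 * p! + 4]. *)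
Lemma soft_count : normc (power_sum upper_recip 1) <= (p`!).*2%:R + 4.
Proof.
set L := normc _; rewrite leNgt; apply/negP => hL.
have L1 : 1 <= L.
  by apply: le_trans (ltW hL); have := ler0n R (p`!).*2; lra.
have := @recip_poly_coef_pow_sub _ n upper_recip L%:C%C _ _ _ p.-1.
rewrite prednK // -(rmorph1 (real_complex R)) lecR L1 => /(_ isT).
rewrite normr_normc -/L => /(_ erefl).
have hk k : `|power_sum upper_recip k.+2| <= L%:C%C.
  by rewrite normr_normc lecR (le_trans (power_sum_upper_recip_le _)) // soft_weight_le_power_sum.
move=> /(_ hk); rewrite normr_normc -rmorphXn -rmorphMn lecR => hp.
have h1 : L ^+ p <= normc ((recip_poly upper_recip)`_p *+ p`!) + L ^+ p.-1 *+ p`!.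
  rewrite -normcX -[X in normc X](subrK ((recip_poly upper_recip)`_p *+ p`!)) addrC.
  by apply: le_trans (le_normcD _ _) _; rewrite lerD2l -normcN opprB.
have h2 := le_trans h1 (lerD coef_le (lexx _)).
have : L ^+ p - L ^+ p.-1 *+ p`! <= 3 / 2 + L / 2 by rewrite lerBlDr.
rewrite -[in L ^+ p](prednK p_gt0) exprS -mulr_natl -mulrBl.
have e1 : 1 <= L ^+ p.-1 by rewrite exprn_ege1.
move: hL; rewrite -muln2 natrM => hL; apply/negP; rewrite -ltNge.
apply: lt_le_trans (_ : (L - p`!%:R) * 1 <= _); last by rewrite ler_wpM2l //; have := ler0n R p`!; lra.
have := ler0n R p`!; lra.
Qed.
End soft_count.

(** * Local approximation by polynomials of bounded degree *)

Section horner_bounds.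
Variable R : realFieldType.

Lemma geometric_sum_le (t : R) m : 0 <= t <= 4^-1 -> \sum_(k < m) t ^+ k <= 4 / 3.
Proof.
move=> /andP[t0 t1]; have h : 0 < 1 - t by lra.
rewrite -(ler_pM2l h) -[_ * \sum_(_ < _) _]opprK -mulNr opprB -subrX1.
have := exprn_ge0 m t0; lra.
Qed.

Lemma horner_geometric_le (P : {poly R}) (A Q s : R) :
  0 <= A -> 0 <= Q -> (forall k, `|P`_k| <= A * Q ^+ k) -> `|s| * Q <= 4^-1 ->
  `|P.[s]| <= A * (4 / 3).
Proof.
move=> A0 Q0 hP hs; rewrite horner_coef.
apply: le_trans (ler_norm_sum _ _ _) _.
have h : 0 <= `|s| * Q <= 4^-1 by rewrite hs mulr_ge0.
apply: le_trans (ler_wpM2l A0 (geometric_sum_le (size P) h)).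
rewrite mulr_sumr; apply: ler_sum => k _.
rewrite normrM normrX exprMn [ `|s| ^+ _ * _]mulrC mulrA.
by rewrite ler_wpM2r ?exprn_ge0.
Qed.

(** The error is relative to [F.[s]]: the remainder is at most [4 / 3 * (|s| * Q) ^+ p], and
    [|F.[s]| >= 2 / 3] because the constant term is 1 and the other terms contribute at most
    [1 / 3]. *)
Lemma poly_take_drop_error (F : {poly R}) (Q s : R) p : (0 < p)%N ->
  F`_0 = 1 -> 0 <= Q -> (forall k, `|F`_k| <= Q ^+ k) -> `|s| * Q <= 4^-1 ->
  `|F.[s] - (take_poly p F).[s]| <= 2 * (`|s| * Q) ^+ p * `|F.[s]|.
Proof.
move=> p0 F0 Q0 hF hs.
have drop_le k : `|(drop_poly k F).[s]| <= Q ^+ k * (4 / 3).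
  apply: (@horner_geometric_le _ _ Q) => //; first exact: exprn_ge0.
  by move=> i; rewrite coef_drop_poly -exprD addnC.
have lower : 2 / 3 <= `|F.[s]|.
  have -> : F.[s] = 1 + s * (drop_poly 1 F).[s].
    rewrite -[in LHS](poly_take_drop 1 F) hornerD hornerM hornerXn expr1 mulrC; congr (_ + _).
    have -> : take_poly 1 F = 1%:P.
      by apply/polyP => -[|i]; rewrite coef_take_poly coefC.
    by rewrite hornerC.
  have h1 := drop_le 1%N; rewrite expr1 in h1.
  have h2 : `|s * (drop_poly 1 F).[s]| <= 1 / 3.
    rewrite normrM; apply: le_trans (ler_wpM2l (normr_ge0 s) h1) _.
    by rewrite mulrA; lra.
  have := lerB_normD 1 (s * (drop_poly 1 F).[s]); rewrite normr1; lra.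
have -> : F.[s] - (take_poly p F).[s] = s ^+ p * (drop_poly p F).[s].
  rewrite -[in X in X - _](poly_take_drop p F) hornerD hornerM hornerXn mulrC.
  by rewrite addrC addKr mulrC.
rewrite normrM normrX exprMn; apply: le_trans (ler_wpM2l _ (drop_le p)) _.
  by rewrite exprn_ge0.
have := mulr_ge0 (exprn_ge0 p (normr_ge0 s)) (exprn_ge0 p Q0).
rewrite mulrA; set t := _ * _; nra.
Qed.
End horner_bounds.

Section local_approx.
Variables (R : rcfType) (n : nat) (z : 'I_n -> R) (x h : R) (Lam : R).
Hypothesis h0 : 0 < h.
Hypothesis Lam1 : 1 <= Lam.
Hypothesis x_root : forall i, x != z i.
Hypothesis soft : normc (power_sum (upper_recip z x h) 1) <= Lam.

Let W i := soft_weight z x h i.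
Let far i := h <= `|x - z i|.

Let sumW : \sum_i W i <= Lam.
Proof. by apply: le_trans soft; apply: soft_weight_le_power_sum. Qed.

Let W0 i : 0 <= W i. Proof. exact: soft_weight_ge0. Qed.

Let den0 i : (x - z i) ^+ 2 + h ^+ 2 != 0.
Proof. by rewrite gt_eqF // ltr_wpDl ?sqr_ge0 ?exprn_gt0. Qed.

Lemma near_weight i : ~~ far i -> 1 <= 2 * W i.
Proof.
rewrite -ltNge => hi; rewrite /W /soft_weight mulrA ler_pdivlMr; last first.
  by rewrite lt0r den0 addr_ge0 ?sqr_ge0.
have : `|x - z i| ^+ 2 <= h ^+ 2 by rewrite ler_pXn2r ?nnegrE // ltW.
rewrite real_normK ?num_real //; lra.
Qed.

Lemma near_count : #|[pred i | ~~ far i]|%:R <= 2 * Lam.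
Proof.
rewrite -sum1_card natr_sum; apply: le_trans (_ : \sum_i 2 * W i <= _).
  rewrite big_mkcond /=; apply: ler_sum => i _; case: ifP => [|_]; first exact: near_weight.
  by rewrite mulr_ge0.
by rewrite -mulr_sumr ler_wpM2l.
Qed.

Definition far_recip i : R := if far i then h / (x - z i) else 0.

Let far_recip_le1 i : `|far_recip i| <= 1.
Proof.
rewrite /far_recip; case: ifP => [fi|_]; last by rewrite normr0 ler01.
by rewrite normrM normfV gtr0_norm // ler_pdivrMr ?mul1r // normr_gt0 subr_eq0.
Qed.

Let far_recip2 i : far_recip i ^+ 2 <= 2 * W i.
Proof.
rewrite /far_recip; case: ifP => [fi|_]; last by rewrite expr0n mulr_ge0.
have x0 : x - z i != 0 by rewrite subr_eq0.
have : h ^+ 2 <= (x - z i) ^+ 2.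
  by rewrite -(real_normK (num_real (x - z i))) ler_pXn2r ?nnegrE // ltW.
have u0 : 0 < (x - z i) ^+ 2 by rewrite exprn_even_gt0.
rewrite /W /soft_weight expr_div_n mulrA ler_pdivlMr; last first.
  by rewrite lt0r den0 addr_ge0 ?sqr_ge0.
rewrite mulrAC ler_pdivrMr //; have := sqr_ge0 h; nra.
Qed.

(** From the second power on, twice the total soft weight is a bound. The first sum needs its
    cancellations: it is compared with the real part of the complex sum, which costs at most
    [2 * W i] per root. *)
Lemma power_sum_far k : `|power_sum far_recip k.+1| <= 4 * Lam.
Proof.
case: k => [|k]; last first.
  apply: le_trans (ler_norm_sum _ _ _) _.
  apply: le_trans (_ : \sum_i 2 * W i <= _).
    apply: ler_sum => i _; rewrite -addn2 exprD normrM.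
    rewrite [ `|_ ^+ 2|]ger0_norm ?sqr_ge0 //.
    apply: le_trans (far_recip2 i); rewrite ler_piMl ?sqr_ge0 //.
    by rewrite normrX exprn_ile1.
  by rewrite -mulr_sumr; have := sumW; have := Lam1; set S := \sum_i _; lra.
pose re i := complex.Re (upper_recip z x h i).
have reE : `|\sum_i re i| <= Lam.
  apply: le_trans soft; rewrite /power_sum -(@ler_pXn2r _ 2) ?nnegrE ?normc_ge0 //.
  rewrite normcX2 real_normK ?num_real //.
  have -> : \sum_i re i = complex.Re (\sum_i upper_recip z x h i ^+ 1).
    by symmetry; apply: (big_morph (@complex.Re R)) => // -[? ?] [? ?].
  by rewrite lerDl sqr_ge0.
have -> : power_sum far_recip 1 = \sum_i re i + \sum_i (far_recip i - re i).
  by rewrite -big_split; apply: eq_bigr => i _ /=; rewrite expr1 addrC subrK.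
apply: le_trans (ler_normD _ _) _.
suff : `|\sum_i (far_recip i - re i)| <= 2 * Lam by have := Lam1; lra.
apply: le_trans (ler_norm_sum _ _ _) _.
apply: le_trans (_ : \sum_i 2 * W i <= _); last by rewrite -mulr_sumr ler_wpM2l.
apply: ler_sum => i _; rewrite /far_recip.
case: ifP => [fi|/negbT ni].
  have x0 : x - z i != 0 by rewrite subr_eq0.
  have -> : h / (x - z i) - re i = far_recip i * W i.
    rewrite /far_recip fi /re /= /W /soft_weight; field.
    by rewrite x0 den0.
  rewrite normrM [ `|W i|]ger0_norm //.
  apply: le_trans (ler_wpM2r (W0 i) (far_recip_le1 i)) _.
  by have := W0 i; lra.
rewrite sub0r normrN; apply: le_trans (near_weight ni).
rewrite -(@ler_pXn2r _ 2) ?nnegrE // real_normK ?num_real // expr1n.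
apply: (@le_trans _ _ (W i)); last exact: soft_weight_le1.
by rewrite /W -normc_upper_recip // normcX2 lerDl sqr_ge0.
Qed.

(** Around [x] the polynomial is a constant times the product over the near roots times
    [F((y - x) / h)], where [F] is the [recip_poly] of the far roots. The near roots are kept and
    [F] is truncated at order [p]. *)
Lemma soft_local_approx (p : nat) (rho : R) : (0 < p)%N -> 0 < rho ->
  rho / h * (4 * Lam) <= 4^-1 ->
  exists v : {poly R}, (size v <= #|[pred i | ~~ far i]| + p)%N /\
  forall y, `|y - x| <= rho ->
    `|(root_poly z).[y] - v.[y]| <= 2 * (rho / h * (4 * Lam)) ^+ p * `|(root_poly z).[y]|.
Proof.
move=> p0 rho0 small.
pose F := recip_poly far_recip.
pose N := \prod_(i | ~~ far i) ('X - (z i)%:P).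
pose c := \prod_(i | far i) (x - z i).
have h_neq0 : h != 0 by rewrite gt_eqF.
have QE y : (root_poly z).[y] = c * N.[y] * F.[(y - x) / h].
  rewrite horner_root_poly (bigID far) /= mulrC [c * _]mulrC -mulrA; congr (_ * _).
    by rewrite /N horner_prod; apply: eq_bigr => i _; rewrite !hornerE.
  rewrite /F /recip_poly horner_prod [in RHS](bigID far) /=.
  rewrite [X in _ = c * (_ * X)]big1; last first.
    by move=> i fi; rewrite /far_recip (negbTE fi) scale0r addr0 hornerC.
  rewrite mulr1 /c -big_split /=; apply: eq_bigr => i fi.
  have x0 : x - z i != 0 by rewrite subr_eq0.
  by rewrite hornerD hornerC hornerZ hornerX /far_recip fi; field; rewrite x0 h_neq0.
exists (c *: N * (take_poly p F \Po (h^-1 *: ('X - x%:P)))); split.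
  rewrite -scalerAl; apply: leq_trans (size_scale_leq _ _) _.
  apply: leq_trans (size_polyMleq _ _) _.
  have -> : size N = (#|[pred i | ~~ far i]|).+1.
    rewrite /N -big_filter size_prod_XsubC; congr _.+1.
    by rewrite -sum1_card -sum1_size big_filter.
  rewrite addSn /= leq_add2l; apply: leq_trans (size_comp_poly_leq _ _) _.
  have -> : size (h^-1 *: ('X - x%:P)) = 2%N by rewrite size_scale ?invr_eq0 // size_XsubC.
  rewrite muln1; apply: (@leq_trans (size (take_poly p F)).-1.+1) => //.
  by case: (size _) (size_take_poly p F) => //.
move=> y hy; rewrite QE hornerM hornerZ horner_comp hornerZ hornerXsubC.
rewrite [h^-1 * _]mulrC -mulrBr !normrM mulrCA.
rewrite ler_wpM2l // -?normrM //.
have hs : `|(y - x) / h| <= rho / h.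
  by rewrite normrM normfV (gtr0_norm h0) ler_pM2r ?invr_gt0.
have L40 : 0 <= 4 * Lam by have := Lam1; lra.
have L41 : 1 <= 4 * Lam by have := Lam1; lra.
have hs4 : `|(y - x) / h| * (4 * Lam) <= rho / h * (4 * Lam) by rewrite ler_wpM2r.
apply: le_trans (poly_take_drop_error p0 _ L40 _ (le_trans hs4 small)) _.
- exact: coef0_recip_poly.
- exact: recip_poly_coef_le L41 power_sum_far.
rewrite ler_wpM2r // ler_wpM2l // ler_pXn2r // nnegrE mulr_ge0 //.
by rewrite divr_ge0 // ltW.
Qed.
End local_approx.

Section pointwise_approx.
Variable R : rcfType.

Lemma rcf_root_exists k (c : R) : (0 < k)%N -> 0 < c -> exists2 h : R, 0 < h & h ^+ k = c.
Proof.
move=> k0 c0.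
have [||y /andP[yb _] /rootP] := @poly_ivt R ('X^k - c%:P) 0 (1 + c).
- by rewrite addr_ge0 // ltW.
- rewrite !(hornerD, hornerN, hornerXn, hornerC) expr0n gtn_eqF // sub0r oppr_le0 (ltW c0) subr_ge0 /=.
  apply: (@le_trans _ _ (1 + c)); first by rewrite lerDr ler01.
  by rewrite ler_eXnr // lerDl ltW.
rewrite !(hornerD, hornerN, hornerXn, hornerC) => /eqP; rewrite subr_eq0 => /eqP yk.
exists y => //; rewrite lt0r yb andbT; apply: contraTneq c0 => y0.
by rewrite -yk y0 expr0n gtn_eqF // ltxx.
Qed.

Definition deriv_residue n (z : 'I_n -> R) p i : R :=
  (root_poly z)^`(p).[z i] / (root_cofactor z i).[z i].

(* For an orthogonal polynomial q, Gauss quadrature makes the terms of the Lagrange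
   expansion of q^(p) at the roots of q orthogonal, so both summands have the same
   integral; pointwise, only their sum dominates q^2 in the sense of
   [local_poly_approx]. *)
Definition deriv_square n (z : 'I_n -> R) p : {poly R} :=
  ((root_poly z)^`(p)) ^+ 2 +
  \sum_i (deriv_residue z p i *: root_cofactor z i) ^+ 2.

Lemma horner_deriv_square n (z : 'I_n -> R) p x : (deriv_square z p).[x] =
  (root_poly z)^`(p).[x] ^+ 2 +
  \sum_i (deriv_residue z p i * (root_cofactor z i).[x]) ^+ 2.
Proof.
rewrite /deriv_square hornerD horner_exp horner_sum; congr (_ + _).
by apply: eq_bigr => i _; rewrite horner_exp hornerZ.
Qed.

Lemma derivn_root_poly_residues n (z : 'I_n -> R) p : injective z -> (0 < p)%N ->
  (root_poly z)^`(p) = \sum_i deriv_residue z p i *: root_cofactor z i.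
Proof.
by move=> zi p0; apply: lagrange_root_cofactor => //; apply: size_derivn_root_poly.
Qed.

Lemma deriv_square_gt0 n (z : 'I_n -> R) p x : injective z -> (0 < p <= n)%N ->
  (forall i, x != z i) -> 0 < (deriv_square z p).[x].
Proof.
move=> zi /andP[p0 pn] xz; rewrite horner_deriv_square lt0r.
have s0 : 0 <= \sum_i (deriv_residue z p i * (root_cofactor z i).[x]) ^+ 2.
  by apply: sumr_ge0 => i _; apply: sqr_ge0.
rewrite addr_ge0 ?sqr_ge0 // andbT paddr_eq0 ?sqr_ge0 // negb_and orbC.
apply/orP; left; rewrite psumr_eq0 => [|i _]; last exact: sqr_ge0.
apply/negP => /allP h.
have : (root_poly z)^`(p) != 0.
  apply/negP => /eqP /(congr1 (fun P : {poly R} => P`_(n - p))).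
  rewrite coef_derivn subnKC // coef0 => /eqP.
  have -> : (root_poly z)`_n = 1.
    have /monicP := monic_prod_XsubC (index_enum 'I_n) xpredT z.
    by rewrite lead_coefE -/(root_poly z) size_root_poly.
  by apply/negP; rewrite pnatr_eq0 -lt0n ffact_gt0 pn.
rewrite derivn_root_poly_residues // big1 ?eqxx // => i _.
have := h i (mem_index_enum i); rewrite /= sqrf_eq0 mulf_eq0 => /orP[/eqP ->|].
  by rewrite scale0r.
by rewrite /root_cofactor horner_prod => /prodf_eq0[j _]; rewrite hornerXsubC subr_eq0 (negbTE (xz j)).
Qed.

(** The scale [h] is chosen so that the hypothesis of [soft_count] holds with equality. If [rho] is
    small compared with [h], [soft_local_approx] applies; otherwise the right-hand side is at least
    [Q(y) ^+ 2 * Q(x) ^+ 2] and [v = 0] will do. Denominators are cleared so that the bound can be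
    integrated in [x]. *)
Lemma local_poly_approx p : (0 < p)%N -> exists (D : nat) (C : R), 0 < C /\
  forall n (z : 'I_n -> R) (x rho : R), injective z -> (p <= n)%N ->
    (root_poly z).[x] != 0 -> 0 < rho ->
  exists v : {poly R}, (size v <= D)%N /\ forall y, `|y - x| <= rho ->
    ((root_poly z).[y] - v.[y]) ^+ 2 * (root_poly z).[x] ^+ 2 <=
    C * rho ^+ p.*2 * (deriv_square z p).[x] * (root_poly z).[y] ^+ 2.
Proof.
move=> p0; set Lam : R := (p`!).*2%:R + 4.
have Lam1 : 1 <= Lam by have := ler0n R (p`!).*2; rewrite /Lam; lra.
have Lam0 : 0 <= Lam by apply: le_trans Lam1.
(* At most [2 * Lam] near roots, plus [p] for the truncation. The factor 16 makes the base exceed 1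
   when [rho / h * (4 * Lam) > 1 / 4]. *)
exists ((p`!).*2 * 2 + 8 + p)%N, (4 * (16 * Lam) ^+ p.*2); split.
  by rewrite mulr_gt0 // exprn_gt0 // mulr_gt0 // (lt_le_trans _ Lam1).
move=> n z x rho zi pn Qx rho0.
have xz i : x != z i.
  by apply: contraNneq Qx => ->; rewrite (root_polyD z i) hornerM hornerXsubC subrr mul0r.
have H0 := deriv_square_gt0 zi (introT andP (conj p0 pn)) xz.
have Q0 : 0 < (root_poly z).[x] ^+ 2 by rewrite exprn_even_gt0.
set H := (deriv_square z p).[x] in H0 *.
have [||h h0 hE] := @rcf_root_exists p.*2 ((root_poly z).[x] ^+ 2 / H).
- by rewrite double_gt0.
- by rewrite divr_gt0.
have hH : h ^+ p.*2 * H = (root_poly z).[x] ^+ 2 by rewrite hE divfK // gt_eqF.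
have rhoH : rho ^+ p.*2 * H = (rho / h) ^+ p.*2 * (root_poly z).[x] ^+ 2.
  by rewrite expr_div_n -hH mulrA divfK // expf_neq0 // gt_eqF.
have soft : normc (power_sum (upper_recip z x h) 1) <= Lam.
  by apply: soft_count => //; rewrite -horner_deriv_square -/H hH lexx.
have g0 : 0 <= rho / h by rewrite divr_ge0 // ltW.
have CE y : 4 * (16 * Lam) ^+ p.*2 * rho ^+ p.*2 * H * (root_poly z).[y] ^+ 2 =
    4 * (rho / h * (16 * Lam)) ^+ p.*2 * (root_poly z).[y] ^+ 2 * (root_poly z).[x] ^+ 2.
  by rewrite -[_ * rho ^+ _ * H]mulrA rhoH [in RHS](exprMn _ (rho / h)); ring.
have [gs|gl] := leP (rho / h * (4 * Lam)) 4^-1.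
  have [v [sv vP]] := soft_local_approx h0 Lam1 xz soft p0 rho0 gs.
  exists v; split.
    apply: (leq_trans sv); rewrite leq_add2r -(@ler_nat R).
    apply: le_trans (near_count h0 soft) _.
    by rewrite natrD natrM /Lam; lra.
  move=> y /vP hy; rewrite CE ler_pM2r // -(real_normK (num_real (_ - v.[y]))).
  rewrite -(real_normK (num_real (root_poly z).[y])).
  have t1 : (rho / h * (4 * Lam)) ^+ p <= (rho / h * (16 * Lam)) ^+ p.
    have q1 : 0 <= rho / h * (4 * Lam) by rewrite mulr_ge0 // mulr_ge0.
    have q2 : rho / h * (4 * Lam) <= rho / h * (16 * Lam).
      by rewrite ler_wpM2l //; lra.
    by rewrite ler_pXn2r // nnegrE ?(le_trans q1).
  have {}hy := le_trans hy (ler_wpM2r (normr_ge0 _) (ler_wpM2l (ler0n _ 2) t1)).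
  have -> : 4 * (rho / h * (16 * Lam)) ^+ p.*2 * `|(root_poly z).[y]| ^+ 2 =
      (2 * (rho / h * (16 * Lam)) ^+ p * `|(root_poly z).[y]|) ^+ 2.
    by rewrite -muln2 exprM; ring.
  apply: lerXn2r => //; rewrite nnegrE ?normr_ge0 //.
  exact: le_trans (normr_ge0 _) hy.
exists 0; split; first by rewrite size_poly0.
move=> y _; rewrite horner0 subr0 CE ler_pM2r // ler_peMl ?sqr_ge0 //.
have : 1 <= (rho / h * (16 * Lam)) ^+ p.*2 by rewrite exprn_ege1 //; lra.
lra.
Qed.
End pointwise_approx.

(** * Packing and widths *)

Section spanner.
Variables (R : archiRealFieldType) (d : nat).

Definition set_row (V : 'M[R]_d) (k : 'I_d) (x : 'rV[R]_d) : 'M[R]_d :=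
  \matrix_(i, j) if i == k then x 0 j else V i j.

Lemma cramer_row (V : 'M[R]_d) (k : 'I_d) (x : 'rV[R]_d) : \det V != 0 ->
  (x *m invmx V) 0 k = \det (set_row V k x) / \det V.
Proof.
move=> V0; rewrite /invmx unitmxE unitfE V0 -scalemxAr mxE mulrC; congr (_ / _).
rewrite (expand_det_row _ k) mxE; apply: eq_bigr => l _.
rewrite !mxE eqxx; congr (_ * _); rewrite /cofactor; congr (_ * \det _).
apply/matrixP => i j; rewrite !mxE eq_sym (negbTE (neq_lift _ _)) //.
Qed.

Variable N : 'rV[R]_d -> R.
Hypothesis N_ge0 : forall x, 0 <= N x.
Hypothesis N_add : forall x y, N (x + y) <= N x + N y.
Hypothesis N_scale : forall c x, N (c *: x) = `|c| * N x.

Lemma seminorm_sum (I : Type) (r : seq I) (P : pred I) (F : I -> 'rV[R]_d) :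
  N (\sum_(i <- r | P i) F i) <= \sum_(i <- r | P i) N (F i).
Proof.
apply: (big_ind2 (fun x y => N x <= y)) => // [|x1 y1 x2 y2 h1 h2].
  by rewrite -(scale0r 0) N_scale normr0 mul0r.
by apply: le_trans (N_add _ _) _; apply: lerD.
Qed.

(* Vectors maximizing the determinant among the given ones (and small multiples
   of the canonical basis) express all of them with coefficients in [-1, 1]. *)
Lemma barycentric_spanner (I : finType) (x : I -> 'rV[R]_d) :
  (forall i, N (x i) <= 1) ->
  exists V : 'M[R]_d, [/\ V \in unitmx, forall k, N (row k V) <= 1 &
    forall i k, `|(x i *m invmx V) 0 k| <= 1].
Proof.
move=> x1.
pose J := (I + 'I_d)%type.
pose e (k : 'I_d) : 'rV[R]_d := (1 + N (delta_mx 0 k))^-1 *: delta_mx 0 k.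
pose y (j : J) := match j with inl i => x i | inr k => e k end.
have e0 k : 0 < 1 + N (delta_mx 0 k) by rewrite ltr_wpDr.
have y1 j : N (y j) <= 1.
  case: j => [i|k] //=; rewrite N_scale gtr0_norm ?invr_gt0 //.
  by rewrite mulrC ler_pdivrMr // mul1r lerDr ler01.
pose M (f : {ffun 'I_d -> J}) : 'M[R]_d := \matrix_(i, j) y (f i) 0 j.
pose f0 : {ffun 'I_d -> J} := [ffun k => inr k].
case: (@Order.TotalTheory.arg_maxP _ _ _ f0 xpredT (fun f => `|\det (M f)|) isT) => f _ fmax.
have M0 : \det (M f) != 0.
  rewrite -normr_gt0; apply: lt_le_trans (fmax f0 isT).
  have -> : M f0 = diag_mx (\row_k (1 + N (delta_mx 0 k))^-1).
    apply/matrixP => i j; rewrite !mxE ffunE /= !mxE eqxx /=.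
    by rewrite eq_sym; case: eqP => [->|_]; rewrite ?mulr1 ?mulr0 ?mulr1n ?mulr0n.
  rewrite det_diag normr_gt0; apply/prodf_neq0 => k _.
  by rewrite mxE invr_neq0 // gt_eqF.
exists (M f); split=> [|k|i k]; first by rewrite unitmxE unitfE.
  have -> : row k (M f) = y (f k) by apply/rowP => j; rewrite !mxE.
  exact: y1.
rewrite cramer_row // normrM normfV ler_pdivrMr ?normr_gt0 // mul1r.
pose g : {ffun 'I_d -> J} := [ffun l => if l == k then inl i else f l].
have -> : set_row (M f) k (x i) = M g.
  by apply/matrixP => l j; rewrite !mxE ffunE; case: eqP.
exact: fmax.
Qed.

(** Coordinates on a spanner lie in [[-1, 1]] and are rounded to a grid of mesh [1 / K]. Two vectors
    with the same rounding differ by at most [d / K] in the seminorm, so rounding is injective on a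
    separated family. *)
Lemma separated_family_card (K : nat) (I : finType) (x : I -> 'rV[R]_d) :
  (forall i, N (x i) <= 1) ->
  (forall i j, i != j -> d%:R < N (x i - x j) * K%:R) ->
  (#|I| <= (K.*2).+1 ^ d)%N.
Proof.
move=> x1 sep; have [V [Vu V1 t1]] := barycentric_spanner x1.
pose t i := x i *m invmx V; have tE i : x i = t i *m V by rewrite mulmxKV.
have t2 i (k : 'I_d) : 0 <= (t i 0 k + 1) * K%:R <= K.*2%:R.
  have := t1 i k; rewrite -/(t i) ler_norml => /andP[h1 h2].
  rewrite mulr_ge0 ?ler0n //=; last lra.
  by rewrite -muln2 mulnC natrM ler_wpM2r ?ler0n //; lra.
have cP i (k : 'I_d) : (Num.truncn ((t i 0 k + 1) * K%:R)%R < (K.*2).+1)%N.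
  have /andP[h1 h2] := t2 i k.
  by rewrite ltnS -(@ler_nat R) (le_trans _ h2) // truncn_le.
pose c i : {ffun 'I_d -> 'I_(K.*2).+1} := [ffun k => Ordinal (cP i k)].
suff c_inj : injective c.
  by have := leq_card c c_inj; rewrite card_ffun !card_ord.
move=> i j cij; apply/eqP; apply: contraT => /sep; rewrite ltNge => /negP; case.
have dt k : `|t i 0 k - t j 0 k| * K%:R <= 1.
  have /(congr1 val) : c i k = c j k by rewrite cij.
  rewrite !ffunE /= => ck; have /andP[hi _] := t2 i k; have /andP[hj _] := t2 j k.
  have := truncn_itv hi; have := truncn_itv hj; rewrite -ck.
  set z := Num.truncn _; rewrite -natr1 => /andP[a1 a2] /andP[b1 b2].
  rewrite -[K%:R]normr_nat -normrM mulrBl ler_norml; apply/andP; split; lra.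
have -> : x i - x j = \sum_k (t i 0 k - t j 0 k) *: row k V.
  rewrite !tE -mulmxBl; apply/rowP => l; rewrite !mxE summxE.
  by apply: eq_bigr => k _; rewrite !mxE.
apply: le_trans (ler_wpM2r (ler0n _ K) (seminorm_sum _ _ _)) _.
have -> : d%:R = \sum_(k < d) (1 : R) by rewrite sumr_const card_ord.
rewrite mulr_suml.
apply: ler_sum => k _; rewrite N_scale mulrAC.
by apply: le_trans (dt k); apply: ler_piMr; rewrite ?mulr_ge0 // ler0n.
Qed.
End spanner.

(** * Kolmogorov widths from traces *)

Section greedy.
Variables (R : realFieldType).

Definition qform J (B : 'M[R]_J) (c : 'rV[R]_J) : R := (c *m B *m c^T) 0 0.

Lemma psd_trace_ge0 J (B : 'M[R]_J) : (forall c, 0 <= qform B c) -> 0 <= \tr B.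
Proof.
move=> B0; apply: sumr_ge0 => i _; have := B0 (delta_mx 0 i).
by rewrite /qform -rowE mxE (bigD1 i) //= !mxE !eqxx mulr1 big1 ?addr0 // => j /negbTE ji;
   rewrite !mxE ji mulr0.
Qed.

(** Orthogonal projection onto the complement of the line of [c0]. *)
Definition off_proj J (c0 : 'rV[R]_J) : 'M[R]_J :=
  1%:M - (qform 1%:M c0)^-1 *: (c0^T *m c0).

Lemma qform1 J (c : 'rV[R]_J) : qform 1%:M c = \sum_i c 0 i ^+ 2.
Proof. by rewrite /qform mulmx1 mxE; apply: eq_bigr => i _; rewrite mxE expr2. Qed.

Lemma qform1_ge0 J (c : 'rV[R]_J) : 0 <= qform 1%:M c.
Proof. by rewrite qform1; apply: sumr_ge0 => i _; apply: sqr_ge0. Qed.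

Lemma mul_off_proj J (c0 c : 'rV[R]_J) :
  c *m off_proj c0 = c - ((qform 1%:M c0)^-1 * (c *m c0^T) 0 0) *: c0.
Proof.
rewrite /off_proj mulmxBr mulmx1 -scalemxAr mulmxA; congr (_ - _).
rewrite -scalerA; congr (_ *: _).
by rewrite [c *m c0^T]mx11_scalar mul_scalar_mx !mxE.
Qed.

Lemma tr_off_proj J (c0 : 'rV[R]_J) : (off_proj c0)^T = off_proj c0.
Proof. by rewrite /off_proj linearB linearZ /= trmx_mul trmxK trmx1. Qed.

Lemma qform_off_proj J (B : 'M[R]_J) (c0 c : 'rV[R]_J) :
  qform (off_proj c0 *m B *m off_proj c0) c = qform B (c *m off_proj c0).
Proof. by rewrite /qform trmx_mul tr_off_proj !mulmxA. Qed.

(** The projection is idempotent, so splitting off [c0] lowers the trace by exactly the Rayleigh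
    quotient of [c0]. *)
Lemma trace_off_proj J (B : 'M[R]_J) (c0 : 'rV[R]_J) : 0 < qform 1%:M c0 ->
  \tr (off_proj c0 *m B *m off_proj c0) = \tr B - (qform 1%:M c0)^-1 * qform B c0.
Proof.
move=> n0; rewrite -mulmxA mxtrace_mulC.
have -> : B *m off_proj c0 *m off_proj c0 = B *m off_proj c0.
  rewrite -mulmxA; congr (_ *m _).
  rewrite {1}/off_proj mulmxBl mul1mx -scalemxAl -mulmxA mul_off_proj.
  have -> : (qform 1%:M c0)^-1 * (c0 *m c0^T) 0 0 = 1.
    have e : qform 1%:M c0 = (c0 *m c0^T) 0 0 by rewrite /qform mulmx1.
    by rewrite e mulVf // -e gt_eqF.
  by rewrite scale1r subrr mulmx0 scaler0 subr0.
rewrite /off_proj mulmxBr mulmx1 linearB /= -scalemxAr linearZ /= mulmxA.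
rewrite mxtrace_mulC mulmxA; congr (_ - _ * _).
by rewrite /qform /mxtrace big_ord1.
Qed.

Lemma stretched_direction J (B : 'M[R]_J) tau (c0 : 'rV[R]_J) : 0 <= tau ->
  tau * qform 1%:M c0 < qform B c0 -> 0 < qform 1%:M c0.
Proof.
move=> t0; rewrite lt0r qform1_ge0 andbT => h; apply: contraTneq h => /eqP.
rewrite qform1 psumr_eq0 => [/allP c00|i _]; last exact: sqr_ge0.
have -> : c0 = 0.
  apply/rowP => i; rewrite mxE; apply/eqP.
  by have := c00 i (mem_index_enum _); rewrite /= sqrf_eq0.
rewrite /qform !mul0mx big1 => [|i _]; last by rewrite mxE expr0n.
by rewrite mulr0 mxE ltxx.
Qed.

(* Kolmogorov widths of a Hilbert-Schmidt map, without singular values: as long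
   as some direction is stretched by more than tau, split it off; this lowers the
   trace by more than tau. *)
Lemma gram_width (J k : nat) (B : 'M[R]_J) (tau : R) :
  0 <= tau -> (forall c, 0 <= qform B c) -> \tr B <= k%:R * tau ->
  exists e : 'I_k -> 'rV[R]_J, forall c, exists y : 'I_k -> R,
    qform B (c - \sum_i y i *: e i) <= tau * qform 1%:M c.
Proof.
move=> tau0; elim: k B => [|k IHk] B B0 trB;
  case: (EM (forall c, qform B c <= tau * qform 1%:M c)) => [hB|].
- by exists (fun _ => 0) => c; exists (fun _ => 0); rewrite big_ord0 subr0.
- move=> /existsNP[c0 /negP]; rewrite -ltNge => hc0; exfalso.
  have n0 := stretched_direction tau0 hc0.
  have : 0 <= \tr (off_proj c0 *m B *m off_proj c0).
    by apply: psd_trace_ge0 => c; rewrite qform_off_proj.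
  rewrite trace_off_proj // mul0r in trB * => h.
  have : 0 < (qform 1%:M c0)^-1 * qform B c0.
    by rewrite mulr_gt0 ?invr_gt0 // (le_lt_trans _ hc0) // mulr_ge0 // ltW.
  lra.
- exists (fun _ => 0) => c; exists (fun _ => 0); rewrite big1 ?subr0 // => i _.
  by rewrite scale0r.
move=> /existsNP[c0 /negP]; rewrite -ltNge => hc0.
have n0 := stretched_direction tau0 hc0.
have [|| e he] := IHk (off_proj c0 *m B *m off_proj c0).
- by move=> c; rewrite qform_off_proj.
- rewrite trace_off_proj //; move: trB; rewrite -natr1 mulrDl mul1r => trB.
  have : tau <= (qform 1%:M c0)^-1 * qform B c0.
    by rewrite mulrC ler_pdivlMr // ltW.
  lra.
exists (fun i => if unlift ord_max i is Some j then e j *m off_proj c0 else c0) => c.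
have [y hy] := he c.
exists (fun i => if unlift ord_max i is Some j then y j
                 else (qform 1%:M c0)^-1 * (c *m c0^T) 0 0).
apply: le_trans hy; rewrite qform_off_proj mulmxBl mulmx_suml mul_off_proj.
rewrite big_ord_recr /= unlift_none opprD addrA addrAC.
rewrite (_ : \sum_(i < k) _ = \sum_i y i *: e i *m off_proj c0) //.
apply: eq_bigr => i _; have -> : widen_ord (leqnSn k) i = lift ord_max i.
  by apply: val_inj; rewrite /= /bump leqNgt ltn_ord.
by rewrite liftK scalemxAl.
Qed.

End greedy.

(** * Square-integrable functions *)

Section density.
Context d (T : measurableType d) (R : realType).
Variables (m : {measure set T -> \bar R}) (f : T -> R).
Hypotheses (mf : measurable_fun setT f) (f0 : forall x, 0 <= f x).
Local Open Scope ereal_scope.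

Import HBNNSimple.

(** Stated for any [nu] that agrees with the density on measurable sets, so that it serves for
    [density_measure] as well as for laws of random variables. Simple functions first, then monotone
    convergence. *)
Lemma ge0_integral_density (nu : {measure set T -> \bar R}) (h : T -> \bar R) :
  (forall A, measurable A -> nu A = \int[m]_(x in A) (f x)%:E) ->
  measurable_fun setT h -> (forall x, 0 <= h x) ->
  \int[nu]_x h x = \int[m]_x (h x * (f x)%:E).
Proof.
move=> hnu mh h0; have mfE : measurable_fun setT (EFin \o f) by exact/measurable_EFinP.
pose a := nnsfun_approx measurableT mh.
have a_cvg x : (a n x)%:E @[n --> \oo] --> h x by exact: cvg_nnsfun_approx.
have simple n : \int[m]_x ((a n x)%:E * (f x)%:E) = \int[nu]_x (a n x)%:E.
  pose L r := a n @^-1` [set r].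
  have mL r : measurable (L r) by exact: measurable_sfunP.
  have term r : 0 <= r%:E -> \int[m]_x ((r * \1_(L r) x)%:E * (f x)%:E) = r%:E * nu (L r).
    move=> r0; rewrite hnu // [in RHS]integral_mkcond -ge0_integralZl //.
    - apply: eq_integral => x _; rewrite patchE indicE.
      by case: ifP => _; rewrite ?mulr1 ?mulr0 ?mul0e ?mule0.
    - by apply/measurable_restrict => //; exact: measurable_funTS.
    - by move=> x _; rewrite patchE; case: ifP; rewrite ?lee_fin.
  have range0 r : r \in range (a n) -> 0 <= r%:E by move=> /set_mem[x _ <-]; rewrite lee_fin.
  transitivity (\sum_(r \in range (a n)) \int[m]_x ((r * \1_(L r) x)%:E * (f x)%:E)).
    rewrite -ge0_integral_fsum //.
    - apply: eq_integral => x _; rewrite -ge0_mule_fsuml ?fsumEFin -?fimfunE // => r.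
      exact: nnfun_muleindic_ge0.
    - by move=> r; apply: emeasurable_funM => //; apply/measurable_EFinP/measurable_funM.
    - by move=> r x _; rewrite mule_ge0 ?lee_fin //; exact: nnfun_muleindic_ge0.
  rewrite integral_nnsfun // patch_setT sintegralE; apply: eq_fsbigr => r /range0; exact: term.
have c1 : \int[nu]_x (a n x)%:E @[n --> \oo] --> \int[nu]_x h x.
  rewrite (eq_integral (fun x => lim ((a n x)%:E @[n --> \oo]))) => [|x _]; last first.
    by apply/esym/cvg_lim => //; exact: a_cvg.
  apply: cvg_monotone_convergence => // [n|n x _|x _ i j ij]; first exact/measurable_EFinP.
    by rewrite lee_fin.
  by rewrite lee_fin; exact/lefP/nd_nnsfun_approx.
have c2 : \int[m]_x ((a n x)%:E * (f x)%:E) @[n --> \oo] --> \int[m]_x (h x * (f x)%:E).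
  rewrite (eq_integral (fun x => lim ((a n x)%:E * (f x)%:E @[n --> \oo]))) => [|x _]; last first.
    by apply/esym/cvg_lim => //; apply: cvgeZr => //; exact: a_cvg.
  apply: cvg_monotone_convergence => // [n|n x _|x _ i j ij].
  - by apply: emeasurable_funM => //; exact/measurable_EFinP.
  - by rewrite mule_ge0 ?lee_fin.
  - by rewrite lee_wpmul2r ?lee_fin //; exact/lefP/nd_nnsfun_approx.
apply: (cvg_unique _ c1) => /=; first exact: ereal_hausdorff.
by rewrite (_ : (fun n => _) = (fun n => \int[m]_x ((a n x)%:E * (f x)%:E))) //; apply/funext.
Qed.

(** The two proofs are arguments so that the structure of a measure can be attached to the
    constant. *)
Definition density_measure of measurable_fun setT f & (forall x, (0 <= f x)%R) :=
  fun A : set T => \int[m]_(x in A) (f x)%:E.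

Local Notation nu := (density_measure mf f0).

Let nu0 : nu set0 = 0. Proof. exact: integral_set0. Qed.

Let nu_ge0 A : 0 <= nu A.
Proof. by apply: integral_ge0 => x _; rewrite lee_fin. Qed.

Let nu_additive : semi_sigma_additive nu.
Proof.
move=> /= A mA tA mUA; rewrite /density_measure ge0_integral_bigcup //=; last 2 first.
- exact/measurable_funTS/measurable_EFinP.
- by move=> x _; rewrite lee_fin.
apply: is_cvg_ereal_nneg_natsum_cond => n _ _.
by apply: integral_ge0 => x _; rewrite lee_fin.
Qed.

HB.instance Definition _ := isMeasure.Build _ _ _ nu nu0 nu_ge0 nu_additive.

End density.

Section square_integrable.
Context d (T : measurableType d) (R : realType).
Variable mu : {measure set T -> \bar R}.
Implicit Types f g : T -> R.

Definition sq_integrable f :=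
  measurable_fun setT f /\ (\int[mu]_x (f x ^+ 2)%:E < +oo)%E.

Definition inner f g : R := \int[mu]_x (f x * g x).

Definition norm2 f : R := Num.sqrt (inner f f).

Lemma measurable_sqr f : measurable_fun setT f ->
  measurable_fun setT (fun x => (f x ^+ 2)%:E).
Proof. by move=> mf; apply/measurable_EFinP; exact: measurable_funX. Qed.

Lemma sq_integrable_sqr f : sq_integrable f ->
  mu.-integrable setT (fun x => (f x ^+ 2)%:E).
Proof.
move=> [mf f2]; apply/integrableP; split; first exact: measurable_sqr.
by under eq_integral do rewrite /= ger0_norm ?sqr_ge0 //.
Qed.

Lemma sq_integrable_mul f g : sq_integrable f -> sq_integrable g ->
  mu.-integrable setT (fun x => (f x * g x)%:E).
Proof.
move=> hf hg; have [mf _] := hf; have [mg _] := hg.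
have := integrableD measurableT (sq_integrable_sqr hf) (sq_integrable_sqr hg).
apply: le_integrable => //.
  by apply/measurable_EFinP; exact: measurable_funM.
move=> x _ /=; rewrite lee_fin [X in _ <= X]ger0_norm ?addr_ge0 ?sqr_ge0 //.
rewrite normrM -(real_normK (num_real (f x))) -(real_normK (num_real (g x))).
have := sqr_ge0 (`|f x| - `|g x|); have := normr_ge0 (f x); have := normr_ge0 (g x); nra.
Qed.

Lemma sq_integrableD f g : sq_integrable f -> sq_integrable g ->
  sq_integrable (fun x => f x + g x).
Proof.
move=> hf hg; have [mf _] := hf; have [mg _] := hg.
split; first exact: measurable_funD.
have int2 : mu.-integrable setT (fun x => ((f x ^+ 2)%:E + (g x ^+ 2)%:E + ((f x * g x)%:E + (f x * g x)%:E))%E).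
  apply: integrableD => //; apply: integrableD => //; try exact: sq_integrable_sqr;
  exact: sq_integrable_mul.
apply: le_lt_trans (integrable_lty measurableT int2).
under [X in (_ <= X)%E]eq_integral do rewrite -!EFinD.
rewrite le_eqVlt; apply/orP; left; apply/eqP; apply: eq_integral => x _.
by congr _%:E; ring.
Qed.

Lemma sq_integrableZ (c : R) f : sq_integrable f -> sq_integrable (fun x => c * f x).
Proof.
move=> [mf f2]; split; first exact: measurable_funM.
under eq_integral do rewrite exprMn EFinM.
rewrite ge0_integralZl //; last 3 first.
- exact: measurable_sqr.
- by move=> x _; rewrite lee_fin sqr_ge0.
- by rewrite lee_fin sqr_ge0.
have : (0 <= \int[mu]_x (f x ^+ 2)%:E)%E.
  by apply: integral_ge0 => x _; rewrite lee_fin sqr_ge0.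
by case: (\int[mu]_x _)%E f2 => // r _ _; rewrite -EFinM ltry.
Qed.

Lemma sq_integrable0 : sq_integrable (fun _ => 0).
Proof.
split; first exact: measurable_cst.
under eq_integral do rewrite expr0n.
by rewrite integral0 ltry.
Qed.

Lemma sq_integrableN f : sq_integrable f -> sq_integrable (fun x => - f x).
Proof. by move=> /(sq_integrableZ (-1)); under eq_fun do rewrite mulN1r. Qed.

Lemma sq_integrableB f g : sq_integrable f -> sq_integrable g ->
  sq_integrable (fun x => f x - g x).
Proof. by move=> hf /sq_integrableN; apply: sq_integrableD. Qed.

Lemma sq_integrable_sum (I : Type) (r : seq I) (P : pred I) (F : I -> T -> R) :
  (forall i, P i -> sq_integrable (F i)) -> sq_integrable (fun x => \sum_(i <- r | P i) F i x).
Proof.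
move=> hF; elim: r => [|i r IHr].
  by under eq_fun do rewrite big_nil; exact: sq_integrable0.
under eq_fun do rewrite big_cons; case: (boolP (P i)) => // Pi.
by apply: sq_integrableD => //; apply: hF.
Qed.

Lemma innerC f g : inner f g = inner g f.
Proof. by rewrite /inner; under eq_Rintegral do rewrite mulrC. Qed.

Lemma innerDl f g h : sq_integrable f -> sq_integrable g -> sq_integrable h ->
  inner (fun x => f x + g x) h = inner f h + inner g h.
Proof.
move=> hf hg hh; rewrite /inner; under eq_Rintegral do rewrite mulrDl.
by rewrite RintegralD //; exact: sq_integrable_mul.
Qed.

Lemma innerZl (c : R) f h : sq_integrable f -> sq_integrable h ->
  inner (fun x => c * f x) h = c * inner f h.
Proof.
move=> hf hh; rewrite /inner; under eq_Rintegral do rewrite -mulrA.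
by rewrite RintegralZl //; exact: sq_integrable_mul.
Qed.

Lemma inner0l h : inner (fun _ => 0) h = 0.
Proof.
rewrite /inner; under eq_Rintegral do rewrite mul0r.
by rewrite /Rintegral integral0.
Qed.

Lemma inner_suml (I : Type) (r : seq I) (P : pred I) (c : I -> R) (F : I -> T -> R) h :
  (forall i, P i -> sq_integrable (F i)) -> sq_integrable h ->
  inner (fun x => \sum_(i <- r | P i) c i * F i x) h = \sum_(i <- r | P i) c i * inner (F i) h.
Proof.
move=> hF hh; elim: r => [|i r IHr].
  by under eq_fun do rewrite big_nil; rewrite big_nil inner0l.
under eq_fun do rewrite big_cons; rewrite big_cons; case: (boolP (P i)) => // Pi.
rewrite innerDl ?innerZl ?IHr //; try exact: hF.
  exact/sq_integrableZ/hF.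
by apply: sq_integrable_sum => k Pk; exact/sq_integrableZ/hF.
Qed.

Lemma inner_ge0 f : 0 <= inner f f.
Proof. by apply: Rintegral_ge0 => x _; rewrite -expr2 sqr_ge0. Qed.

Lemma integral_sqr f : sq_integrable f ->
  (\int[mu]_x (f x ^+ 2)%:E = (inner f f)%:E)%E.
Proof.
move=> hf; rewrite /inner /Rintegral fineK; first by apply: eq_integral => x _; rewrite expr2.
exact: (integrable_fin_num measurableT (sq_integrable_mul hf hf)).
Qed.

Lemma norm2E f : norm2 f = Num.sqrt (inner f f).
Proof. by []. Qed.

Lemma norm2_ge0 f : 0 <= norm2 f. Proof. exact: sqrtr_ge0. Qed.

Lemma sqr_norm2 f : norm2 f ^+ 2 = inner f f.
Proof. by rewrite sqr_sqrtr // inner_ge0. Qed.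

Lemma norm2Z (c : R) f : sq_integrable f -> norm2 (fun x => c * f x) = `|c| * norm2 f.
Proof.
move=> hf; have hcf := sq_integrableZ c hf.
rewrite /norm2 innerZl // innerC innerZl // mulrA -expr2.
by rewrite sqrtrM ?sqr_ge0 // sqrtr_sqr.
Qed.

Lemma inner_le_norm2 f g : sq_integrable f -> sq_integrable g ->
  inner f g <= norm2 f * norm2 g.
Proof.
move=> hf hg; set a := norm2 f; set b := norm2 g.
have a0 : 0 <= a := norm2_ge0 f; have b0 : 0 <= b := norm2_ge0 g.
have key (s t : R) : 2 * s * t * inner f g <= s ^+ 2 * a ^+ 2 + t ^+ 2 * b ^+ 2.
  have hs := sq_integrableZ s hf; have ht := sq_integrableZ (- t) hg.
  have := inner_ge0 (fun x => s * f x + - t * g x).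
  rewrite innerDl //; last exact: sq_integrableD.
  rewrite innerC innerDl // [X in _ + X]innerC innerDl //.
  rewrite !innerZl // ![inner _ (fun _ => _ * _)]innerC !innerZl //.
  rewrite [inner g f]innerC -!sqr_norm2 -/a -/b; nra.
(* A vanishing norm leaves [t * inner f g <= t ^+ 2 * b ^+ 2] for all [t], and a small positive [t]
   rules out a positive [inner f g]. The [+ 1] in the witness keeps it defined when [b] vanishes
   too. *)
case: (eqVneq a 0) => [a00|an0].
  have h t : t * inner f g <= t ^+ 2 * b ^+ 2.
    by have := key 2^-1 t; rewrite a00; lra.
  rewrite a00 mul0r leNgt; apply/negP => i0.
  have := h (inner f g / (b ^+ 2 + 1) ); have b1 : 0 < b ^+ 2 + 1 by rewrite ltr_wpDl ?sqr_ge0.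
  have -> : inner f g / (b ^+ 2 + 1) * inner f g = (inner f g / (b ^+ 2 + 1)) ^+ 2 * (b ^+ 2 + 1).
    by field; rewrite gt_eqF.
  rewrite ler_pM2l ?exprn_gt0 ?divr_gt0 //; lra.
case: (eqVneq b 0) => [b00|bn0].
  have h t : t * inner f g <= t ^+ 2 * a ^+ 2.
    by have := key t 2^-1; rewrite b00; lra.
  rewrite b00 mulr0 leNgt; apply/negP => i0.
  have := h (inner f g / (a ^+ 2 + 1) ); have b1 : 0 < a ^+ 2 + 1 by rewrite ltr_wpDl ?sqr_ge0.
  have -> : inner f g / (a ^+ 2 + 1) * inner f g = (inner f g / (a ^+ 2 + 1)) ^+ 2 * (a ^+ 2 + 1).
    by field; rewrite gt_eqF.
  rewrite ler_pM2l ?exprn_gt0 ?divr_gt0 //; lra.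
have ap : 0 < a by rewrite lt0r an0.
have bp : 0 < b by rewrite lt0r bn0.
have := key b a; have -> : b ^+ 2 * a ^+ 2 + a ^+ 2 * b ^+ 2 = 2 * b * a * (a * b) by ring.
by rewrite ler_pM2l ?mulr_gt0.
Qed.

Lemma norm2D f g : sq_integrable f -> sq_integrable g ->
  norm2 (fun x => f x + g x) <= norm2 f + norm2 g.
Proof.
move=> hf hg; have hfg := sq_integrableD hf hg.
rewrite -(@ler_pXn2r _ 2) ?nnegrE ?addr_ge0 ?norm2_ge0 // sqr_norm2.
rewrite innerDl // innerC innerDl // [X in _ + X]innerC innerDl // -!sqr_norm2.
rewrite [inner g f]innerC; have := inner_le_norm2 hf hg; nra.
Qed.

Lemma norm2_sum (I : Type) (r : seq I) (P : pred I) (F : I -> T -> R) :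
  (forall i, P i -> sq_integrable (F i)) ->
  norm2 (fun x => \sum_(i <- r | P i) F i x) <= \sum_(i <- r | P i) norm2 (F i).
Proof.
move=> hF; elim: r => [|i r IHr].
  under eq_fun do rewrite big_nil; rewrite big_nil /norm2 inner0l sqrtr0 //.
under eq_fun do rewrite big_cons; rewrite big_cons; case: (boolP (P i)) => // Pi.
apply: le_trans (norm2D (hF _ Pi) (sq_integrable_sum r hF)) _.
by rewrite lerD2l.
Qed.

Lemma le_integral_indic_sqr (A : set T) f : measurable A -> measurable_fun setT f ->
  (\int[mu]_x ((\1_A x * f x) ^+ 2)%:E <= \int[mu]_x (f x ^+ 2)%:E)%E.
Proof.
move=> mA mf; apply: ge0_le_integral => //.
- by move=> x _; rewrite lee_fin sqr_ge0.
- by apply: measurable_sqr; apply: measurable_funM => //; exact: measurable_indic.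
- exact: measurable_sqr.
move=> x _; rewrite lee_fin indicE; case: (x \in A); rewrite ?mul1r ?mul0r // expr0n.
exact: sqr_ge0.
Qed.

Lemma sq_integrable_indic (A : set T) f : measurable A -> sq_integrable f ->
  sq_integrable (fun x => \1_A x * f x).
Proof.
move=> mA [mf f2]; split; first by apply: measurable_funM => //; exact: measurable_indic.
exact: le_lt_trans (le_integral_indic_sqr mA mf) f2.
Qed.

Lemma norm2_indic_le (A : set T) f : measurable A -> sq_integrable f ->
  norm2 (fun x => \1_A x * f x) <= norm2 f.
Proof.
move=> mA sf; have [mf _] := sf; apply: ler_wsqrtr; rewrite -lee_fin -!integral_sqr //.
  exact: le_integral_indic_sqr.
exact: sq_integrable_indic.
Qed.

End square_integrable.

(** * Orthogonal polynomials *)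

Section rootless.
Variable R : rcfType.

Lemma rootless_factor (p : {poly R}) : p != 0 ->
  exists (s : {poly R}) (zs : seq R),
    p = s * \prod_(z <- zs) ('X - z%:P) /\ (forall x, ~~ root s x).
Proof.
have [n] := ubnP (size p); elim: n => // n IHn in p *; rewrite ltnS => sp p0.
case: (EM (exists x, root p x)) => [[x /factor_theorem[p1 pE]]|h].
  have p10 : p1 != 0 by apply: contraNneq p0 => p10; rewrite pE p10 mul0r.
  have [|s [zs [p1E hs]]] := IHn p1 _ p10.
    move: sp; rewrite pE size_Mmonic ?monicXsubC // size_XsubC addn2 /=.
    by rewrite -ltnS.
  exists s, (x :: zs); split=> //.
  by rewrite big_cons pE p1E mulrAC mulrA.
exists p, [::]; rewrite big_nil mulr1; split=> // x.
by apply/negP => px; apply: h; exists x.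
Qed.

Lemma double_root_factor (zs : seq R) : ~~ uniq zs -> exists (x : R) (t : {poly R}),
  \prod_(z <- zs) ('X - z%:P) = ('X - x%:P) ^+ 2 * t.
Proof.
elim: zs => [//|x zs IHzs] /=; rewrite negb_and negbK => /orP[xzs|/IHzs[y [t tE]]].
  exists x, (\prod_(z <- rem x zs) ('X - z%:P)).
  by rewrite big_cons (big_rem x xzs) /= mulrA expr2.
by exists y, (('X - x%:P) * t); rewrite big_cons tE mulrCA.
Qed.

Lemma rootless_sign (s : {poly R}) : (forall x, ~~ root s x) ->
  (forall x, 0 < s.[x]) \/ (forall x, s.[x] < 0).
Proof.
move=> hs.
have s0 x : s.[x] != 0 by have := hs x; rewrite /root.
have ivt (t : {poly R}) x y : (forall x, ~~ root t x) -> x <= y -> t.[x] <= 0 -> 0 <= t.[y] -> False.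
  move=> ht xy tx ty; have [|z _ tz] := @poly_ivt R t _ _ xy; first by rewrite tx ty.
  by have := ht z; rewrite tz.
have hs' x : ~~ root (- s) x by rewrite /root hornerN oppr_eq0.
have key x y : s.[x] < 0 -> 0 < s.[y] -> False.
  move=> sx sy; have [xy|yx] := leP x y.
    exact: (ivt s x y hs xy (ltW sx) (ltW sy)).
  by apply: (ivt (- s) y x hs' (ltW yx)); rewrite hornerN ?oppr_le0 ?oppr_ge0 ltW.
case: (ltrgtP s.[0] 0) (s0 0) => // s00 _; [right|left] => x;
  case: (ltrgtP s.[x] 0) (s0 x) => // sx _; exfalso.
- exact: key s00 sx.
- exact: key sx s00.
Qed.
End rootless.

Section poly_integral.
Variables (R : realType) (mu : {measure set (measurableTypeR R) -> \bar R}).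
Hypothesis moments : forall k, (\int[mu]_x (`|x| ^+ k)%:E < +oo)%E.
Implicit Types P Q : {poly R}.

Local Notation ev P := (fun x : measurableTypeR R => P.[x]).

Lemma measurable_horner P : measurable_fun setT (ev P).
Proof.
under eq_fun do rewrite horner_coef.
apply: measurable_sum => i; apply: measurable_funM => //; exact: measurable_funX.
Qed.

Lemma integrable_horner P : mu.-integrable setT (fun x => P.[x]%:E).
Proof.
have -> : (fun x => P.[x]%:E) = (fun x => \sum_(i < size P) (P`_i * x ^+ i)%:E)%E.
  by apply/funext => x; rewrite horner_coef sumEFin.
apply: integrable_sum => // i _.
under eq_fun do rewrite EFinM.
apply: integrableZl => //; apply/integrableP; split.
  by apply/measurable_EFinP; exact: measurable_funX.
by under eq_integral do rewrite /= normrX; exact: moments.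
Qed.

Definition poly_int (A : set (measurableTypeR R)) P : R := \int[mu]_(x in A) P.[x].

Variable A : set (measurableTypeR R).
Hypothesis mA : measurable A.

Let intA P : mu.-integrable A (EFin \o ev P).
Proof. by apply: integrableS (integrable_horner P). Qed.

Lemma poly_intD P Q : poly_int A (P + Q) = poly_int A P + poly_int A Q.
Proof.
rewrite /poly_int; under eq_Rintegral do rewrite hornerD.
by rewrite RintegralD.
Qed.

Lemma poly_intZ (c : R) P : poly_int A (c *: P) = c * poly_int A P.
Proof.
rewrite /poly_int; under eq_Rintegral do rewrite hornerZ.
by rewrite RintegralZl.
Qed.

Lemma poly_int0 : poly_int A 0 = 0.
Proof. by rewrite -(scale0r (0 : {poly R})) poly_intZ mul0r. Qed.

Lemma poly_int_sum (I : Type) (r : seq I) (B : pred I) (F : I -> {poly R}) :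
  poly_int A (\sum_(i <- r | B i) F i) = \sum_(i <- r | B i) poly_int A (F i).
Proof.
apply: (big_morph (poly_int A)); [exact: poly_intD|exact: poly_int0].
Qed.

Lemma poly_int_ge0 P : (forall x, A x -> 0 <= P.[x]) -> 0 <= poly_int A P.
Proof. by move=> h; apply: Rintegral_ge0. Qed.

Lemma le_poly_int P Q : (forall x, A x -> P.[x] <= Q.[x]) -> poly_int A P <= poly_int A Q.
Proof. by move=> h; apply: le_Rintegral. Qed.

Lemma poly_intE P : (forall x, A x -> 0 <= P.[x]) ->
  (\int[mu]_(x in A) P.[x]%:E = (poly_int A P)%:E)%E.
Proof.
by move=> h; rewrite /poly_int /Rintegral fineK //; exact: (integrable_fin_num mA (intA P)).
Qed.

End poly_integral.

Section orthogonal.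
Variables (R : realType) (mu : {measure set (measurableTypeR R) -> \bar R}).
Hypothesis moments : forall k, (\int[mu]_x (`|x| ^+ k)%:E < +oo)%E.
Local Notation J := (poly_int mu setT).
Hypothesis positive : forall P : {poly R}, P != 0 -> (forall x, 0 <= P.[x]) -> 0 < J P.
Variable q : nat -> {poly R}.
Hypothesis q_size : forall j, size (q j) = j.+1.
Hypothesis q_orth : forall i j, i != j -> J (q i * q j) = 0.
Let mT := @measurableT _ (measurableTypeR R).

Lemma sq_integrable_horner (P : {poly R}) : sq_integrable mu (fun x => P.[x]).
Proof.
split; first exact: measurable_horner.
have := integrable_horner moments (P ^+ 2) => /(integrable_lty mT).
by under eq_integral do rewrite horner_exp.
Qed.

Lemma inner_horner (P Q : {poly R}) :
  inner mu (fun x => P.[x]) (fun x => Q.[x]) = J (P * Q).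
Proof. by rewrite /inner /poly_int; under eq_Rintegral do rewrite -hornerM. Qed.

Lemma orth_basis n (r : {poly R}) : (size r <= n)%N ->
  exists c : nat -> R, r = \sum_(i < n) c i *: q i.
Proof.
elim: n r => [|n IHn] r rn.
  exists (fun _ => 0); rewrite big_ord0; apply/eqP.
  by rewrite -size_poly_eq0 -leqn0.
have qn0 : (q n)`_n != 0.
  by have := q_size n; move=> e; rewrite -[n in _`_n]/(n.+1.-1) -e -lead_coefE lead_coef_eq0 -size_poly_eq0 e.
pose a := r`_n / (q n)`_n.
have [|c hc] := IHn (r - a *: q n).
  apply/leq_sizeP => k; rewrite leq_eqVlt => /orP[/eqP <-|nk].
    by rewrite coefB coefZ divfK // subrr.
  rewrite coefB coefZ !nth_default ?mulr0 ?subr0 ?q_size //.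
  exact: leq_trans rn nk.
exists (fun i => if i == n then a else c i).
rewrite big_ord_recr /= eqxx -[LHS](subrK (a *: q n)) hc; congr (_ + _).
by apply: eq_bigr => i _; rewrite ltn_eqF.
Qed.

Lemma orth_low j (r : {poly R}) : (size r <= j)%N -> J (q j * r) = 0.
Proof.
move=> /orth_basis[c ->]; rewrite mulr_sumr poly_int_sum // big1 // => i _.
by rewrite -scalerAr poly_intZ // q_orth ?mulr0 // gtn_eqF.
Qed.

Lemma positive_sqr (P : {poly R}) : P != 0 -> 0 < J (P ^+ 2).
Proof.
move=> P0; apply: positive; first by rewrite expf_neq0.
by move=> x; rewrite horner_exp sqr_ge0.
Qed.

(** A rootless factor of positive degree would give [q j], times the product of its linear factors,
    a constant sign; a double root would make [q j] times a polynomial of lower degree a square.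
    Both contradict orthogonality to lower degrees. Signs are taken on the whole line, so the roots
    are not located in the support of the measure. *)
Lemma orth_real_roots j : exists z : 'I_j -> R, injective z /\
  q j = lead_coef (q j) *: root_poly z.
Proof.
have q0 : q j != 0 by rewrite -size_poly_eq0 q_size.
have [s [zs [qE hs]]] := rootless_factor q0.
set r := \prod_(z <- zs) _ in qE.
have s0 : s != 0 by apply: contraNneq q0 => s0; rewrite qE s0 mul0r.
have rm : r \is monic by apply: monic_prod_XsubC.
have r0 : r != 0 by rewrite monic_neq0.
have size_r : size r = (size zs).+1 by rewrite size_prod_XsubC.
have size_q : (size s + size zs = j.+1)%N.
  by rewrite -(q_size j) qE size_Mmonic // size_r addnS.
have s1 : size s = 1%N.
  apply/eqP; rewrite eqn_leq lt0n size_poly_eq0 s0 andbT leqNgt; apply/negP => s2.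
  have h : J (q j * r) = 0.
    by apply: orth_low; rewrite size_r; lia.
  have hsr : q j * r = s * r ^+ 2 by rewrite qE -mulrA expr2.
  have sr0 : s * r ^+ 2 != 0 by rewrite mulf_neq0 // expf_neq0.
  have [sp|sn] := rootless_sign hs.
    have := positive sr0; rewrite -hsr h ltxx => /(_ _)/notF; apply => x.
    by rewrite hsr hornerM horner_exp mulr_ge0 ?sqr_ge0 // ltW.
  have := @positive (- (s * r ^+ 2)); rewrite oppr_eq0 => /(_ sr0).
  rewrite -hsr -scaleN1r poly_intZ // h mulr0 ltxx => /(_ _)/notF; apply => x.
  by rewrite hsr hornerZ mulN1r oppr_ge0 hornerM horner_exp mulr_le0_ge0 ?sqr_ge0 // ltW.
have [c c0 sE] := size_poly1P _ (introT eqP s1).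
have zs_size : size zs = j by move: size_q; rewrite s1 add1n => -[].
have zs_uniq : uniq zs.
  apply: contraT => /double_root_factor[x [t tE]].
  have hsq : q j * (c%:P * t) = (c%:P * (('X - x%:P) * t)) ^+ 2.
    by rewrite qE sE /r tE; ring.
  have t0 : t != 0 by apply: contraNneq r0 => t0; rewrite /r tE t0 mulr0.
  have : 0 < J ((c%:P * (('X - x%:P) * t)) ^+ 2).
    by apply: positive_sqr; rewrite !mulf_neq0 ?polyC_eq0 ?polyXsubC_eq0.
  rewrite -hsq orth_low ?ltxx // mul_polyC (leq_trans (size_scale_leq _ _)) //.
  have := size_r; rewrite /r tE size_mul ?expf_neq0 ?polyXsubC_eq0 //.
  by rewrite size_exp_XsubC zs_size /= => -[<-]; exact: leqnSn.
exists (fun i => zs`_i); split.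
  by move=> i k /eqP; rewrite nth_uniq ?zs_size // => /eqP /val_inj.
have rE : root_poly (fun i : 'I_j => zs`_i) = r.
  by rewrite /r (big_nth 0) zs_size big_mkord.
rewrite rE {1}qE sE mul_polyC; congr (_ *: _).
by rewrite qE sE mul_polyC lead_coefZ (monicP rm) mulr1.
Qed.

(** Up to a scalar, the product of two distinct cofactors is [q j] times a polynomial of degree
    [j - 2]. *)
Lemma root_cofactor_orth j (z : 'I_j -> R) i k : q j = lead_coef (q j) *: root_poly z ->
  i != k -> J (root_cofactor z i * root_cofactor z k) = 0.
Proof.
move=> qE ik; pose t := \prod_(l | (l != i) && (l != k)) ('X - (z l)%:P).
have lc0 : lead_coef (q j) != 0 by rewrite lead_coef_eq0 -size_poly_eq0 q_size.
have ti : root_cofactor z i = ('X - (z k)%:P) * t.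
  by rewrite /root_cofactor (bigD1 k) //= eq_sym.
have tk : root_cofactor z k = ('X - (z i)%:P) * t.
  rewrite /root_cofactor (bigD1 i) //=; congr (_ * _).
  by apply: eq_bigl => l; rewrite andbC.
have -> : root_cofactor z i * root_cofactor z k = (lead_coef (q j))^-1 *: (q j * t).
  by rewrite {2}qE -!scalerAl scalerA mulVf // scale1r (root_polyD z k) tk ti; ring.
rewrite poly_intZ // orth_low ?mulr0 //.
have := size_root_cofactor z i; rewrite ti size_mul ?polyXsubC_eq0 //; last first.
  by apply/prodf_neq0 => l _; rewrite polyXsubC_eq0.
by rewrite size_XsubC => h; exact: leq_trans (leqnSn _) (eq_leq h).
Qed.

Lemma deriv_square_int j p (z : 'I_j -> R) : injective z -> (0 < p)%N ->
  q j = lead_coef (q j) *: root_poly z ->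
  J (deriv_square z p) = 2 * J (((root_poly z)^`(p)) ^+ 2).
Proof.
move=> zi p0 qE; rewrite /deriv_square poly_intD // poly_int_sum // mulrDl mul1r.
congr (_ + _); rewrite (derivn_root_poly_residues zi p0) expr2 mulr_suml poly_int_sum //.
apply: eq_bigr => i _; rewrite mulr_sumr poly_int_sum // (bigD1 i) //= -expr2.
rewrite big1 ?addr0 // => k ki.
by rewrite -scalerAl -scalerAr !poly_intZ // root_cofactor_orth ?mulr0 // eq_sym.
Qed.

(* A Poincare inequality of order p on small sets, valid for orthogonal
   polynomials with respect to an arbitrary measure: compare the pointwise
   approximations at all points x of A, weighted by q(x)^2. *)
Lemma local_poincare p : (0 < p)%N -> exists (D : nat) (C : R), 0 < C /\
  forall j (z : 'I_j -> R) (A : set (measurableTypeR R)) (rho e : R),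
    injective z -> (p <= j)%N -> measurable A -> 0 < rho -> 0 < e ->
    (forall x y, A x -> A y -> `|y - x| <= rho) ->
  exists v : {poly R}, (size v <= D)%N /\
    poly_int mu A ((root_poly z - v) ^+ 2) <=
    C * rho ^+ p.*2 * poly_int mu A (deriv_square z p) + e.
Proof.
move=> /local_poly_approx H0; have [D [C [C0 hD]]] := H0 R.
exists D, C; split=> // j z A rho e zi pj mA rho0 e0 hA.
(* If every [v] fails, then so does the approximant attached to each [x], and the resulting
   pointwise inequalities can be integrated in [x] without choosing [v] measurably. *)
apply: contrapT => /forallNP hv.
set Q := root_poly z in hv hD *; set H := deriv_square z p in hv *.
pose IQ := poly_int mu A (Q ^+ 2); pose IH := poly_int mu A H.
have IQ0 : 0 <= IQ by apply: poly_int_ge0 => x _; rewrite horner_exp sqr_ge0.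
have Cr0 : 0 <= C * rho ^+ p.*2 by rewrite mulr_ge0 ?exprn_ge0 // ltW.
have Hge0 x : 0 <= H.[x].
  rewrite horner_deriv_square addr_ge0 ?sqr_ge0 // sumr_ge0 // => i _.
  exact: sqr_ge0.
have IH0 : 0 <= IH by apply: poly_int_ge0.
have step x : A x -> (C * rho ^+ p.*2 * IH + e) * Q.[x] ^+ 2 <= C * rho ^+ p.*2 * IQ * H.[x].
  move=> Ax; have [Qx|Qx] := eqVneq Q.[x] 0.
    by rewrite Qx expr0n mulr0; apply: mulr_ge0 => //; apply: mulr_ge0.
  have [v [vD vP]] := hD _ z x rho zi pj Qx rho0.
  have := hv v; rewrite not_andP => -[//|/negP]; rewrite -ltNge -/IH => /ltW h.
  have Q2 : 0 <= Q.[x] ^+ 2 by rewrite sqr_ge0.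
  apply: le_trans (ler_wpM2r Q2 h) _; rewrite mulrC -poly_intZ //.
  have -> : C * rho ^+ p.*2 * IQ * H.[x] = poly_int mu A ((C * rho ^+ p.*2 * H.[x]) *: Q ^+ 2).
    by rewrite poly_intZ // -/IQ; ring.
  apply: le_poly_int => // y Ay; rewrite !hornerZ !horner_exp hornerD hornerN mulrC.
  exact: vP (hA _ _ Ax Ay).
have : poly_int mu A ((C * rho ^+ p.*2 * IH + e) *: Q ^+ 2) <=
       poly_int mu A ((C * rho ^+ p.*2 * IQ) *: H).
  by apply: le_poly_int => // x Ax; rewrite !hornerZ horner_exp step.
(* The slack leaves [e * IQ <= 0], so [Q] is null in [L2] on [A] and [v = 0] succeeds after all. *)
rewrite !poly_intZ // -/IQ -/IH => h; have IQE : IQ = 0 by nra.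
apply: (hv 0); split; first by rewrite size_poly0.
by rewrite subr0 -/IQ IQE; apply: addr_ge0; [exact: mulr_ge0|exact: ltW].
Qed.

End orthogonal.

(** * Approximation of the sieve *)

Section cells.
Variables (R : realType) (mu : {measure set (measurableTypeR R) -> \bar R}).
Hypothesis moments : forall k, (\int[mu]_x (`|x| ^+ k)%:E < +oo)%E.
Local Notation J := (poly_int mu setT).
Hypothesis positive : forall P : {poly R}, P != 0 -> (forall x, 0 <= P.[x]) -> 0 < J P.
Variable q : nat -> {poly R}.
Hypothesis q_size : forall j, size (q j) = j.+1.
Hypothesis q_orth : forall i j, i != j -> J (q i * q j) = 0.
Let mT := @measurableT _ (measurableTypeR R).

Let gam j := J (q j ^+ 2).

Lemma gam_gt0 j : 0 < gam j.
Proof. by apply: positive_sqr => //; rewrite -size_poly_eq0 q_size. Qed.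

(** If the derivative has coefficients [c i] in the basis [q i], then
    [2 * t * c i ^+ 2 <= c i ^+ 4 + t ^+ 2] with [t = j ^ (3 / 2)]; after summation against [gam i]
    the two right-hand terms are bounded by the two assumptions on [gt]. The gain [j ^ (3 / 2)]
    makes the remainders square summable. *)
Lemma deriv_int_bound (p j : nat) (gt : R) : (0 < p)%N -> (0 < j)%N ->
  \sum_(i < j) ((gam i)^-1 * J ((q j)^`(p) * q i)) ^+ 4 * gam i <= gt ->
  (forall i, (i < j)%N -> j%:R ^+ 4 * gam i <= gt) ->
  J (((q j)^`(p)) ^+ 2) * (j%:R * Num.sqrt j%:R) <= gt.
Proof.
move=> p0 j0 h1 h2.
have jR : 0 < j%:R :> R by rewrite ltr0n.
have [|c rE] := orth_basis q_size (_ : (size (q j)^`(p) <= j)%N).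
  apply/leq_sizeP => k jk; rewrite coef_derivn nth_default ?mul0rn //.
  by rewrite q_size -add1n leq_add.
have JE i : (i < j)%N -> J ((q j)^`(p) * q i) = c i * gam i.
  move=> ij; rewrite rE mulr_suml poly_int_sum // (bigD1 (Ordinal ij)) //=.
  rewrite -scalerAl poly_intZ // -expr2 big1 ?addr0 // => k ki.
  by rewrite -scalerAl poly_intZ // q_orth ?mulr0.
have J2 : J (((q j)^`(p)) ^+ 2) = \sum_(i < j) c i ^+ 2 * gam i.
  rewrite expr2 {2}rE mulr_sumr poly_int_sum //; apply: eq_bigr => i _.
  by rewrite -scalerAr poly_intZ // JE // mulrA -expr2.
have {}h1 : \sum_(i < j) c i ^+ 4 * gam i <= gt.
  apply: le_trans h1; rewrite le_eqVlt; apply/orP; left; apply/eqP.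
  by apply: eq_bigr => i _; rewrite JE // [_^-1 * _]mulrC mulfK // gt_eqF // gam_gt0.
have {}h2 : j%:R ^+ 3 * \sum_(i < j) gam i <= gt.
  rewrite -(ler_pM2l jR) mulrA -exprS mulr_sumr.
  apply: le_trans (ler_sum _ (fun (i : 'I_j) _ => h2 i (ltn_ord i))) _.
  by rewrite sumr_const card_ord mulr_natl.
set t := j%:R * Num.sqrt j%:R.
have t2 : t ^+ 2 = j%:R ^+ 3 by rewrite exprMn sqr_sqrtr ?ler0n // -exprSr.
have : 2 * t * \sum_(i < j) c i ^+ 2 * gam i <=
    \sum_(i < j) c i ^+ 4 * gam i + t ^+ 2 * \sum_(i < j) gam i.
  rewrite !mulr_sumr -big_split /=; apply: ler_sum => i _.
  have := mulr_ge0 (sqr_ge0 (c i ^+ 2 - t)) (ltW (gam_gt0 i)); nra.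
by rewrite t2 J2; lra.
Qed.

Definition cell (a rho : R) (c : nat) : set (measurableTypeR R) :=
  [set` `[a + c%:R * rho, a + c.+1%:R * rho[%R].

Lemma measurable_cell a rho c : measurable (cell a rho c).
Proof. exact: measurable_itv. Qed.

Lemma cell_indic (a rho : R) N (x : R) : 0 < rho ->
  (exists c0 : 'I_N, \1_[set` `[a, a + N%:R * rho[%R] x = 1 :> R /\
     forall c : 'I_N, \1_(cell a rho c) x = (c == c0)%:R :> R) \/
  (\1_[set` `[a, a + N%:R * rho[%R] x = 0 :> R /\
     forall c : 'I_N, \1_(cell a rho c) x = 0 :> R).
Proof.
move=> rho0; have cellP c : (x \in cell a rho c) = (c%:R <= (x - a) / rho < c.+1%:R).
  rewrite /cell mem_setE in_itv /= ler_pdivlMr // ltr_pdivrMr //.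
  by rewrite lerBrDl ltrBlDl.
have coreP : (x \in [set` `[a, a + N%:R * rho[%R]) = (0 <= (x - a) / rho < N%:R).
  rewrite mem_setE in_itv /= ltr_pdivrMr // ltrBlDl; congr (_ && _).
  by rewrite pmulr_lge0 ?invr_gt0 // subr_ge0.
case: (boolP (x \in [set` `[a, a + N%:R * rho[%R])) => xc; [left|right].
  move: (xc); rewrite coreP => /andP[t0 tN].
  have hN : (Num.truncn ((x - a) / rho)%R < N)%N by rewrite truncn_lt_nat.
  exists (Ordinal hN); split; first by rewrite indicE xc.
  move=> c; rewrite indicE cellP -truncn_eq // -val_eqE /= eq_sym //.
split; first by rewrite indicE (negbTE xc).
move=> c; rewrite indicE cellP; case: andP => // -[h1 h2].
move: xc; rewrite coreP (le_trans _ h1) ?ler0n //= (lt_le_trans h2) // ler_nat //.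
Qed.

Lemma integral_indic_horner (A : set (measurableTypeR R)) (P : {poly R}) :
  measurable A -> (forall x, 0 <= P.[x]) ->
  (\int[mu]_x (\1_A x * P.[x])%:E = (poly_int mu A P)%:E)%E.
Proof.
move=> mA P0; rewrite -poly_intE // [in RHS]integral_mkcond.
apply: eq_integral => x _; rewrite patchE indicE.
by case: ifP => _; rewrite ?mul1r ?mul0r.
Qed.

Lemma integral_cells (N : nat) (A : 'I_N -> set (measurableTypeR R)) (P : 'I_N -> {poly R}) :
  (forall c, measurable (A c)) -> (forall c x, 0 <= (P c).[x]) ->
  (\int[mu]_x (\sum_c \1_(A c) x * (P c).[x])%:E = (\sum_c poly_int mu (A c) (P c))%:E)%E.
Proof.
move=> mA P0; rewrite -sumEFin; under eq_integral do rewrite -sumEFin.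
rewrite ge0_integral_sum //; last 2 first.
- move=> c; apply/measurable_EFinP; apply: measurable_funM; last exact: measurable_horner.
  exact: measurable_indic.
- by move=> c x _; rewrite lee_fin mulr_ge0.
by apply: eq_bigr => c _; rewrite integral_indic_horner.
Qed.

Lemma cell_approx p : (0 < p)%N -> exists (D : nat) (C : R), 0 < C /\
  forall j (a rho : R) (N : nat), (p <= j)%N -> 0 < rho -> (0 < N)%N ->
  exists al : 'I_N -> 'I_D -> R,
    (\int[mu]_x ((\1_[set` `[a, a + N%:R * rho[%R] x * (q j).[x] -
       \sum_c \sum_k al c k * (\1_(cell a rho c) x * x ^+ k)) ^+ 2)%:E <=
     (C * rho ^+ p.*2 * J (((q j)^`(p)) ^+ 2))%:E)%E.
Proof.
move=> p0; have [D [C [C0 hD]]] := local_poincare moments p0.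
(* 2 from [deriv_square_int] and 1 for the slack [e], shared equally by the [N] cells. *)
exists D, (3 * C); split; first by rewrite mulr_gt0.
move=> j a rho N pj rho0 N0.
have [z [zi qE]] := orth_real_roots moments positive q_size q_orth j.
set l := lead_coef (q j) in qE.
set Q := root_poly z; set H := deriv_square z p.
(* The slack must be positive. A vanishing derivative would make [deriv_square] zero at points that
   are not roots. *)
have J0 : 0 < J ((Q^`(p)) ^+ 2).
  apply: positive_sqr => //; rewrite -size_poly_eq0.
  apply/negP => /eqP h; have := deriv_square_gt0 (p := p) zi.
  have [x xz] : exists x, forall i, x != z i.
    exists (1 + \sum_i `|z i|) => i; rewrite gt_eqF //.
    rewrite (bigD1 i) //= addrCA; apply: le_lt_trans (ler_norm _) _.
    by rewrite ltrDl ltr_pwDl // sumr_ge0.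
  move=> /(_ x); rewrite p0 pj => /(_ isT xz).
  have r0 : Q^`(p) = 0 by apply/eqP; rewrite -size_poly_eq0 h.
  rewrite horner_deriv_square -/Q r0 horner0 expr0n add0r big1 ?ltxx // => i _.
  by rewrite /deriv_residue -/Q r0 horner0 mul0r mul0r expr0n.
pose e := C * rho ^+ p.*2 * J ((Q^`(p)) ^+ 2) / N%:R.
have NR : 0 < N%:R :> R by rewrite ltr0n.
have e0 : 0 < e by rewrite divr_gt0 // mulr_gt0 // mulr_gt0 // exprn_gt0.
have dA c (x y : measurableTypeR R) : cell a rho c x -> cell a rho c y -> `|y - x| <= rho.
  rewrite /cell /= !in_itv /= => /andP[x1 x2] /andP[y1 y2].
  move: x2 y2; rewrite -natr1 mulrDl mul1r => x2 y2.
  by rewrite ler_norml; apply/andP; split; lra.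
have /choice[v hv] : forall c : 'I_N, exists v : {poly R}, (size v <= D)%N /\
    poly_int mu (cell a rho c) ((Q - v) ^+ 2) <=
    C * rho ^+ p.*2 * poly_int mu (cell a rho c) H + e.
  by move=> c; apply: hD => //; [exact: measurable_cell|exact: dA].
exists (fun c k => l * (v c)`_k).
have H0 x : 0 <= H.[x].
  rewrite horner_deriv_square addr_ge0 ?sqr_ge0 // sumr_ge0 // => i _.
  exact: sqr_ge0.
have mc (c : 'I_N) : measurable (cell a rho c) by exact: measurable_cell.
under eq_integral => x _.
  have -> : (\1_[set` `[a, a + N%:R * rho[%R] x * (q j).[x] -
       \sum_(c < N) \sum_(k < D) l * (v c)`_k * (\1_(cell a rho c) x * x ^+ k)) ^+ 2 =
     \sum_(c < N) \1_(cell a rho c) x * (l ^+ 2 *: (Q - v c) ^+ 2).[x].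
    have -> : \sum_(c < N) \sum_(k < D) l * (v c)`_k * (\1_(cell a rho c) x * x ^+ k) =
        \sum_(c < N) \1_(cell a rho c) x * (l * (v c).[x]).
      apply: eq_bigr => c _; rewrite (horner_coef_wide _ (hv c).1) !mulr_sumr.
      by apply: eq_bigr => k _; ring.
    have [[c0 [-> hc]]|[-> hc]] := cell_indic a N x rho0.
      rewrite (bigD1 c0) //= hc eqxx big1 => [|c cc0]; last by rewrite hc (negbTE cc0) mul0r.
      rewrite (bigD1 c0) //= hc eqxx big1 => [|c cc0]; last by rewrite hc (negbTE cc0) mul0r.
      by rewrite !addr0 !mul1r hornerZ horner_exp hornerD hornerN qE hornerZ -/Q; ring.
    rewrite big1 => [|c _]; last by rewrite hc mul0r.
    rewrite big1 => [|c _]; last by rewrite hc mul0r.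
    by rewrite mul0r subrr expr0n.
  over.
rewrite integral_cells //; last first.
  by move=> c x; rewrite hornerZ horner_exp mulr_ge0 ?sqr_ge0.
rewrite lee_fin.
have JH : \sum_(c < N) poly_int mu (cell a rho c) H <= 2 * J ((Q^`(p)) ^+ 2).
  rewrite -(deriv_square_int moments q_size q_orth zi p0 qE).
  rewrite -lee_fin -(@integral_cells N (fun c => cell a rho c) (fun _ => H)) //.
  rewrite -(@poly_intE R mu moments setT mT H) //; apply: ge0_le_integral => //.
  - by move=> x _; rewrite lee_fin sumr_ge0 // => c _; rewrite mulr_ge0.
  - apply/measurable_EFinP; apply: measurable_sum => c; apply: measurable_funM.
      exact: measurable_indic.
    exact: measurable_horner.
  - apply/measurable_EFinP; exact: (measurable_horner H).
  - move=> x _; rewrite lee_fin -mulr_suml ler_piMl //.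
    have [[c0 [_ hc]]|[_ hc]] := cell_indic a N x rho0.
      by rewrite (bigD1 c0) //= hc eqxx big1 ?addr0 // => c cc0; rewrite hc (negbTE cc0).
    by rewrite big1 // ler01.
have -> : J ((q j)^`(p) ^+ 2) = l ^+ 2 * J ((Q^`(p)) ^+ 2).
  by rewrite qE derivnZ exprZn poly_intZ.
apply: (@le_trans _ _ (l ^+ 2 * \sum_(c < N)
    (C * rho ^+ p.*2 * poly_int mu (cell a rho c) H + e))).
  rewrite mulr_sumr; apply: ler_sum => c _; rewrite poly_intZ //.
  by rewrite ler_wpM2l ?sqr_ge0 //; have [] := hv c.
rewrite big_split /= -mulr_sumr sumr_const card_ord -[e *+ N]mulr_natr.
rewrite /e divfK ?gt_eqF // [X in _ <= X]mulrCA ler_wpM2l ?sqr_ge0 //.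
have Cr : 0 <= C * rho ^+ p.*2 by rewrite mulr_ge0 ?exprn_ge0 // ltW.
have := ler_wpM2l Cr JH; lra.
Qed.
End cells.

Lemma cauchy_schwarz_sum (R : realType) (I : finType) (a b : I -> R) :
  (\sum_i a i * b i) ^+ 2 <= (\sum_i a i ^+ 2) * (\sum_i b i ^+ 2).
Proof.
have h : 0 <= \sum_i \sum_j (a i * b j - a j * b i) ^+ 2.
  by apply: sumr_ge0 => i _; apply: sumr_ge0 => j _; exact: sqr_ge0.
have e : \sum_i \sum_j (a i * b j - a j * b i) ^+ 2 =
    \sum_i \sum_j (a i ^+ 2 * b j ^+ 2) + \sum_i \sum_j (a j ^+ 2 * b i ^+ 2)
    - 2 * \sum_i \sum_j (a i * b i) * (a j * b j).
  rewrite mulr_sumr -sumrN -!big_split /=; apply: eq_bigr => i _.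
  rewrite mulr_sumr -sumrN -!big_split /=; apply: eq_bigr => j _; ring.
have e1 : \sum_i \sum_j (a i ^+ 2 * b j ^+ 2) = (\sum_i a i ^+ 2) * (\sum_i b i ^+ 2).
  by rewrite big_distrlr.
have e2 : \sum_i \sum_j (a j ^+ 2 * b i ^+ 2) = (\sum_i a i ^+ 2) * (\sum_i b i ^+ 2).
  by rewrite exchange_big big_distrlr.
have e3 : \sum_i \sum_j (a i * b i) * (a j * b j) = (\sum_i a i * b i) ^+ 2.
  by rewrite expr2 big_distrlr.
by move: h; rewrite e e1 e2 e3; lra.
Qed.

(** Telescoping: [1 / y ^+ 3 <= 2 / x - 2 / y] for the square roots [x] and [y] of consecutive
    integers. *)
Lemma sum_inv_pow32 (R : realType) (A n : nat) : (0 < A)%N ->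
  \sum_(i < n) ((A + i).+1%:R * Num.sqrt (A + i).+1%:R)^-1 <= 2 / Num.sqrt A%:R :> R.
Proof.
move=> A0; suff h : \sum_(i < n) ((A + i).+1%:R * Num.sqrt (A + i).+1%:R)^-1 <=
    2 / Num.sqrt A%:R - 2 / Num.sqrt (A + n)%:R :> R.
  by apply: le_trans h _; rewrite lerBlDr lerDl divr_ge0 ?sqrtr_ge0.
elim: n => [|n IHn]; first by rewrite big_ord0 addn0 subrr.
rewrite big_ord_recr /=; have := IHn.
set s := \sum_(i < n) _; set x := Num.sqrt (A + n)%:R.
rewrite addnS; set y := Num.sqrt (A + n).+1%:R.
have x0 : 0 < x by rewrite sqrtr_gt0 ltr0n addn_gt0 A0.
have y0 : 0 < y by rewrite sqrtr_gt0 ltr0n.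
have xy : x <= y by rewrite ler_wsqrtr // ler_nat.
have x2 : x ^+ 2 = (A + n)%:R by rewrite sqr_sqrtr.
have y2 : y ^+ 2 = (A + n).+1%:R by rewrite sqr_sqrtr.
rewrite -y2; have e : y ^+ 2 - x ^+ 2 = 1 by rewrite x2 y2 -natr1; ring.
suff : (y ^+ 2 * y)^-1 <= 2 / x - 2 / y by lra.
have -> : 2 / x - 2 / y = 2 / (x * y * (x + y)).
  have -> : 2 / (x * y * (x + y)) = 2 * (y ^+ 2 - x ^+ 2) / (x * y * (x + y)) by rewrite e mulr1.
  by field; rewrite !gt_eqF //= addr_gt0.
have xy0 : 0 < x * y * (x + y) by rewrite !mulr_gt0 // addr_gt0.
rewrite ler_pdivlMr // mulrC ler_pdivrMr ?mulr_gt0 ?exprn_gt0 //.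
have -> : 2 * (y ^+ 2 * y) = y * y * (y + y) by ring.
by rewrite ler_pM ?lerD // ?mulr_ge0 ?addr_ge0 ?(ltW x0) ?(ltW y0) // ler_wpM2r // ltW.
Qed.

(** * Finite-dimensional approximation of ellipsoids in [L2] *)

Section hilbert.
Context d (T : measurableType d) (R : realType).
Variable mu : {measure set T -> \bar R}.
Local Notation inner := (inner mu).
Local Notation norm2 := (norm2 mu).
Local Notation sq_integrable := (sq_integrable mu).

Lemma norm2_comb (I : finType) (c : I -> R) (s : I -> T -> R) :
  (forall i, sq_integrable (s i)) ->
  norm2 (fun x => \sum_i c i * s i x) <= Num.sqrt ((\sum_i c i ^+ 2) * \sum_i inner (s i) (s i)).
Proof.
move=> hs.
apply: le_trans (norm2_sum _ (fun i _ => sq_integrableZ (c i) (hs i))) _.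
under eq_bigr => i _ do rewrite norm2Z //.
rewrite -ler_sqr ?nnegrE ?sqrtr_ge0 ?sumr_ge0 // => [|i _]; last by rewrite mulr_ge0 ?norm2_ge0.
rewrite sqr_sqrtr; last first.
  by rewrite mulr_ge0 ?sumr_ge0 // => i _; [exact: sqr_ge0|exact: inner_ge0].
apply: le_trans (cauchy_schwarz_sum _ _) _.
rewrite le_eqVlt; apply/orP; left; apply/eqP; congr (_ * _); apply: eq_bigr => i _.
  exact: real_normK (num_real _).
exact: sqr_norm2.
Qed.

(** [gram_width] for the Gram matrix of the [s j], whose trace is a squared Hilbert-Schmidt norm. *)
Lemma l2_width (J k : nat) (s : 'I_J -> T -> R) (tau : R) : 0 <= tau ->
  (forall j, sq_integrable (s j)) -> \sum_j inner (s j) (s j) <= k%:R * tau ->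
  exists v : 'I_k -> T -> R, (forall i, sq_integrable (v i)) /\
   forall c : 'I_J -> R, exists y : 'I_k -> R,
    norm2 (fun x => \sum_j c j * s j x - \sum_i y i * v i x) <= Num.sqrt (tau * \sum_j c j ^+ 2).
Proof.
move=> tau0 hs htr.
pose B : 'M[R]_J := \matrix_(i, j) inner (s i) (s j).
have comb (c : 'rV[R]_J) : sq_integrable (fun x => \sum_j c 0 j * s j x).
  by apply: sq_integrable_sum => j _; exact: sq_integrableZ.
have BE (c : 'rV[R]_J) : qform B c =
    inner (fun x => \sum_j c 0 j * s j x) (fun x => \sum_j c 0 j * s j x).
  rewrite inner_suml // /qform mxE; apply: eq_bigr => j _; rewrite !mxE mulrC.
  congr (_ * _); rewrite innerC inner_suml //; apply: eq_bigr => i _.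
  by rewrite !mxE.
have [||e he] := @gram_width R J k B tau tau0.
- by move=> c; rewrite BE inner_ge0.
- by rewrite /mxtrace; under eq_bigr do rewrite mxE.
exists (fun i x => \sum_j e i 0 j * s j x); split => [i|c]; first exact: comb.
have [y hy] := he (\row_j c j); exists y.
have -> : (fun x => \sum_j c j * s j x - \sum_i y i * \sum_j e i 0 j * s j x) =
    (fun x => \sum_j (\row_j c j - \sum_i y i *: e i) 0 j * s j x).
  apply/funext => x; under [RHS]eq_bigr => j _ do rewrite !mxE summxE mulrBl mulr_suml.
  rewrite sumrB; congr (_ - _); rewrite exchange_big; apply: eq_bigr => i _.
  by rewrite mulr_sumr; apply: eq_bigr => j _; rewrite mxE mulrA.
rewrite norm2E -BE; apply: ler_wsqrtr; apply: le_trans hy _.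
by rewrite qform1; under eq_bigr do rewrite mxE.
Qed.

(** The first [J0] functions enter the space themselves. Of the remainders [D j] modulo the span of
    [phi], the next [L] are compressed to [k] directions by [l2_width], and the later ones are small
    by Cauchy-Schwarz. Together with the truncation of the series this makes three errors of size
    [sqrt tau * M]. *)
Lemma sieve_approx (W : finType) (phi : W -> T -> R) (f : nat -> T -> R) (al : nat -> W -> R)
    (t : nat -> R) (J0 L k : nat) (tau : R) :
  let D j x := f j x - \sum_w al j w * phi w x in
  0 <= tau -> (forall w, sq_integrable (phi w)) -> (forall j, sq_integrable (f j)) ->
  (forall j, 0 < t j) ->
  \sum_(i < L) inner (D (J0 + i)%N) (D (J0 + i)%N) / t (J0 + i)%N ^+ 2 <= k%:R * tau ->
  (forall r, \sum_(i < r) inner (D (J0 + L + i)%N) (D (J0 + L + i)%N) / t (J0 + L + i)%N ^+ 2 <= tau) ->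
  exists u : ('I_J0 + W + 'I_k)%type -> T -> R, (forall i, sq_integrable (u i)) /\
   forall (G : T -> R) (eta : nat -> R) (M : R), 0 <= M -> sq_integrable G ->
    (forall n, \sum_(j < n) eta j ^+ 2 * t j ^+ 2 <= M ^+ 2) ->
    (exists2 n, (J0 + L <= n)%N & norm2 (fun x => G x - \sum_(j < n) eta j * f j x) <= Num.sqrt tau * M) ->
    exists y, norm2 (fun x => G x - \sum_i y i * u i x) <= 3 * (Num.sqrt tau * M).
Proof.
move=> D tau0 hphi hf t0 hL hr.
have hD j : sq_integrable (D j).
  by apply: sq_integrableB => //; apply: sq_integrable_sum => w _; exact: sq_integrableZ.
pose s j x := (t j)^-1 * D j x.
have hs j : sq_integrable (s j) by exact: sq_integrableZ.
have sE j : inner (s j) (s j) = inner (D j) (D j) / t j ^+ 2.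
  by rewrite -sqr_norm2 (norm2Z _ (hD j)) exprMn real_normK ?num_real // sqr_norm2 exprVn mulrC.
have [|v [hv hvy]] := @l2_width L k (fun i => s (J0 + i)%N) tau tau0 (fun i => hs _).
  by under eq_bigr do rewrite sE.
pose u (i : 'I_J0 + W + 'I_k) := match i with
  | inl (inl j) => f j | inl (inr w) => phi w | inr i => v i end.
exists u; split => [|G eta M M0 hG hM [n nJ hn]].
  by move=> [[j|w]|i]; rewrite /u.
pose r := (n - (J0 + L))%N; have nE : n = (J0 + L + r)%N by rewrite subnKC.
pose c j := eta j * t j.
have cM i m : \sum_(j < m) c (i + j)%N ^+ 2 <= M ^+ 2.
  apply: le_trans (hM (i + m)%N); rewrite big_split_ord /= ler_wpDl ?sumr_ge0 //.
    by move=> j _; rewrite mulr_ge0 ?sqr_ge0.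
  by apply: ler_sum => j _; rewrite exprMn.
have cs j x : c j * s j x = eta j * f j x - eta j * \sum_w al j w * phi w x.
  by rewrite /c /s mulrA mulfK ?gt_eqF // mulrBr.
have [y hy] := hvy (fun i => c (J0 + i)%N).
pose z (i : 'I_J0 + W + 'I_k) := match i with
  | inl (inl j) => eta j
  | inl (inr w) => \sum_(j < L) eta (J0 + j)%N * al (J0 + j)%N w +
                   \sum_(j < r) eta (J0 + L + j)%N * al (J0 + L + j)%N w
  | inr i => y i end.
exists z.
have swap x i m : \sum_w (\sum_(j < m) eta (i + j)%N * al (i + j)%N w) * phi w x =
    \sum_(j < m) eta (i + j)%N * \sum_w al (i + j)%N w * phi w x.
  under eq_bigr do rewrite mulr_suml.
  rewrite exchange_big; apply: eq_bigr => j _; rewrite mulr_sumr.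
  by apply: eq_bigr => w _; rewrite mulrA.
have -> : (fun x => G x - \sum_i z i * u i x) =
  (fun x => (G x - \sum_(j < n) eta j * f j x) +
    ((\sum_(j < r) c (J0 + L + j)%N * s (J0 + L + j)%N x) +
    (\sum_(j < L) c (J0 + j)%N * s (J0 + j)%N x - \sum_i y i * v i x))).
  apply/funext => x; rewrite !big_sumType /= nE !big_split_ord /=.
  under [\sum_i (_ + _) * _]eq_bigr do rewrite mulrDl.
  rewrite big_split /= !swap.
  do 2 under [\sum_(j < _) c _ * _]eq_bigr do rewrite cs.
  rewrite !sumrB.
  ring.
have iG : sq_integrable (fun x => G x - \sum_(j < n) eta j * f j x).
  by apply: sq_integrableB => //; apply: sq_integrable_sum => j _; exact: sq_integrableZ.
have iS i m : sq_integrable (fun x => \sum_(j < m) c (i + j)%N * s (i + j)%N x).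
  by apply: sq_integrable_sum => j _; exact: sq_integrableZ.
have iV : sq_integrable (fun x => \sum_(j < L) c (J0 + j)%N * s (J0 + j)%N x - \sum_i y i * v i x).
  by apply: sq_integrableB => //; apply: sq_integrable_sum => j _; exact: sq_integrableZ.
apply: le_trans (norm2D iG (sq_integrableD (iS _ _) iV)) _.
have h3 := norm2D (iS (J0 + L)%N r) iV.
have sM : Num.sqrt (tau * M ^+ 2) = Num.sqrt tau * M by rewrite sqrtrM // sqrtr_sqr ger0_norm.
have h1 : norm2 (fun x => \sum_(j < r) c (J0 + L + j)%N * s (J0 + L + j)%N x) <= Num.sqrt tau * M.
  apply: le_trans (norm2_comb _ (fun j => hs _)) _; rewrite -sM; apply: ler_wsqrtr.
  rewrite mulrC; apply: ler_pM; rewrite ?sumr_ge0 //.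
  - by move=> j _; exact: inner_ge0.
  - by move=> j _; exact: sqr_ge0.
  - by under eq_bigr do rewrite sE.
have h2 := le_trans hy (ler_wsqrtr (ler_wpM2l tau0 (cM J0 L))); rewrite sM in h2.
lra.
Qed.
End hilbert.

Section sieve_exponents.
Variable p : nat.

(* On [-m, m[ the sieve of radius M is within M m^(-sieve_rate/2) of a space of
   dimension O(m^sieve_dim). The rate exceeds (sieve_dim + 1)(2p + 1), so that with
   m = n^(1/sieve_rate) the dimension times log n is O(n^(1/(2p+1))). *)

Definition sieve_dim : nat := (4 * p + 4).*2.
Definition sieve_rate : nat := (sieve_dim.+1 * (2 * p + 1)).+1.

Lemma sieve_exponent :
  (sieve_rate + p.*2 + 2 = sieve_dim * p.*2 + (4 * p + 4) * 3)%N.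
Proof.
rewrite /sieve_rate mulSn mulnDr muln1 mul2n.
have : sieve_dim = (8 * p + 8)%N by rewrite /sieve_dim; lia.
by move: sieve_dim (sieve_dim * p.*2)%N => d z ->; lia.
Qed.

Lemma sieve_dim_le_rate : (sieve_dim <= sieve_rate)%N.
Proof. by rewrite /sieve_rate leqW // (leq_trans (leqnSn _)) // leq_pmulr // addn1. Qed.

End sieve_exponents.

Section sieve.
Variables (R : realType) (mu : {measure set (measurableTypeR R) -> \bar R}).
Hypothesis moments : forall k, (\int[mu]_x (`|x| ^+ k)%:E < +oo)%E.
Local Notation J := (poly_int mu setT).
Hypothesis positive : forall P : {poly R}, P != 0 -> (forall x, 0 <= P.[x]) -> 0 < J P.
Variable q : nat -> {poly R}.
Hypothesis q_size : forall j, size (q j) = j.+1.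
Hypothesis q_orth : forall i j, i != j -> J (q i * q j) = 0.
Variables (p : nat) (gt : nat -> R).
Hypothesis p_gt0 : (0 < p)%N.
Hypothesis gt_gt0 : forall j, 0 < gt j.
Hypothesis gt_deriv : forall j, (p <= j)%N ->
  \sum_(i < j) ((J (q i ^+ 2))^-1 * J ((q j)^`(p) * q i)) ^+ 4 * J (q i ^+ 2) <= gt j.
Hypothesis gt_gam : forall i j, (i < j)%N -> j%:R ^+ 4 * J (q i ^+ 2) <= gt j.

Lemma sqrtr_exprn_half (m b : nat) : Num.sqrt ((m ^ b.*2)%:R) = m%:R ^+ b :> R.
Proof. by rewrite -muln2 expnM natrX sqrtr_sqr ger0_norm // natrX. Qed.

(** [sieve_approx] with monomials on cells as [phi]. Put [B = m ^ (4 p + 4)], so that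
    [m ^ b = B ^ 2]. The square sum of the weighted remainders is [O(rho ^ (2 p) / B)] past index
    [B ^ 2] and [O(rho ^ (2 p) / B ^ 3)] past index [B ^ 6]; with the latter as [tau], the former is
    [B ^ 2 * tau], whence [B ^ 2] directions. *)
Lemma finite_sieve : exists Cd : nat, forall c0 : R, 0 < c0 -> \forall m \near \oo,
  exists (U : finType) (u : U -> R -> R),
  [/\ (#|U| <= Cd * m ^ sieve_dim p)%N, forall i, sq_integrable mu (u i) &
   forall (G : R -> R) (eta : nat -> R) (M : R), 0 < M -> sq_integrable mu G ->
   (\int[mu]_x ((G x - \sum_(j < n) eta j * (q j).[x]) ^+ 2)%:E)%E @[n --> \oo] --> 0%E ->
   (forall n, \sum_(j < n) eta j ^+ 2 * gt j <= M ^+ 2) ->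
   exists y, norm2 mu (fun x => \1_[set` `[- m%:R, m%:R[%R] x * G x - \sum_i y i * u i x) ^+ 2 <=
     c0 / m.+1%:R ^+ sieve_rate p * M ^+ 2].
Proof.
have [D [C [C0 hDC]]] := cell_approx moments positive q_size q_orth p_gt0.
set b' := (4 * p + 4)%N; set b := sieve_dim p; set c := sieve_rate p.
exists (p + 3 + 2 * D)%N => c0 c00.
(* 18 is the square of the three errors times the 2 in [tau], and [2 ^+ c] pays for replacing [m.+1]
   by [2 * m]. By [sieve_exponent] a factor [1 / m ^+ 2] is left over to absorb this constant. *)
exists (Num.truncn (18 * C * 2 ^+ c / c0)).+1 => // m /= hm.
have m0 : (0 < m)%N by apply: leq_trans hm.
have x0 : 0 < m%:R :> R by rewrite ltr0n.
have mb0 : (0 < m ^ b)%N by rewrite expn_gt0 m0.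
set N := (2 * m ^ b)%N; have N0 : (0 < N)%N by rewrite muln_gt0.
pose rho : R := m%:R / m%:R ^+ b; have rho0 : 0 < rho by rewrite divr_gt0 ?exprn_gt0.
have NR : - m%:R + N%:R * rho = m%:R :> R.
  by rewrite /N /rho natrM natrX; field; rewrite gt_eqF // exprn_gt0.
pose Delta : set (measurableTypeR R) := [set` `[- m%:R, m%:R[%R].
have mD : measurable Delta by exact: measurable_itv.
have /choice[al hal] : forall j, exists al : 'I_N -> 'I_D -> R, (p <= j)%N ->
    (\int[mu]_x ((\1_Delta x * (q j).[x] -
       \sum_c \sum_k al c k * (\1_(cell (- m%:R) rho c) x * x ^+ k)) ^+ 2)%:E <=
     (C * rho ^+ p.*2 * J (((q j)^`(p)) ^+ 2))%:E)%E.
  move=> j; case: (leqP p j) => pj; last by exists (fun _ _ => 0).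
  by have [al hal] := hDC j (- m%:R) rho N pj rho0 N0; exists al => _; rewrite NR in hal.
pose phi (i : 'I_N * 'I_D) (x : R) := \1_(cell (- m%:R) rho i.1) x * ('X^(i.2)).[x].
pose f j x := \1_Delta x * (q j).[x].
have hphi i : sq_integrable mu (phi i).
  by apply: sq_integrable_indic; [exact: measurable_cell|exact: sq_integrable_horner].
have hf j : sq_integrable mu (f j).
  by apply: sq_integrable_indic => //; exact: sq_integrable_horner.
pose t j := Num.sqrt (gt j).
have t0 j : 0 < t j by rewrite sqrtr_gt0.
have t2 j : t j ^+ 2 = gt j by rewrite sqr_sqrtr // ltW.
pose DD j x := f j x - \sum_(i : 'I_N * 'I_D) al j i.1 i.2 * phi i x.
have hDD j : sq_integrable mu (DD j).
  by apply: sq_integrableB => //; apply: sq_integrable_sum => w _; exact: sq_integrableZ.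
have DDb j : (p <= j)%N -> inner mu (DD j) (DD j) / t j ^+ 2 <=
    C * rho ^+ p.*2 * (j%:R * Num.sqrt j%:R)^-1.
  move=> pj; have j0 : (0 < j)%N := leq_trans p_gt0 pj.
  have jj0 : 0 < j%:R * Num.sqrt j%:R :> R by rewrite mulr_gt0 ?sqrtr_gt0 ?ltr0n.
  rewrite t2 ler_pdivrMr // mulrAC ler_pdivlMr //.
  have h1 := deriv_int_bound moments positive q_size q_orth p_gt0 j0 (gt_deriv pj)
    (fun i ij => gt_gam ij).
  have h2 : inner mu (DD j) (DD j) <= C * rho ^+ p.*2 * J ((q j)^`(p) ^+ 2).
    rewrite -lee_fin -integral_sqr //; apply: le_trans (hal j pj).
    rewrite le_eqVlt; apply/orP; left; apply/eqP; apply: eq_integral => x _.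
    congr ((_ - _) ^+ 2)%:E; rewrite pair_big; apply: eq_bigr => i _.
    by rewrite /phi hornerXn.
  apply: le_trans (ler_wpM2r (ltW jj0) h2) _.
  by rewrite -[X in X <= _]mulrA; apply: ler_wpM2l h1; rewrite mulr_ge0 ?exprn_ge0 // ltW.
(* The summand [p] keeps every remainder at an index where [gt_deriv] applies. *)
set A := (m ^ b + p)%N.
have bE : (m ^ b)%:R = m%:R ^+ b' ^+ 2 :> R.
  by rewrite natrX -exprM muln2.
have A0 : (0 < A)%N by rewrite addn_gt0 mb0.
pose tau : R := 2 * C * rho ^+ p.*2 / m%:R ^+ b' ^+ 3.
have xb0 : 0 < m%:R ^+ b' :> R by rewrite exprn_gt0.
have tau0 : 0 < tau.
  by rewrite /tau !(divr_gt0, mulr_gt0, exprn_gt0).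
have Crho0 : 0 <= C * rho ^+ p.*2 by rewrite mulr_ge0 ?exprn_ge0 // ltW.
have hsum A' r (B : R) : (A <= A')%N -> 0 < B -> B <= Num.sqrt A'%:R ->
    \sum_(i < r) inner mu (DD (A'.+1 + i)%N) (DD (A'.+1 + i)%N) / t (A'.+1 + i)%N ^+ 2 <=
    2 * C * rho ^+ p.*2 / B.
  move=> AA B0 hB; have A'0 : (0 < A')%N := leq_trans A0 AA.
  apply: (@le_trans _ _ (C * rho ^+ p.*2 *
      \sum_(i < r) ((A' + i).+1%:R * Num.sqrt (A' + i).+1%:R)^-1)).
    rewrite mulr_sumr; apply: ler_sum => i _; rewrite addSn; apply: DDb.
    by rewrite leqW // -(addn0 p) leq_add // (leq_trans _ AA) // leq_addl.
  have -> : 2 * C * rho ^+ p.*2 / B = C * rho ^+ p.*2 * (2 / B) by field; rewrite gt_eqF.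
  rewrite ler_wpM2l //; apply: le_trans (sum_inv_pow32 _ _ A'0) _.
  by rewrite ler_pM2l // lef_pV2 ?posrE // (lt_le_trans B0).
have hL : \sum_(i < m ^ (3 * b)) inner mu (DD (A.+1 + i)%N) (DD (A.+1 + i)%N) / t (A.+1 + i)%N ^+ 2 <=
    (m ^ b)%:R * tau.
  have -> : (m ^ b)%:R * tau = 2 * C * rho ^+ p.*2 / m%:R ^+ b'.
    by rewrite bE /tau; field; rewrite gt_eqF.
  apply: hsum => //; rewrite -sqrtr_exprn_half ler_wsqrtr // ler_nat.
  exact: leq_addr.
have hr r : \sum_(i < r) inner mu (DD (A.+1 + m ^ (3 * b) + i)%N) (DD (A.+1 + m ^ (3 * b) + i)%N)
    / t (A.+1 + m ^ (3 * b) + i)%N ^+ 2 <= tau.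
  rewrite addSn; apply: hsum; rewrite ?leq_addr ?exprn_gt0 //.
  rewrite -exprM -sqrtr_exprn_half ler_wsqrtr // ler_nat.
  have -> : ((b' * 3).*2 = 3 * b)%N by rewrite mulnC -doubleMr.
  exact: leq_addl.
have [u [hu hG]] := sieve_approx (al := fun j i => al j i.1 i.2) (ltW tau0) hphi hf t0 hL hr.
exists ('I_A.+1 + ('I_N * 'I_D) + 'I_(m ^ b))%type, u; split => //.
  rewrite !card_sum card_prod !card_ord /A /N.
  have : (p <= p * m ^ b)%N by rewrite leq_pmulr.
  lia.
move=> G eta M M0 sG cvG hM.
have sDG : sq_integrable mu (fun x => \1_Delta x * G x) by exact: sq_integrable_indic.
have sM0 : 0 < Num.sqrt tau * M by rewrite mulr_gt0 ?sqrtr_gt0.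
have [||y hy] := hG _ eta M (ltW M0) sDG.
- by move=> n; under eq_bigr do rewrite t2; exact: hM.
- have /fine_cvgP[_ /cvgrPdist_lt /(_ ((Num.sqrt tau * M) ^+ 2) (exprn_gt0 _ sM0))] := cvG.
  case=> n0 _ hn0; exists (n0 + (A.+1 + m ^ (3 * b)))%N; first exact: leq_addl.
  set n := (n0 + _)%N; have {hn0} := hn0 n (leq_addr _ _) => /=.
  have sGn : sq_integrable mu (fun x => G x - \sum_(j < n) eta j * (q j).[x]).
    apply: sq_integrableB => //; apply: sq_integrable_sum => j _.
    by apply: sq_integrableZ; exact: sq_integrable_horner.
  rewrite integral_sqr //= sub0r normrN => /ltW/(le_trans (ler_norm _)) h.
  rewrite -ler_sqr ?nnegrE ?norm2_ge0 ?(ltW sM0) //; apply: le_trans h.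
  have -> : (fun x => \1_Delta x * G x - \sum_(j < n) eta j * f j x) =
      (fun x => \1_Delta x * (G x - \sum_(j < n) eta j * (q j).[x])).
    apply/funext => x; rewrite mulrBr mulr_sumr; congr (_ - _).
    by apply: eq_bigr => j _; rewrite mulrCA.
  by rewrite -sqr_norm2; apply: lerXn2r; rewrite ?nnegrE ?norm2_ge0 //; exact: norm2_indic_le.
exists y; have {}hy : norm2 mu (fun x => \1_Delta x * G x - \sum_i y i * u i x) ^+ 2 <=
    (3 * (Num.sqrt tau * M)) ^+ 2.
  by rewrite lerXn2r ?nnegrE ?norm2_ge0 // mulr_ge0 // ltW.
apply: le_trans hy _; rewrite !exprMn sqr_sqrtr ?(ltW tau0) // mulrA.
rewrite ler_pM2r ?exprn_gt0 // ler_pdivlMr ?exprn_gt0 ?ltr0n //.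
have hm1 : m.+1%:R ^+ c <= (2 * m%:R) ^+ c :> R.
  have h2 : m.+1%:R <= 2 * m%:R :> R.
    by rewrite -natrM ler_nat mul2n -addnn -addn1 leq_add2l.
  by apply: lerXn2r h2; rewrite nnegrE ?mulr_ge0 ?ler0n.
have h18 : 0 <= 3 ^+ 2 * tau by rewrite mulr_ge0 // ltW.
apply: le_trans (ler_wpM2l h18 hm1) _.
have -> : 3 ^+ 2 * tau * (2 * m%:R) ^+ c = 18 * C * 2 ^+ c / m%:R ^+ 2.
  rewrite /tau /rho expr_div_n.
  have e1 : m%:R ^+ c * m%:R ^+ p.*2 * m%:R ^+ 2 = m%:R ^+ b ^+ p.*2 * m%:R ^+ b' ^+ 3 :> R.
    rewrite -!exprM -!exprD; congr (_ ^+ _).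
    exact: sieve_exponent.
  have e2 : m%:R ^+ c = m%:R ^+ b ^+ p.*2 * m%:R ^+ b' ^+ 3 / (m%:R ^+ p.*2 * m%:R ^+ 2) :> R.
    by rewrite -e1; field; rewrite !gt_eqF ?exprn_gt0.
  rewrite exprMn e2; field.
  by rewrite !gt_eqF ?exprn_gt0 // exprn_gt0.
rewrite ler_pdivrMr ?exprn_gt0 //.
have : 18 * C * 2 ^+ c / c0 <= m%:R.
  by apply: ltW; apply: lt_le_trans (truncnS_gt _) _; rewrite ler_nat.
rewrite ler_pdivrMr // => h; apply: le_trans h _.
rewrite mulrC ler_pM2l // expr2 ler_peMr ?ler1n // ltW //.
Qed.
End sieve.

(** A separated family of maximal size is a net: an uncovered point would extend it. *)
Lemma finite_net (S : Type) (A : S -> Prop) (sep : S -> S -> Prop) (N : nat) :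
  (forall s t, sep s t -> sep t s) ->
  (forall k (x : 'I_k -> S), (forall i, A (x i)) -> (forall i j, i != j -> sep (x i) (x j)) ->
     (k <= N)%N) ->
  exists k (x : 'I_k -> S), [/\ (k <= N)%N, forall i, A (x i) &
    forall t, A t -> exists i, ~ sep t (x i)].
Proof.
move=> sepC hN.
pose Q k := `[< exists x : 'I_k -> S, (forall i, A (x i)) /\ (forall i j, i != j -> sep (x i) (x j)) >].
have Q0 : exists k, Q k.
  exists 0; apply/asboolP; have x0 : 'I_0 -> S by case.
  by exists x0; split => [[]|[]].
have QN k : Q k -> (k <= N)%N by move=> /asboolP[x [h1 h2]]; exact: hN h1 h2.
case: (ex_maxnP Q0 QN) => k Qk kmax; move/asboolP: (Qk) => [x [xA xsep]].
exists k, x; split => //; first exact: QN.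
move=> t At; apply: contrapT => /forallNP h.
suff /kmax : Q k.+1 by rewrite ltnn.
apply/asboolP; exists (fun i => if unlift ord0 i is Some j then x j else t); split => [i|i j].
  by case: unliftP.
case: unliftP => [i' ->|->]; case: unliftP => [j' ->|->] //.
- by rewrite (inj_eq lift_inj); exact: xsep.
- by move=> _; apply: sepC; exact: contrapT.
- by move=> _; exact: contrapT.
Qed.

(** * Finite nets *)

Section l1.
Context d (T : measurableType d) (R : realType).
Variable mu : {measure set T -> \bar R}.
Hypothesis mu_fin : (mu setT < +oo)%E.
Local Notation inner := (inner mu).
Local Notation norm2 := (norm2 mu).
Local Notation sq_integrable := (sq_integrable mu).

Definition norm1 (f : T -> R) : R := \int[mu]_x `|f x|.

Lemma sq_integrable_cst (r : R) : sq_integrable (fun=> r).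
Proof.
split; first exact: measurable_cst.
rewrite (eq_integral (cst (r ^+ 2)%:E)) // integral_cst //.
by rewrite lte_mul_pinfty // lee_fin sqr_ge0.
Qed.

Lemma sq_integrable_norm f : sq_integrable f -> sq_integrable (fun x => `|f x|).
Proof.
move=> [mf f2]; split; first exact: measurableT_comp.
by under eq_integral do rewrite real_normK ?num_real //.
Qed.

Lemma sq_integrable_int f : sq_integrable f -> mu.-integrable setT (EFin \o f).
Proof.
move=> hf; have := sq_integrable_mul hf (sq_integrable_cst 1).
by apply: eq_integrable => // x _; rewrite mulr1.
Qed.

Definition total_norm : R := norm2 (fun=> 1).

Lemma norm1_le_norm2 f : sq_integrable f -> norm1 f <= total_norm * norm2 f.
Proof.
move=> hf; have h1 := sq_integrable_norm hf.
have e1 : inner (fun x => `|f x|) (fun=> 1) = norm1 f.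
  by apply: eq_Rintegral => x _; rewrite mulr1.
have e2 : norm2 (fun x => `|f x|) = norm2 f.
  by congr Num.sqrt; apply: eq_Rintegral => x _; rewrite -normrM ger0_norm // -expr2 sqr_ge0.
by have := inner_le_norm2 h1 (sq_integrable_cst 1); rewrite e1 e2 mulrC.
Qed.

Lemma norm1D f g : sq_integrable f -> sq_integrable g ->
  norm1 (fun x => f x + g x) <= norm1 f + norm1 g.
Proof.
move=> hf hg.
have If := sq_integrable_int (sq_integrable_norm hf).
have Ig := sq_integrable_int (sq_integrable_norm hg).
have Ifg := sq_integrable_int (sq_integrable_norm (sq_integrableD hf hg)).
rewrite /norm1 -RintegralD //; apply: le_Rintegral => //; first exact: (sq_integrable_int (sq_integrableD (sq_integrable_norm hf) (sq_integrable_norm hg))).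
by move=> x _; exact: ler_normD.
Qed.

Lemma norm1Z c f : sq_integrable f -> norm1 (fun x => c * f x) = `|c| * norm1 f.
Proof.
move=> hf; have If := sq_integrable_int (sq_integrable_norm hf).
rewrite /norm1 -RintegralZl //; apply: eq_Rintegral => x _; exact: normrM.
Qed.

Lemma norm1_ge0 f : 0 <= norm1 f.
Proof. exact: Rintegral_ge0. Qed.

(** A packing of the approximants in a seminorm made of their [L1] norm and of the integral of
    [F s], kept as an extra coordinate. Neighbours then differ by an [L2] error [e] plus an element
    [v] of the space that is small in [L1], and their nearly equal integrals cancel the linear
    effect of [e] in [net_ratio_le]. Net points belong to [A] and so inherit its properties. *)
Lemma l2_net (U : finType) (u : U -> T -> R) (S : Type) (A : S -> Prop) (F : S -> T -> R)
    (delta : R) (D0 q : nat) :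
  (forall i, sq_integrable (u i)) -> (0 < D0)%N -> (0 < q)%N -> 2 + total_norm * delta <= D0%:R ->
  (forall s, A s -> [/\ sq_integrable (F s), norm1 (F s) <= 1 &
     exists y, norm2 (fun x => F s x - \sum_i y i * u i x) <= delta]) ->
  exists k (x : 'I_k -> S), [/\ (k <= ((#|U|.+1 * D0 * q).*2).+1 ^ #|U|.+1)%N, forall i, A (x i) &
    forall t, A t -> exists i, exists e v : T -> R,
      [/\ sq_integrable e, sq_integrable v, norm2 e <= 2 * delta, norm1 v <= q%:R^-1 &
      `|\int[mu]_y (F t y) - \int[mu]_y (F (x i) y)| <= q%:R^-1 /\
      forall y, F t y - F (x i) y = e y + v y]].
Proof.
move=> hu D00 q0 hD hA.
have /choice[y hy] : forall s, exists y : U -> R,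
    A s -> norm2 (fun x => F s x - \sum_i y i * u i x) <= delta.
  move=> s; case: (EM (A s)) => [As|nAs]; last by exists (fun=> 0).
  by have [_ _ [y hy]] := hA s As; exists y.
set dd := #|U|.+1.
pose comb (r : 'rV[R]_dd) (x : T) := \sum_i r 0 (lift ord0 (enum_rank i)) * u i x.
have hcomb r : sq_integrable (comb r).
  by apply: sq_integrable_sum => i _; exact: sq_integrableZ.
(* [D0] normalizes to the unit ball: an approximant has [L1] norm at most [1 + total_norm * delta],
   and the integral is at most 1 in absolute value. *)
pose N (r : 'rV[R]_dd) := D0%:R^-1 * (norm1 (comb r) + `|r 0 ord0|).
have D0R : 0 < D0%:R :> R by rewrite ltr0n.
have qR : 0 < q%:R :> R by rewrite ltr0n.
have N0 r : 0 <= N r by rewrite mulr_ge0 ?invr_ge0 ?ler0n // addr_ge0 // norm1_ge0.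
have combD r s : comb (r + s) = (fun x => comb r x + comb s x).
  by apply/funext => x; rewrite /comb -big_split; apply: eq_bigr => i _; rewrite mxE mulrDl.
have combZ c r : comb (c *: r) = (fun x => c * comb r x).
  by apply/funext => x; rewrite /comb mulr_sumr; apply: eq_bigr => i _; rewrite mxE mulrA.
have NA r s : N (r + s) <= N r + N s.
  rewrite /N -mulrDr ler_pM2l ?invr_gt0 // addrACA; apply: lerD; last by rewrite mxE ler_normD.
  by rewrite combD; exact: norm1D.
have NZ c r : N (c *: r) = `|c| * N r.
  by rewrite /N mulrCA mxE normrM combZ norm1Z // [in RHS]mulrDr.
pose X s : 'rV[R]_dd := \row_j if unlift ord0 j is Some i then y s (enum_val i) else \int[mu]_z (F s z).
have combX s x : comb (X s) x = \sum_i y s i * u i x.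
  by apply: eq_bigr => i _; rewrite mxE liftK enum_rankK.
have X0 s : X s 0 ord0 = \int[mu]_z (F s z) by rewrite mxE unlift_none.
(* Failing to be separated at this [K] means distance at most [1 / q] before the normalization by
   [D0]. *)
pose K := (dd * D0 * q)%N.
pose sep s t := dd%:R < N (X s - X t) * K%:R.
have N_le1 s : A s -> N (X s) <= 1.
  move=> As; have [sF F1 _] := hA s As; have hys := hy s As.
  rewrite /N ler_pdivrMl // mulr1; apply: le_trans hD.
  have i1 : `|X s 0 ord0| <= 1.
    by rewrite X0; apply: le_trans F1; apply: le_normr_Rintegral => //; exact: sq_integrable_int.
  have sd : sq_integrable (fun x => F s x - comb (X s) x) by exact: sq_integrableB.
  have n1 : norm1 (comb (X s)) <= norm1 (F s) + norm1 (fun x => -1 * (F s x - comb (X s) x)).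
    rewrite [X in norm1 X <= _](_ : _ = (fun x => F s x + -1 * (F s x - comb (X s) x))).
      by apply: norm1D => //; exact: sq_integrableZ.
    by apply/funext => x; ring.
  rewrite norm1Z // normrN1 mul1r in n1.
  have n2 := norm1_le_norm2 sd.
  have n3 : total_norm * norm2 (fun x => F s x - comb (X s) x) <= total_norm * delta.
    rewrite ler_wpM2l ?norm2_ge0 //; apply: le_trans hys.
    by under [X in norm2 X <= _]eq_fun do rewrite combX.
  lra.
have [||k [x [kN xA xcov]]] := @finite_net S A sep ((K.*2).+1 ^ dd).
- by move=> s t; rewrite /sep -opprB -scaleN1r NZ normrN1 mul1r.
- move=> k x xA xsep; have := separated_family_card N0 NA NZ (K := K) (x := fun i => X (x i)).
  by rewrite card_ord; apply => [i|i j /xsep//]; exact: N_le1.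
exists k, x; split => // t At; have [i hi] := xcov t At; exists i.
have [sFt _ _] := hA t At; have [sFi _ _] := hA (x i) (xA i).
exists (fun z => (F t z - \sum_j y t j * u j z) - (F (x i) z - \sum_j y (x i) j * u j z)),
  (comb (X t - X (x i))).
have su s : sq_integrable (fun z => \sum_j y s j * u j z).
  by apply: sq_integrable_sum => j _; exact: sq_integrableZ.
have hq : norm1 (comb (X t - X (x i))) + `|(X t - X (x i)) 0 ord0| <= q%:R^-1.
  move/negP: hi; rewrite -leNgt /N /K !natrM.
  set a := _ + _ => h; have h' : dd%:R * (a * q%:R) <= dd%:R * 1.
    rewrite mulr1; apply: le_trans h; rewrite le_eqVlt; apply/orP; left; apply/eqP.
    by field; rewrite gt_eqF.
  by rewrite ler_pM2l ?ltr0n // in h'; rewrite -[leRHS]mul1r ler_pdivlMr.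
have h1 := norm1_ge0 (comb (X t - X (x i))); have h2 := normr_ge0 ((X t - X (x i)) 0 ord0).
split.
- by apply: sq_integrableB; apply: sq_integrableB.
- exact: hcomb.
- have st := sq_integrableB sFt (su t); have si := sq_integrableB sFi (su (x i)).
  have h3 := hy _ At; have h4 := hy _ (xA i).
  have := norm2D st (sq_integrableZ (-1) si); rewrite norm2Z // normrN1 mul1r.
  under [X in norm2 X <= _]eq_fun do rewrite mulN1r; lra.
- lra.
- split; first by move: hq h1; rewrite !mxE unlift_none; lra.
  move=> z; have -> : comb (X t - X (x i)) z = comb (X t) z - comb (X (x i)) z.
    by rewrite combD -scaleN1r combZ mulN1r.
  by rewrite !combX; ring.
Qed.
End l1.

Section measurability.
Context d (T : measurableType d) (R : realType).
Implicit Type f : T -> R.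

Lemma measurable_inv f : measurable_fun setT f -> (forall x, 0 <= f x) ->
  measurable_fun setT (fun x => (f x)^-1).
Proof.
move=> mf f0; have -> : (fun x => (f x)^-1) = (fun x => f x `^ (-1)).
  by apply/funext => x; rewrite powR_inv1.
by apply: (@measurableT_comp _ _ _ _ _ _ (@powR R ^~ (-1))) => //; exact: measurable_powR.
Qed.

Lemma measurable_sqrt f : measurable_fun setT f -> measurable_fun setT (fun x => Num.sqrt (f x)).
Proof.
move=> mf; apply: (@measurableT_comp _ _ _ _ _ _ (@Num.sqrt R)) => //.
by apply: continuous_measurable_fun; exact: sqrt_continuous.
Qed.
End measurability.

Section densities.
Context d (T : measurableType d) (R : realType).
Variable mu : {measure set T -> \bar R}.
Hypothesis mu_fin : (mu setT < +oo)%E.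
Variable a : R.
Hypothesis a0 : 0 < a.
Local Notation norm2 := (norm2 mu).
Local Notation inner := (inner mu).
Local Notation norm1 := (norm1 mu).
Local Notation sq_integrable := (sq_integrable mu).

Record density (f : T -> R) : Prop := Density {
  density_sq : sq_integrable f;
  density_ge : forall x, a <= f x;
  density_int : \int[mu]_x f x = 1 }.

Lemma density_gt0 f x : density f -> 0 < f x.
Proof. by move=> hf; apply: lt_le_trans (density_ge hf x). Qed.

Lemma density_integrable f : density f -> mu.-integrable setT (EFin \o f).
Proof. by move=> hf; apply: (sq_integrable_int mu_fin); exact: density_sq. Qed.

Lemma density_eint f : density f -> (\int[mu]_x (f x)%:E = 1)%E.
Proof.
move=> hf; rewrite -[RHS](congr1 EFin (density_int hf)) /Rintegral fineK //.
exact: (integrable_fin_num measurableT (density_integrable hf)).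
Qed.

Lemma ge0_le_Rintegral (f h : T -> R) : measurable_fun setT f ->
  mu.-integrable setT (EFin \o h) -> (forall x, 0 <= f x <= h x) ->
  (\int[mu]_x (f x)%:E <= (\int[mu]_x h x)%:E)%E.
Proof.
move=> mf ih fh; rewrite /Rintegral fineK; last exact: (integrable_fin_num measurableT ih).
apply: ge0_le_integral => //.
- by move=> x _; rewrite lee_fin; have /andP[] := fh x.
- exact/measurable_EFinP.
- by have /integrableP[] := ih.
- by move=> x _; rewrite lee_fin; have /andP[] := fh x.
Qed.

Lemma integrable_add (f h : T -> R) : mu.-integrable setT (EFin \o f) ->
  mu.-integrable setT (EFin \o h) -> mu.-integrable setT (EFin \o (fun x => f x + h x)).
Proof. by move=> hf hh; exact: (integrableD measurableT hf hh). Qed.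

Lemma integrable_scale (c : R) (f : T -> R) : mu.-integrable setT (EFin \o f) ->
  mu.-integrable setT (EFin \o (fun x => c * f x)).
Proof. by move=> hf; exact: (integrableZl measurableT c hf). Qed.

Lemma integrable_sqr (f : T -> R) : sq_integrable f ->
  mu.-integrable setT (EFin \o (fun x => f x ^+ 2)).
Proof. exact: sq_integrable_sqr. Qed.

Lemma Rintegral_sqr (f : T -> R) : \int[mu]_x (f x ^+ 2) = norm2 f ^+ 2.
Proof. by rewrite sqr_norm2; apply: eq_Rintegral => x _; rewrite expr2. Qed.

Lemma density_meas f : density f -> measurable_fun setT f.
Proof. by case=> -[]. Qed.

(** [g0 ^+ 2 / f = (f - g0) ^+ 2 / f + 2 * g0 - f], and the last two terms integrate to 1. *)
Lemma chi_square_le (g0 f : T -> R) : density g0 -> density f ->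
  (\int[mu]_x (g0 x ^+ 2 / f x)%:E <= (1 + norm2 (fun x => f x - g0 x) ^+ 2 / a)%:E)%E.
Proof.
move=> hg hf; have ig := density_integrable hg; have iF := density_integrable hf.
have sfg := sq_integrableB (density_sq hf) (density_sq hg).
have i2 := integrable_scale a^-1 (integrable_sqr sfg).
have i3 := integrable_add (integrable_scale 2 ig) (integrable_scale (-1) iF).
have -> : 1 + norm2 (fun x => f x - g0 x) ^+ 2 / a =
    \int[mu]_x (a^-1 * (f x - g0 x) ^+ 2 + (2 * g0 x + -1 * f x)).
  rewrite RintegralD // RintegralZl //; last exact: integrable_sqr.
  rewrite RintegralD //; [|exact: integrable_scale|exact: integrable_scale].
  by rewrite !RintegralZl // Rintegral_sqr (density_int hg) (density_int hf); lra.
apply: ge0_le_Rintegral; last 1 first.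
- move=> x; have f0 := density_gt0 x hf; have := density_ge hf x => af.
  rewrite divr_ge0 ?sqr_ge0 ?(ltW f0) //=.
  have -> : g0 x ^+ 2 / f x = (f x - g0 x) ^+ 2 / f x + (2 * g0 x + -1 * f x).
    by field; rewrite gt_eqF.
  by rewrite lerD2r mulrC ler_wpM2r ?sqr_ge0 // lef_pV2 ?posrE.
- apply: measurable_funM; last by apply: measurable_inv => [|x]; [exact: density_meas|exact/ltW/density_gt0].
  exact: measurable_funX (density_meas hg).
- exact: integrable_add.
Qed.

Lemma affinity_le (g0 f : T -> R) (h : R) : density g0 -> density f ->
  (h%:E <= \int[mu]_x ((Num.sqrt (f x) - Num.sqrt (g0 x)) ^+ 2)%:E)%E ->
  (\int[mu]_x (Num.sqrt (f x * g0 x))%:E <= (1 - h / 2)%:E)%E.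
Proof.
move=> hg hf hh; have ig := density_integrable hg; have iF := density_integrable hf.
have sE f' x : density f' -> Num.sqrt (f' x) ^+ 2 = f' x.
  by move=> hf'; rewrite sqr_sqrtr // ltW // (density_gt0 x hf').
have sq_sqrt f' : density f' -> sq_integrable (fun x => Num.sqrt (f' x)).
  move=> hf'; split; first exact/measurable_sqrt/density_meas.
  under eq_integral => x _ do rewrite sE //.
  by rewrite density_eint // ltry.
have ssub := sq_integrableB (sq_sqrt _ hf) (sq_sqrt _ hg).
rewrite integral_sqr // lee_fin in hh.
have i1 := integrable_scale 2^-1 (integrable_add iF ig).
have i2 := integrable_scale (- 2^-1) (integrable_sqr ssub).
apply: (@le_trans _ _ (\int[mu]_x (2^-1 * (f x + g0 x) +
    - 2^-1 * (Num.sqrt (f x) - Num.sqrt (g0 x)) ^+ 2))%:E).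
  apply: ge0_le_Rintegral; last 1 first.
  - move=> x; rewrite sqrtr_ge0 sqrtrM ?(ltW (density_gt0 x hf)) //=.
    by rewrite -{2}(sE f x hf) -{2}(sE g0 x hg); set s := Num.sqrt _; set t := Num.sqrt _; lra.
  - by apply/measurable_sqrt/measurable_funM; exact: density_meas.
  - exact: integrable_add.
rewrite lee_fin RintegralD // RintegralZl ?integrable_add // RintegralZl; last 2 first => //.
  exact: integrable_sqr.
rewrite RintegralD // (density_int hg) (density_int hf) Rintegral_sqr sqr_norm2.
lra.
Qed.

(** Put [t = sqrt g0], [s = sqrt f1], [r = t / s]. On [C], [f * r = t * s + (e + v) * (r - 1) + (e +
    v)], whose last term integrates to the difference of masses. Moreover
    [e * (r - 1) = (e / s) * (t - s)] is at most [e ^+ 2 / (2 * a) + (t - s) ^+ 2 / 2], while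
    [t * s + (t - s) ^+ 2 / 2] is the mean of [f1] and [g0]. Thus [e] enters only quadratically. *)
Lemma net_ratio_le (C : set T) (g0 f f1 e v : T -> R) (delta : R) (q n : nat) :
  measurable C -> density g0 -> density f -> density f1 ->
  sq_integrable e -> sq_integrable v -> norm2 e <= 2 * delta -> norm1 v <= q%:R^-1 ->
  `|\int[mu]_x (\1_C x * f x) - \int[mu]_x (\1_C x * f1 x)| <= q%:R^-1 ->
  (forall x, \1_C x * f x - \1_C x * f1 x = e x + v x) ->
  (forall x, C x -> g0 x <= n%:R ^+ 2) ->
  (\int[mu]_x (\1_C x * f x * Num.sqrt (g0 x / f1 x))%:E <=
    (1 + 2 * delta ^+ 2 / a + (n%:R / Num.sqrt a + 2) / q%:R)%:E)%E.
Proof.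
move=> mC hg hf hf1 he hv ne nv mass ev gC.
have sCf f' : density f' -> sq_integrable (fun x => \1_C x * f' x).
  by move=> hf'; apply: sq_integrable_indic => //; exact: density_sq.
have icf := sq_integrable_int mu_fin (sCf _ hf).
have icf1 := sq_integrable_int mu_fin (sCf _ hf1).
have ig := density_integrable hg; have i1 := density_integrable hf1.
have ie := integrable_sqr he.
have iv := sq_integrable_int mu_fin (sq_integrable_norm hv).
(* On [C] the root ratio is at most [n / sqrt a], as [g0 <= n ^+ 2] there and [f1 >= a]. It
   multiplies [v], which is small only in [L1]. *)
pose kap := n%:R / Num.sqrt a + 1.
have sa0 : 0 < Num.sqrt a by rewrite sqrtr_gt0.
have kap0 : 0 <= kap by rewrite addr_ge0 // divr_ge0 // ltW.
pose H x := 2^-1 * (g0 x + f1 x) + ((2 * a)^-1 * e x ^+ 2 +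
   ((\1_C x * f x + -1 * (\1_C x * f1 x)) + kap * `|v x|)).
have j1 := integrable_scale 2^-1 (integrable_add ig i1).
have j2 := integrable_scale (2 * a)^-1 ie.
have j3' := integrable_scale (-1) icf1.
have j3 := integrable_add icf j3'.
have j4 := integrable_scale kap iv.
have j34 := integrable_add j3 j4.
have j234 := integrable_add j2 j34.
apply: (@le_trans _ _ (\int[mu]_x H x)%:E).
  apply: ge0_le_Rintegral; last 1 first.
  - move=> x; rewrite mulr_ge0 ?sqrtr_ge0 ?mulr_ge0 ?(ltW (density_gt0 x hf)) //=.
    have f10 := density_gt0 x hf1; have g00 := density_gt0 x hg.
    have af1 := density_ge hf1 x.
    have ev' := ev x; rewrite /H.
    case: (boolP (x \in C)) => xC; last first.
      rewrite indicE (negbTE xC) !mul0r mulr0.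
      have h1 : 0 <= 2^-1 * (g0 x + f1 x) by rewrite mulr_ge0 ?addr_ge0 // ltW.
      have h2 : 0 <= (2 * a)^-1 * e x ^+ 2 by rewrite mulr_ge0 ?sqr_ge0 ?invr_ge0 ?mulr_ge0 // ltW.
      have h3 : 0 <= kap * `|v x| by rewrite mulr_ge0.
      lra.
    rewrite indicE xC !mul1r in ev' *.
    have fE : f x = f1 x + (e x + v x) by rewrite -ev'; ring.
    set s := Num.sqrt (f1 x); set t := Num.sqrt (g0 x).
    have s0 : 0 < s by rewrite sqrtr_gt0.
    have t0 : 0 < t by rewrite sqrtr_gt0.
    have s2 : f1 x = s ^+ 2 by rewrite sqr_sqrtr // ltW.
    have t2 : g0 x = t ^+ 2 by rewrite sqr_sqrtr // ltW.
    have -> : Num.sqrt (g0 x / f1 x) = t / s.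
      by rewrite sqrtrM ?(ltW g00) // sqrtrV ?(ltW f10).
    have tn : t <= n%:R.
      by rewrite -(ler_sqr) ?nnegrE ?(ltW t0) // -t2 gC //; exact: set_mem.
    have sas : Num.sqrt a <= s by rewrite ler_wsqrtr.
    set r := t / s; have r0 : 0 <= r by rewrite divr_ge0 // ltW.
    have rn : r <= n%:R / Num.sqrt a.
      by apply: ler_pM => //; rewrite ?invr_ge0 ?lef_pV2 ?posrE // ltW.
    have v1 : v x * (r - 1) <= kap * `|v x|.
      apply: le_trans (ler_norm _) _; rewrite normrM mulrC ler_wpM2r //.
      by rewrite /kap ler_norml; apply/andP; split; lra.
    have e1 : e x * (r - 1) <= (2 * a)^-1 * e x ^+ 2 + 2^-1 * (t - s) ^+ 2.
      have -> : e x * (r - 1) = (e x / s) * (t - s) by rewrite /r; field; rewrite gt_eqF.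
      have e2 : (e x / s) ^+ 2 <= a^-1 * e x ^+ 2.
        rewrite expr_div_n -s2 mulrC ler_wpM2r ?sqr_ge0 // lef_pV2 ?posrE //.
      have := sqr_ge0 (e x / s - (t - s)); rewrite invfM.
      lra.
    have m1 : f1 x * r = t * s by rewrite /r s2; field; rewrite gt_eqF.
    have -> : f x * r = t * s + e x * (r - 1) + v x * (r - 1) + (e x + v x).
      by rewrite fE mulrDl m1; ring.
    rewrite -[f x + _](_ : e x + v x = _); last by rewrite fE; ring.
    rewrite t2 s2; lra.
  - apply: measurable_funM.
      by apply: measurable_funM; [exact: measurable_indic|exact: density_meas].
    by apply/measurable_sqrt/measurable_funM; [exact: density_meas|apply: measurable_inv => [|x]; [exact: density_meas|exact/ltW/density_gt0]].
  - exact: integrable_add.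
rewrite lee_fin /H RintegralD // RintegralZl ?integrable_add // RintegralD //.
rewrite RintegralD // RintegralZl // RintegralD // RintegralD // RintegralZl // RintegralZl //.
rewrite (density_int hg) (density_int hf1) Rintegral_sqr -/(norm1 v).
have q0 : 0 <= q%:R^-1 :> R by rewrite invr_ge0.
have h1 : (2 * a)^-1 * norm2 e ^+ 2 <= 2 * delta ^+ 2 / a.
  have -> : 2 * delta ^+ 2 / a = (2 * a)^-1 * (2 * delta) ^+ 2 by field; rewrite gt_eqF.
  rewrite ler_wpM2l ?invr_ge0 ?mulr_ge0 ?(ltW a0) // lerXn2r ?nnegrE ?norm2_ge0 //.
  exact: le_trans (norm2_ge0 _ _) ne.
have h2 := le_trans (ler_norm _) mass.
have h3 : kap * norm1 v <= kap / q%:R by rewrite ler_wpM2l.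
have -> : (n%:R / Num.sqrt a + 2) / q%:R = kap / q%:R + q%:R^-1 by rewrite /kap; ring.
lra.
Qed.
End densities.

(** * Posterior bounds *)

Section markov.
Context d (T : measurableType d) (R : realType).
Variable P : {measure set T -> \bar R}.
Local Open Scope ereal_scope.

Lemma measurable_exceedance (F : T -> \bar R) (t : \bar R) :
  measurable_fun setT F -> measurable [set x | t < F x].
Proof.
move=> mF; rewrite -[X in measurable X]setTI.
by apply: emeasurable_fun_o_infty.
Qed.

Lemma markov_exceedance (F : T -> \bar R) (t b : R) :
  measurable_fun setT F -> (forall x, 0 <= F x) -> (0 < t)%R ->
  \int[P]_x F x <= b%:E -> P [set x | t%:E < F x] <= (b / t)%:E.
Proof.
move=> mF F0 t0 hb; have mA := measurable_exceedance t%:E mF.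
rewrite EFinM muleC -lee_pdivrMl ?invr_gt0 // invrK; apply: le_trans hb.
rewrite -integral_cst //; apply: (@le_trans _ _ (\int[P]_(x in [set x | t%:E < F x]) F x)).
  apply: ge0_le_integral => //.
  - by move=> x _; rewrite lee_fin ltW.
  - exact: measurable_funTS.
  - by move=> x /ltW.
by apply: ge0_subset_integral.
Qed.

End markov.

Section markov_fubini.
Context d (T : measurableType d) dE (E : measurableType dE) (R : realType).
Variables (P : probability T R) (pi : probability E R).

(** Markov's inequality for the prior integral of [Phi]; by Tonelli, bounds on the expectation at
    each fixed parameter suffice. *)
Lemma fubini_exceedance (Phi : T -> E -> R) (S : set E) (c t : R) :
  measurable_fun setT (fun z : T * E => Phi z.1 z.2) -> (forall x e, 0 <= Phi x e) ->
  measurable S -> 0 < t ->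
  (forall e, S e -> (\int[P]_x (Phi x e)%:E <= c%:E)%E) ->
  let A := [set x | (t%:E < \int[pi]_(e in S) (Phi x e)%:E)%E] in
  measurable A /\ (P A <= (fine (pi S) * c / t)%:E)%E.
Proof.
move=> mPhi Phi0 mS t0 hc A.
pose F (z : T * E) := ((Phi z.1 z.2)%:E * (\1_S z.2)%:E)%E.
have mF : measurable_fun setT F.
  apply: emeasurable_funM; first exact/measurable_EFinP.
  apply/measurable_EFinP; apply: measurableT_comp; last exact: measurable_snd.
  exact: measurable_indic.
have F0 z : (0 <= F z)%E by rewrite mule_ge0 ?lee_fin.
have AE x : (\int[pi]_(e in S) (Phi x e)%:E = \int[pi]_e F (x, e))%E.
  rewrite [LHS]integral_mkcond; apply: eq_integral => e _; rewrite patchE /F indicE /=.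
  by case: ifP => _; rewrite ?mule1 ?mule0.
have {}AE : A = [set x | (t%:E < \int[pi]_e F (x, e))%E] by apply/seteqP; split => x; rewrite /A /= AE.
have mFF : measurable_fun setT (fun x => \int[pi]_e F (x, e))%E.
  exact: measurable_fun_fubini_tonelli_F.
rewrite AE; split; first exact: measurable_exceedance.
apply: markov_exceedance => //; first by move=> x; apply: integral_ge0.
rewrite (fubini_tonelli _ mF F0).
have -> : (fine (pi S) * c)%:E = (\int[pi]_(e in S) (cst c%:E e))%E.
  by rewrite integral_cst // EFinM fineK ?fin_num_measure // muleC.
rewrite [leRHS]integral_mkcond; apply: ge0_le_integral => //.
- by move=> e _; apply: integral_ge0.
- exact: measurable_fun_fubini_tonelli_G.
- by apply/measurable_restrict => //; rewrite setTI; exact: measurable_cst.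
move=> e _; rewrite patchE /F /= indicE; case: ifP => [/set_mem /hc|_] /=.
  by under [X in _ -> (X <= _)%E]eq_integral do rewrite mule1.
by rewrite integral0_eq // => x _; rewrite mule0.
Qed.
End markov_fubini.

(** * Expectations of products under independence *)

Section independence.
Context d (T : measurableType d) (R : realType).
Variables (P : probability T R) (Y : nat -> {RV P >-> R}).
Hypothesis Yindep : mutually_independent Y.

Lemma indep_indic (B : nat -> set R) (N : nat) : (forall i, measurable (B i)) ->
  (\int[P]_x (\prod_(i < N) \1_(B i) (Y i x))%:E = \prod_(i < N) P (Y i @^-1` B i))%E.
Proof.
move=> mB.
have mYB i : measurable (Y i @^-1` B i).
  by rewrite -[X in measurable X]setTI; exact: measurable_funPT.
have mcap : measurable (\bigcap_(i in [set` [fset j in iota 0 N]%fset]) (Y i @^-1` B i)).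
  by apply: fin_bigcap_measurable => // i _.
transitivity (P (\bigcap_(i in [set` [fset j in iota 0 N]%fset]) (Y i @^-1` B i))).
  rewrite -[X in P X]setIT -integral_indic //; apply: eq_integral => x _.
  congr _%:E; rewrite indicE; case: (boolP (x \in _)) => [|/negP xn].
    rewrite inE => h; apply/esym; rewrite big1 // => i _; rewrite indicE mem_set //.
    by apply: (h i); rewrite /= !inE mem_iota /= add0n.
  have [i hi] : exists i : 'I_N, ~ B i (Y i x).
    apply: contrapT => /forallNP h; apply: xn; rewrite inE => i /=.
    rewrite !inE mem_iota /= add0n => iN.
    by have := h (Ordinal iN) => /contrapT.
  by rewrite (bigD1 i) //= indicE memNset // mul0r.
rewrite Yindep //; rewrite (perm_big (iota 0 N)) /=; last first.
  by apply: uniq_perm; rewrite ?fset_uniq ?iota_uniq // => i; rewrite !inE.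
by rewrite -[N in LHS]subn0 big_mkord.
Qed.

Lemma indep_prod_aux (k : nat) (h : nat -> R -> R) (m : nat -> R) (N : nat) :
  (forall i, measurable_fun setT (h i)) -> (forall i x, 0 <= h i x) ->
  (forall i, (\int[P]_x (h i (Y i x))%:E = (m i)%:E)%E) ->
  (forall i, (k <= i)%N -> exists2 B, measurable B & h i = \1_B) ->
  (\int[P]_x (\prod_(i < N) h i (Y i x))%:E = (\prod_(i < N) m i)%:E)%E.
Proof.
have m_ge0 h' m' : (forall i x, 0 <= h' i x) ->
    (forall i, (\int[P]_x (h' i (Y i x))%:E = (m' i)%:E)%E) -> forall i : nat, 0 <= m' i :> R.
  by move=> h0 hm i; rewrite -lee_fin -hm; apply: integral_ge0 => x _; rewrite lee_fin.
elim: k h m => [|n IHn] h m mh h0 hm hB.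
  have /choice[B hBB] : forall i, exists B, measurable B /\ h i = \1_B.
    by move=> i; have [] := hB i (leq0n i) => B mB ->; exists B.
  have hE i : h i = \1_(B i) by have [] := hBB i.
  under eq_integral => x _ do under eq_bigr => i _ do rewrite hE.
  rewrite indep_indic; last by move=> i; have [] := hBB i.
  rewrite -prodEFin; apply: eq_bigr => i _; rewrite -hm hE.
  have mYB : measurable (Y i @^-1` B i).
    by rewrite -[X in measurable X]setTI; apply: measurable_funPT; have [] := hBB i.
  by rewrite -[X in P X]setIT -integral_indic.
(* If [N <= n], factor [n] does not occur, and all factors from [n] on are replaced by 1. *)
case: (leqP N n) => [Nn|nN].
  have e : (\int[P]_x (\prod_(i < N) (if (i < n)%N then h i else \1_setT) (Y i x))%:E =
      (\prod_(i < N) (if (i < n)%N then m i else 1))%:E)%E.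
    apply: (IHn (fun i => if (i < n)%N then h i else \1_setT)
      (fun i => if (i < n)%N then m i else 1)).
    - by move=> i; case: ifP => // _; exact: measurable_indic.
    - by move=> i x; case: ifP.
    - move=> i; case: ifP => // _.
      rewrite (eq_integral (cst 1%E)) => [|x _]; last by rewrite indicT.
      by rewrite integral_cst // mul1e; exact: probability_setT.
    - by move=> i; rewrite leqNgt => /negbTE ->; exists setT.
  have lt (i : 'I_N) : (i < n)%N by apply: leq_trans Nn.
  rewrite (eq_bigr (fun i : 'I_N => m i)) in e => [|i _]; last by rewrite lt.
  rewrite -e; apply: eq_integral => x _; congr _%:E; apply: eq_bigr => i _.
  by rewrite lt.
pose o := Ordinal nN.
pose D x := \prod_(i < N | i != o) h i (Y i x).
have mhY i : measurable_fun setT (fun x => h i (Y i x)).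
  by apply: measurableT_comp (mh i) _; exact: measurable_funPT.
have mD : measurable_fun setT D.
  by rewrite /D; under eq_fun do rewrite -big_filter; apply: measurable_prod => i _; exact: mhY.
have D0 x : 0 <= D x by apply: prodr_ge0.
pose K := \prod_(i < N | i != o) m i.
have K0 : 0 <= K by apply: prodr_ge0 => i _; exact: m_ge0 h0 hm i.
have push B : measurable B ->
    pushforward (density_measure P mD D0) (Y n) B = (K%:E * distribution P (Y n) B)%E.
  move=> mB; rewrite /pushforward /density_measure.
  have mYB : measurable (Y n @^-1` B).
    by rewrite -[X in measurable X]setTI; exact: measurable_funPT.
  pose h' i := if i == n then \1_B else h i.
  pose m' i := if i == n then fine (P (Y n @^-1` B)) else m i.
  have e : (\int[P]_x (\prod_(i < N) h' i (Y i x))%:E = (\prod_(i < N) m' i)%:E)%E.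
    apply: IHn.
    - by move=> i; rewrite /h'; case: eqP => // _; exact: measurable_indic.
    - by move=> i x; rewrite /h'; case: eqP.
    - move=> i; rewrite /h' /m'; case: eqP => // ->.
      rewrite fineK ?fin_num_measure // -[X in P X]setIT -integral_indic //.
    - move=> i ni; rewrite /h'; case: eqP => [_|/eqP ni']; first by exists B.
      by apply: hB; rewrite ltn_neqAle eq_sym ni'.
  move: e; rewrite (bigD1 o) //= {1}/m' eqxx EFinM fineK ?fin_num_measure // muleC.
  rewrite (eq_bigr (fun i : 'I_N => m i)) => [<-|i]; last first.
    by rewrite -val_eqE /m' /= => /negbTE ->.
  rewrite [LHS]integral_mkcond; apply: eq_integral => x _.
  rewrite (bigD1 o) //= {1}/h' eqxx patchE indicE.
  have -> : (x \in Y n @^-1` B) = (Y n x \in B) by apply/idP/idP; rewrite !inE.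
  case: ifP => _; rewrite ?mul0r // mul1r; congr _%:E; apply: eq_bigr => i.
  by rewrite -val_eqE /h' /= => /negbTE ->.
rewrite (bigD1 o) //= -/K mulrC EFinM -hm.
under eq_integral => x _ do rewrite (bigD1 o) //= -/(D x) EFinM.
have mYn : measurable_fun setT (Y n) by exact: measurable_funPT.
transitivity (\int[density_measure P mD D0]_x (h n (Y n x))%:E)%E.
  apply/esym; apply: ge0_integral_density => //; first by apply/measurable_EFinP; exact: mhY.
  by move=> x; rewrite lee_fin.
transitivity (\int[pushforward (density_measure P mD D0) (Y n)]_y (h n y)%:E)%E.
  rewrite ge0_integral_pushforward //; first exact/measurable_EFinP.
  by move=> y _; rewrite lee_fin.
rewrite (@ge0_integral_density _ _ R (distribution P (Y n)) (fun=> K)) //.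
- under eq_integral do rewrite muleC.
  rewrite ge0_integralZl //; [|exact/measurable_EFinP|by move=> y _; rewrite lee_fin].
  rewrite /distribution ge0_integral_pushforward //; first exact/measurable_EFinP.
  by move=> y _; rewrite lee_fin.
- by move=> A mA; rewrite integral_cst //; exact: push.
- exact/measurable_EFinP.
- by move=> x; rewrite lee_fin.
Qed.

Lemma indep_prod (h : nat -> R -> R) (m : nat -> R) (N : nat) :
  (forall i, measurable_fun setT (h i)) -> (forall i x, 0 <= h i x) ->
  (forall i, (\int[P]_x (h i (Y i x))%:E = (m i)%:E)%E) ->
  (\int[P]_x (\prod_(i < N) h i (Y i x))%:E = (\prod_(i < N) m i)%:E)%E.
Proof.
move=> mh h0 hm.
pose h' i := if (i < N)%N then h i else \1_setT.
pose m' i := if (i < N)%N then m i else 1.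
have e : (\int[P]_x (\prod_(i < N) h' i (Y i x))%:E = (\prod_(i < N) m' i)%:E)%E.
  apply: (indep_prod_aux (k := N)).
  - by move=> i; rewrite /h'; case: ifP => // _; exact: measurable_indic.
  - by move=> i x; rewrite /h'; case: ifP.
  - move=> i; rewrite /h' /m'; case: ifP => // _.
      rewrite (eq_integral (cst 1%E)) => [|x _]; last by rewrite indicT.
      by rewrite integral_cst // mul1e; exact: probability_setT.
  - by move=> i; rewrite /h' leqNgt => /negbTE ->; exists setT.
rewrite (eq_bigr (fun i : 'I_N => m i)) in e => [|i _]; last by rewrite /m' ltn_ord.
rewrite -e; apply: eq_integral => x _; congr _%:E; apply: eq_bigr => i _.
by rewrite /h' ltn_ord.
Qed.
End independence.

(** * Evidence, sieve complement and tests *)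

Section bayes.
Context dX (X : measurableType dX) dE (E : measurableType dE) dT (T : measurableType dT).
Variable R : realType.
Variable mu : {measure set X -> \bar R}.
Hypothesis mu_fin : (mu setT < +oo)%E.
Variable a : R.
Hypothesis a0 : 0 < a.
Variables (P : probability T R) (Y : nat -> T -> X).
Hypothesis mY : forall i, measurable_fun setT (Y i).
Variable g0 : X -> R.
Hypothesis dg0 : density mu a g0.
Hypothesis marginal : forall i (f : X -> R), measurable_fun setT f -> (forall x, 0 <= f x) ->
  (\int[P]_w (f (Y i w))%:E = \int[mu]_x (f x * g0 x)%:E)%E.
Hypothesis iid : forall n (f : X -> R) (c : R), measurable_fun setT f -> (forall x, 0 <= f x) ->
  (\int[mu]_x (f x * g0 x)%:E <= c%:E)%E ->
  (\int[P]_w (\prod_(i < n) f (Y i w))%:E <= (c ^+ n)%:E)%E.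
Variable pi : probability E R.
Variable G : E -> X -> R.
Hypothesis mG : measurable_fun setT (fun z : E * X => G z.1 z.2).
Hypothesis G_gt0 : forall e x, 0 < G e x.
Variable Omega : set E.
Hypothesis mOmega : measurable Omega.
Hypothesis dG : forall e, Omega e -> density mu a (G e).

Definition lratio n (w : T) (e : E) : R := \prod_(i < n) (G e (Y i w) / g0 (Y i w)).

Let g0_gt0 x : 0 < g0 x := density_gt0 a0 x dg0.
Let mg0 : measurable_fun setT g0 := density_meas dg0.

Lemma lratio_gt0 n w e : 0 < lratio n w e.
Proof. by apply: prodr_gt0 => i _; rewrite divr_gt0. Qed.

Lemma measurable_section e : measurable_fun setT (G e).
Proof. exact: (measurableT_comp mG (measurable_pair1 e)). Qed.

Lemma measurable_data_prod n (F : E -> X -> R) :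
  measurable_fun setT (fun z : E * X => F z.1 z.2) ->
  measurable_fun setT (fun z : T * E => \prod_(i < n) F z.2 (Y i z.1)).
Proof.
move=> mF; apply: measurable_prod => i _.
have m2 : measurable_fun setT (fun z : T * E => (z.2, Y i z.1)).
  apply: measurable_fun_pair; first exact: measurable_snd.
  by apply: (measurableT_comp (mY i)); exact: measurable_fst.
exact: (measurableT_comp mF m2).
Qed.

Lemma measurable_ratio (f : E -> X -> R) : measurable_fun setT (fun z : E * X => f z.1 z.2) ->
  measurable_fun setT (fun z : E * X => f z.1 z.2 / g0 z.2).
Proof.
move=> mf; apply: measurable_funM => //; apply: (measurable_inv (f := fun z : E * X => g0 z.2)).
  by apply: (measurableT_comp mg0); exact: measurable_snd.
by move=> z; exact: ltW.
Qed.

Lemma measurable_lratio n : measurable_fun setT (fun z : T * E => lratio n z.1 z.2).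
Proof.
by apply: (@measurable_data_prod n (fun e x => G e x / g0 x)); exact: measurable_ratio.
Qed.

Lemma lratio_section n w : measurable_fun setT (lratio n w).
Proof. exact: (measurableT_comp (measurable_lratio n) (measurable_pair1 w)). Qed.

Lemma lratio_expect n e : Omega e -> (\int[P]_w (lratio n w e)%:E <= 1%:E)%E.
Proof.
move=> /dG de; rewrite -(expr1n R n); apply: (@iid n (fun x => G e x / g0 x)).
- apply: measurable_funM; first exact: measurable_section.
  by apply: measurable_inv => // x; exact: ltW.
- by move=> x; rewrite divr_ge0 // ltW.
- under eq_integral do rewrite divfK ?gt_eqF //.
  by rewrite (density_eint mu_fin de).
Qed.

Lemma tail_event n (U : set E) (u t : R) : measurable U -> U `<=` Omega -> 0 < t ->
  (pi U <= u%:E)%E -> exists A, [/\ measurable A, (P A <= (u / t)%:E)%E &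
    forall w, ~ A w -> (\int[pi]_(e in U) (lratio n w e)%:E <= t%:E)%E].
Proof.
move=> mU UO t0 hu.
have [mA hA] := fubini_exceedance (P := P) (c := 1) pi (measurable_lratio n)
  (fun w e => ltW (lratio_gt0 n w e)) mU t0 (fun e Ue => lratio_expect n (UO e Ue)).
eexists; split; first exact: mA.
- apply: le_trans hA _; rewrite lee_fin mulr1 ler_pM2r ?invr_gt0 //.
  by rewrite -lee_fin fineK // fin_num_measure.
- by move=> w /= /negP; rewrite -leNgt.
Qed.

(** Let [f = n * c] and let [W] be the likelihood ratio. On [B] the inverse of [W] has expectation
    at most [(1 + c) ^ n <= exp f], so its prior integral exceeds [pi B * exp (2 f)] with
    probability at most [exp (- f)]. Otherwise integrating [W >= 2 * s - s ^+ 2 / W] with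
    [s = exp (- 2 f)] leaves [s * pi B]. *)
Lemma evidence_event n (B : set E) (c : R) : measurable B -> B `<=` Omega -> 0 <= c ->
  (0 < pi B)%E -> (forall e, B e -> norm2 mu (fun x => G e x - g0 x) ^+ 2 <= a * c) ->
  exists A, [/\ measurable A, (P A <= (expR (- (n%:R * c)))%:E)%E &
    forall w, ~ A w -> (pi B * (expR (- (2 * n%:R * c)))%:E <=
       \int[pi]_(e in Omega) (lratio n w e)%:E)%E].
Proof.
move=> mB BO c0 piB hB; set f := n%:R * c.
have piBf : (pi B = (fine (pi B))%:E) by rewrite fineK // fin_num_measure.
have pB0 : 0 < fine (pi B) by rewrite -lte_fin -piBf.
pose t := fine (pi B) * expR (2 * f); have t0 : 0 < t by rewrite mulr_gt0 ?expR_gt0.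
have mI : measurable_fun setT (fun z : T * E => (lratio n z.1 z.2)^-1).
  by apply: measurable_inv; [exact: measurable_lratio|move=> z; exact/ltW/lratio_gt0].
have EI e : B e -> (\int[P]_w ((lratio n w e)^-1)%:E <= (expR f)%:E)%E.
  move=> Be; have de := dG (BO e Be).
  have h : (\int[mu]_x (g0 x / G e x * g0 x)%:E <= (1 + c)%:E)%E.
    have := chi_square_le mu_fin a0 dg0 de.
    under eq_integral do rewrite expr2 mulrAC; move=> /le_trans; apply.
    by rewrite lee_fin lerD2l ler_pdivrMr // mulrC; exact: hB.
  apply: (@le_trans _ _ ((1 + c) ^+ n)%:E).
    rewrite (eq_integral (fun w => (\prod_(i < n) (g0 (Y i w) / G e (Y i w)))%:E)).
      apply: (@iid n (fun x => g0 x / G e x)) => //.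
        apply: measurable_funM => //; apply: measurable_inv; first exact: measurable_section.
        by move=> x; exact: ltW.
      by move=> x; rewrite divr_ge0 // ltW.
    move=> w _; congr _%:E; rewrite /lratio -prodfV; apply: eq_bigr => i _.
    by rewrite invf_div.
  rewrite lee_fin /f expRM_natl; apply: lerXn2r; rewrite ?nnegrE ?addr_ge0 ?expR_ge0 //.
  exact: expR_ge1Dx.
have [mA hA] := fubini_exceedance (P := P) (Phi := fun w e => (lratio n w e)^-1) pi mI
  (fun w e => ltW (etrans (invr_gt0 _) (lratio_gt0 n w e))) mB t0 EI.
eexists; split; first exact: mA.
- apply: le_trans hA _; rewrite lee_fin /t; rewrite expRN.
  have -> : 2 * f = f + f by ring.
  rewrite expRD; have := expR_gt0 f; set z := expR f => z0.
  by rewrite le_eqVlt; apply/orP; left; apply/eqP; field; rewrite !gt_eqF.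
move=> w /= /negP; rewrite -leNgt => hI.
apply: (@le_trans _ _ (\int[pi]_(e in B) (lratio n w e)%:E)%E); last first.
  apply: ge0_subset_integral => //.
    by apply/measurable_EFinP/measurable_funTS; exact: lratio_section.
  by move=> e _; rewrite lee_fin ltW // lratio_gt0.
pose s := expR (- (2 * f)); have s0 : 0 < s by exact: expR_gt0.
have mI' : measurable_fun setT (fun e => (lratio n w e)^-1).
  by apply: measurable_inv; [exact: lratio_section|move=> z; exact/ltW/lratio_gt0].
have h : (\int[pi]_(e in B) (cst (2 * s)%:E e) <=
    \int[pi]_(e in B) (lratio n w e)%:E + (s ^+ 2 * t)%:E)%E.
  apply: (@le_trans _ _ (\int[pi]_(e in B) (lratio n w e)%:E +
      \int[pi]_(e in B) ((s ^+ 2)%:E * ((lratio n w e)^-1)%:E))%E).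
    rewrite -ge0_integralD //; last 4 first.
    - by move=> e _; rewrite lee_fin ltW // lratio_gt0.
    - by apply/measurable_EFinP/measurable_funTS; exact: lratio_section.
    - by move=> e _; rewrite lee_fin mulr_ge0 ?sqr_ge0 // invr_ge0 ltW // lratio_gt0.
    - by apply/measurable_EFinP/measurable_funM => //; exact: measurable_funTS.
    apply: ge0_le_integral => //.
    - by move=> e _; rewrite lee_fin mulr_ge0 // ltW.
    - apply/measurable_EFinP/measurable_funD; first by apply/measurable_funTS; exact: lratio_section.
      by apply: measurable_funM => //; exact: measurable_funTS.
    move=> e _; rewrite lee_fin; have z0 := lratio_gt0 n w e; set z := lratio n w e in z0 *.
    rewrite -subr_ge0; have -> : z + s ^+ 2 / z - 2 * s = (z - s) ^+ 2 / z by field; rewrite gt_eqF.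
    by rewrite divr_ge0 ?sqr_ge0 // ltW.
  rewrite leeD2l // ge0_integralZl //; last 3 first.
  - by apply/measurable_EFinP; exact: measurable_funTS.
  - by move=> e _; rewrite lee_fin invr_ge0 ltW // lratio_gt0.
  - by rewrite lee_fin sqr_ge0.
  - by rewrite [leRHS]EFinM; apply: lee_wpmul2l => //; rewrite lee_fin sqr_ge0.
have hc : (\int[pi]_(e in B) (cst (2 * s)%:E e) = (2 * s * fine (pi B))%:E)%E.
  by rewrite [RHS]EFinM -piBf; exact: integral_cst.
rewrite hc in h.
have st : s ^+ 2 * t = s * fine (pi B).
  rewrite /t /s expRN; have := expR_gt0 (2 * f); set z := expR _ => z0.
  by field; rewrite gt_eqF.
rewrite -mulrA -/f -/s [in leLHS]piBf -EFinM.
move: h; rewrite st.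
case: (\int[pi]_(e in B) _)%E => [r| |] //=; rewrite ?leey //.
rewrite -EFinD !lee_fin; lra.
Qed.

(** The test statistic sums the root ratios [tau i] over the whole net, hence does not depend on the
    parameter and no net point has to be selected measurably. Where it is at most [kap], so is each
    [tau i], and [lratio <= kap * lratio / tau i]; for the net point [i] of [e] the right-hand side,
    restricted to data in [C], has expectation at most [kap * b ^+ n]. *)
Lemma test_event n (S : set E) (C : set X) (k : nat) (x : 'I_k -> E) (b h kap t p : R) :
  measurable S -> measurable C -> S `<=` Omega -> (forall i, Omega (x i)) ->
  0 < kap -> 0 < t -> 0 <= b ->
  (\int[mu]_y (\1_(~` C) y * g0 y)%:E <= p%:E)%E ->
  (forall i, \int[mu]_y (Num.sqrt (G (x i) y * g0 y))%:E <= h%:E)%E ->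
  (forall e, S e -> exists i,
     \int[mu]_y (\1_C y * G e y * Num.sqrt (g0 y / G (x i) y))%:E <= b%:E)%E ->
  exists A, [/\ measurable A,
     (P A <= (2 * n%:R * p + k%:R * h ^+ n / kap + kap * b ^+ n / t)%:E)%E &
    forall w, ~ A w -> (\int[pi]_(e in S) (lratio n w e)%:E <= t%:E)%E].
Proof.
move=> mS mC SO xO kap0 t0 b0 hp hh hb.
have mGs := measurable_section.
have mYf (f : X -> R) i : measurable_fun setT f -> measurable_fun setT (fun w => f (Y i w)).
  by move=> mf; exact: (measurableT_comp mf (mY i)).
have ratio_meas (f f' : X -> R) : measurable_fun setT f -> measurable_fun setT f' ->
    (forall y, 0 < f' y) -> measurable_fun setT (fun y => f y / f' y).
  by move=> mf mf' f0; apply: measurable_funM => //; apply: measurable_inv => // y; exact: ltW.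
(* The number of observations outside [C]: an integer, hence zero when at most [1 / 2]. Markov's
   inequality at [1 / 2] produces the factor 2. *)
pose out w := \sum_(j < n) \1_(~` C) (Y j w) : R.
have mout : measurable_fun setT out.
  by apply: measurable_sum => j; apply: mYf; exact: measurable_indic (measurableC mC).
have hout : (\int[P]_w (out w)%:E <= (n%:R * p)%:E)%E.
  under eq_integral do rewrite -sumEFin.
  rewrite ge0_integral_sum //; last first.
    by move=> j; apply/measurable_EFinP; apply: mYf; exact: measurable_indic (measurableC mC).
  have -> : (n%:R * p)%:E = (\sum_(j < n) p%:E)%E by rewrite sumEFin sumr_const card_ord mulr_natl.
  apply: lee_sum => j _; rewrite (marginal j) //; exact: measurable_indic (measurableC mC).
have PC := markov_exceedance (proj2 (measurable_EFinP _ _) mout)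
  (fun w => (sumr_ge0 _ (fun j _ => ler0n _ _) : (0 <= (out w)%:E)%E)) (_ : 0 < 2^-1) hout.
pose tau i w := \prod_(j < n) Num.sqrt (G (x i) (Y j w) / g0 (Y j w)).
have tau0 i w : 0 < tau i w by apply: prodr_gt0 => j _; rewrite sqrtr_gt0 divr_gt0.
have msq i : measurable_fun setT (fun y => Num.sqrt (G (x i) y / g0 y)).
  by apply: measurable_sqrt; exact: ratio_meas.
have mtau i : measurable_fun setT (tau i).
  by apply: measurable_prod => j _; exact: mYf (msq i).
have htau i : (\int[P]_w (tau i w)%:E <= (h ^+ n)%:E)%E.
  apply: (@iid n (fun y => Num.sqrt (G (x i) y / g0 y))) => //.
  rewrite (eq_integral (fun y => (Num.sqrt (G (x i) y * g0 y))%:E)) // => y _; congr _%:E.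
  rewrite sqrtrM ?(ltW (G_gt0 _ _)) // sqrtrV ?(ltW (g0_gt0 _)) // sqrtrM ?(ltW (G_gt0 _ _)) //.
  have s0 : 0 < Num.sqrt (g0 y) by rewrite sqrtr_gt0.
  rewrite -[X in _ / _ * X](sqr_sqrtr (ltW (g0_gt0 y))); field.
  by rewrite gt_eqF.
pose F w := \sum_(i < k) tau i w.
have mF : measurable_fun setT F by apply: measurable_sum.
have hF : (\int[P]_w (F w)%:E <= (k%:R * h ^+ n)%:E)%E.
  under eq_integral do rewrite -sumEFin.
  rewrite ge0_integral_sum //; last 2 first.
  - by move=> i; apply/measurable_EFinP.
  - by move=> i w _; rewrite lee_fin ltW.
  have -> : (k%:R * h ^+ n)%:E = (\sum_(j < k) (h ^+ n)%:E)%E.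
    by rewrite sumEFin sumr_const card_ord mulr_natl.
  by apply: lee_sum.
have F0 w : 0 <= F w by apply: sumr_ge0 => i _; exact: ltW.
have PF := markov_exceedance (proj2 (measurable_EFinP _ _) mF)
  (fun w => (F0 w : (0 <= (F w)%:E)%E)) kap0 hF.
have mAF := measurable_exceedance kap%:E (proj2 (measurable_EFinP _ _) mF).
have mAC := measurable_exceedance (2^-1)%:E (proj2 (measurable_EFinP _ _) mout).
set AF := [set w | _] in PF mAF; set AC := [set w | _] in PC mAC.
pose Phi w e := lratio n w e * (\prod_(j < n) \1_C (Y j w) * \1_(~` AF) w).
have mPhi : measurable_fun setT (fun z : T * E => Phi z.1 z.2).
  have mQ : measurable_fun setT (fun w => \prod_(j < n) \1_C (Y j w) * \1_(~` AF) w : R).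
    apply: measurable_funM; last exact: measurable_indic (measurableC mAF).
    by apply: measurable_prod => j _; apply: mYf; exact: measurable_indic.
  apply: measurable_funM; first exact: measurable_lratio.
  exact: (measurableT_comp mQ measurable_fst).
have Phi0 w e : 0 <= Phi w e.
  by rewrite mulr_ge0 ?(ltW (lratio_gt0 _ _ _)) // mulr_ge0 // prodr_ge0.
have EPhi e : S e -> (\int[P]_w (Phi w e)%:E <= (kap * b ^+ n)%:E)%E.
  move=> Se; have [i hi] := hb e Se.
  pose f y := \1_C y * G e y / g0 y * Num.sqrt (g0 y / G (x i) y).
  have f0 y : 0 <= f y by rewrite !mulr_ge0 ?invr_ge0 ?sqrtr_ge0 ?(ltW (G_gt0 _ _)) ?(ltW (g0_gt0 _)).
  have mf : measurable_fun setT f.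
    apply: measurable_funM; last by apply: measurable_sqrt; exact: ratio_meas.
    by apply: ratio_meas => //; apply: measurable_funM => //; exact: measurable_indic.
  have If : (\int[P]_w (\prod_(j < n) f (Y j w))%:E <= (b ^+ n)%:E)%E.
    apply: (@iid n f) => //.
    rewrite (eq_integral (fun y => (\1_C y * G e y * Num.sqrt (g0 y / G (x i) y))%:E)) //.
    by move=> y _; congr _%:E; rewrite /f; field; rewrite gt_eqF.
  rewrite EFinM; have kap0' := ltW kap0.
  apply: le_trans (_ : (_ <= kap%:E * \int[P]_w (\prod_(j < n) f (Y j w))%:E)%E) _; last first.
    by apply: lee_wpmul2l => //; rewrite lee_fin.
  have mpf : measurable_fun setT (fun w => \prod_(j < n) f (Y j w)).
    by apply: measurable_prod => j _; exact: mYf mf.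
  rewrite -ge0_integralZl //; last 2 first.
  - exact/measurable_EFinP.
  - by move=> w _; rewrite lee_fin prodr_ge0.
  apply: ge0_le_integral => //.
  - by move=> w _; rewrite lee_fin.
  - by apply/measurable_EFinP; exact: (measurableT_comp mPhi (measurable_pair2 e)).
  - by apply/measurable_EFinP; exact: measurable_funM.
  move=> w _; rewrite -EFinM lee_fin /Phi [\1_(~` AF) w]indicE.
  case: (boolP (w \in ~` AF)) => wAF; last by rewrite !mulr0 mulr_ge0 // prodr_ge0.
  have tk : tau i w <= kap.
    move: wAF; rewrite inE /AF /= lte_fin => /negP; rewrite -leNgt; apply: le_trans.
    by rewrite /F (bigD1 i) //= lerDl sumr_ge0 // => j _; exact: ltW.
  have -> : \prod_(j < n) f (Y j w) = lratio n w e * \prod_(j < n) \1_C (Y j w) / tau i w.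
    rewrite -prodfV -!big_split /=; apply: eq_bigr => j _.
    by rewrite /f -[in RHS]sqrtrV ?divr_ge0 ?(ltW (G_gt0 _ _)) ?(ltW (g0_gt0 _)) // invf_div; ring.
  rewrite mulr1; set z := lratio n w e * _.
  have z0 : 0 <= z by rewrite mulr_ge0 ?(ltW (lratio_gt0 _ _ _)) // prodr_ge0.
  by rewrite mulrA ler_pdivlMr // mulrC ler_wpM2r.
have [mAP PP] := fubini_exceedance pi mPhi Phi0 mS t0 EPhi.
set AP := [set w | _] in mAP PP.
exists (AC `|` AF `|` AP); split.
- by apply: measurableU => //; exact: measurableU.
- apply: le_trans (measureU2 _ _ _) _ => //; first exact: measurableU.
  rewrite EFinD; apply: leeD; last first.
    apply: le_trans PP _; rewrite lee_fin -mulrA ler_piMl //.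
      by rewrite mulr_ge0 ?invr_ge0 ?(ltW t0) // mulr_ge0 ?exprn_ge0 // ltW.
    by rewrite -lee_fin fineK ?fin_num_measure // probability_le1.
  apply: le_trans (measureU2 _ _ _) _ => //.
  rewrite EFinD; apply: leeD => //.
  by apply: le_trans (PC _) _ => //; rewrite lee_fin invrK; lra.
move=> w /= /not_orP[/not_orP[nC nF] nP].
have h1 : Phi w = lratio n w.
  apply/funext => e; rewrite /Phi [\1_(~` AF) w]indicE mem_set // mulr1 big1 ?mulr1 // => j _.
  rewrite indicE; case: (boolP (Y j w \in C)) => // yC; exfalso; apply: nC.
  rewrite /AC /= lte_fin /out (bigD1 j) //= indicE in_setC yC /=.
  apply: (@lt_le_trans _ _ 1); first by lra.
  by rewrite lerDl sumr_ge0.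
by move/negP: nP; rewrite -leNgt h1.
Qed.
End bayes.

(** * Arithmetic of rates and entropy *)

Section arith.
Variable R : realType.

Lemma exprn_powR_inv (b : nat) (x : R) : (0 < b)%N -> 0 <= x -> (x ^+ b) `^ (b%:R^-1) = x.
Proof.
by move=> b0 x0; rewrite -powR_mulrn // -powRrM mulfV ?pnatr_eq0 -?lt0n // powRr1.
Qed.

(** Finds the sample size at which the tail hypothesis is invoked. Rounding [(9 * f) ^+ b] up to an
    integer costs less than passing from 9 to 10. *)
Lemma tail_index (b : nat) (f : R) : (0 < b)%N -> 1 <= f ->
  exists n : nat, [/\ 9 * f <= n%:R `^ (b%:R^-1), n%:R `^ (b%:R^-1) <= 10 * f & 9 * f <= n%:R].
Proof.
move=> b0 f1; have f0 : 0 <= 9 * f by lra.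
have bi0 : 0 <= b%:R^-1 :> R by rewrite invr_ge0.
set n := (Num.truncn ((9 * f) ^+ b)).+1.
have n1 : (9 * f) ^+ b <= n%:R by apply: ltW; exact: truncnS_gt.
have n2 : n%:R <= (10 * f) ^+ b.
  have h : (9 * f) ^+ b + 1 <= (10 * f) ^+ b.
    case: b b0 {bi0 n n1} => // b _.
    have h1 : (9 * f) ^+ b <= (10 * f) ^+ b by apply: lerXn2r; rewrite ?nnegrE //; lra.
    have h2 : 1 <= (10 * f) ^+ b by apply: exprn_ege1; lra.
    have h0 : 0 <= (9 * f) ^+ b by apply: exprn_ge0.
    rewrite !exprS; nra.
  by apply: le_trans h; rewrite /n -natr1 lerD2r truncn_le // exprn_ge0.
exists n; split.
- by rewrite -[leLHS](exprn_powR_inv b0 f0); apply: ge0_ler_powR; rewrite ?nnegrE ?exprn_ge0.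
- have f10 : 0 <= 10 * f by lra.
  by rewrite -[leRHS](exprn_powR_inv b0 f10); apply: ge0_ler_powR; rewrite ?nnegrE ?exprn_ge0.
- by apply: le_trans n1; rewrite ler_eXnr //; lra.
Qed.

Lemma root_index (c n : nat) : (0 < c)%N -> (0 < n)%N ->
  exists m, [/\ (0 < m)%N, (m ^ c <= n)%N & (n < m.+1 ^ c)%N].
Proof.
move=> c0 n0; pose Q m := (m ^ c <= n)%N.
have Q1 : exists m, Q m by exists 1%N; rewrite /Q exp1n.
have QM m : Q m -> (m <= n)%N.
  by move=> h; apply: leq_trans h; rewrite -(prednK c0); case: m => // m; rewrite expnS leq_pmulr ?expn_gt0.
case: (ex_maxnP Q1 QM) => m Qm mM; exists m; split => //.
- by apply: mM; rewrite /Q exp1n.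
- by rewrite ltnNge; apply/negP => /mM; rewrite ltnn.
Qed.

(** Exponents: [1 - 2 * p / (2 * p + 1) = 1 / (2 * p + 1)]. *)
Lemma rate_lower (p n : nat) (e : R) : (0 < n)%N ->
  n%:R `^ (- (p%:R / (2 * p + 1)%:R)) <= e -> n%:R `^ ((2 * p + 1)%:R^-1) <= n%:R * e ^+ 2.
Proof.
move=> n0 he; have nR : 0 < n%:R :> R by rewrite ltr0n.
set s := n%:R `^ _ in he; have s0 : 0 <= s by exact: powR_ge0.
have h : s ^+ 2 <= e ^+ 2 by rewrite lerXn2r // nnegrE (le_trans s0).
apply: (@le_trans _ _ (n%:R * s ^+ 2)); last by rewrite ler_pM2l.
rewrite /s -powR_mulrn ?powR_ge0 // -powRrM -{2}[n%:R](powRr1 (ltW nR)) -powRD; last first.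
  by rewrite (gt_eqF nR) implybT.
rewrite le_eqVlt; apply/orP; left; apply/eqP; congr (_ `^ _).
by rewrite natrD natrM; field; rewrite -natrM natr1 pnatr_eq0.
Qed.

Lemma pow_root_le (p k m n c : nat) : (k * (2 * p + 1) <= c)%N -> (0 < m)%N -> (m ^ c <= n)%N ->
  m%:R ^+ k <= n%:R `^ ((2 * p + 1)%:R^-1) :> R.
Proof.
move=> kc m0 mn; rewrite -[leLHS](@exprn_powR_inv (2 * p + 1)) ?exprn_ge0 ?addn1 //.
rewrite ge0_ler_powR ?nnegrE ?invr_ge0 ?exprn_ge0 // -exprM -natrX ler_nat.
by apply: leq_trans mn; rewrite leq_pexp2l // -addn1.
Qed.

Lemma natr_le_expR (n : nat) : n%:R <= expR n%:R :> R.
Proof. by apply: le_trans (expR_ge1Dx _); rewrite lerDr. Qed.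

(** The logarithm of the net size is [O(m ^ b)] for the dimension times [O(log n)]. The crude
    [log n <= 2 * c * m], from [n < (m + 1) ^ c <= (2 * m) ^ c], is enough and accounts for the
    exponent [b + 1]. *)
Lemma entropy_bound (b c Cd D1 : nat) : (0 < c)%N -> (b <= c)%N -> exists C' : nat,
  forall m n k d : nat, (0 < m)%N -> (m ^ c <= n)%N -> (n < m.+1 ^ c)%N -> (d <= Cd * m ^ b)%N ->
  (k <= ((d.+1 * D1 * n ^ 2).*2).+1 ^ d.+1)%N -> k%:R <= expR (C'%:R * m%:R ^+ b.+1) :> R.
Proof.
move=> c0 bc; pose D2 := ((Cd + 1) * D1).*2.+1.
exists ((Cd + 1) * (D2 + 6 * c))%N => m n k d m0 mn nm hd hk.
have mb0 : (0 < m ^ b)%N by rewrite expn_gt0 m0.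
have d1 : (d.+1 <= (Cd + 1) * m ^ b)%N by rewrite mulnDl mul1n -addn1 leq_add.
have mbn : (m ^ b <= n)%N by apply: leq_trans mn; rewrite leq_pexp2l.
have n0 : (0 < n)%N by apply: leq_trans mbn.
have hB : ((d.+1 * D1 * n ^ 2).*2.+1 <= D2 * n ^ 3)%N.
  have h1 : (d.+1 * D1 * n ^ 2 <= (Cd + 1) * D1 * n ^ 3)%N.
    have -> : ((Cd + 1) * D1 * n ^ 3 = (Cd + 1) * n * D1 * n ^ 2)%N by rewrite !expnS; ring.
    by rewrite !leq_mul2r (leq_trans d1) ?leq_mul2l ?mbn ?orbT.
  have n3 : (0 < n ^ 3)%N by rewrite expn_gt0 n0.
  move: h1; rewrite /D2; move: (d.+1 * D1 * n ^ 2)%N ((Cd + 1) * D1)%N (n ^ 3)%N n3 => x y z.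
  by rewrite -!muln2 => z0 xy; rewrite mulSn mulnAC; lia.
have hn : n%:R <= expR (2 * c%:R * m%:R) :> R.
  apply: (@le_trans _ _ ((2 * m)%:R ^+ c)).
    rewrite -natrX ler_nat; apply: leq_trans (ltnW nm) _; rewrite leq_exp2r //; lia.
  have -> : 2 * c%:R * m%:R = (2 * m)%:R * c%:R :> R by rewrite natrM; ring.
  rewrite mulrC expRM_natl; apply: lerXn2r; rewrite ?nnegrE ?expR_ge0 //.
  exact: natr_le_expR.
have hBR : ((d.+1 * D1 * n ^ 2).*2.+1)%:R <= expR ((D2 + 6 * c)%:R * m%:R) :> R.
  apply: (@le_trans _ _ (D2%:R * n%:R ^+ 3)); first by rewrite -natrX -natrM ler_nat.
  have -> : (D2 + 6 * c)%:R * m%:R = D2%:R * m%:R + 3%:R * (2 * c%:R * m%:R) :> R.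
    by rewrite natrD natrM; ring.
  rewrite expRD [X in _ <= _ * X]expRM_natl; apply: ler_pM; rewrite ?exprn_ge0 //.
    apply: le_trans (natr_le_expR _) _; rewrite ler_expR ler_peMr // ler1n //.
  by apply: lerXn2r; rewrite ?nnegrE ?expR_ge0.
apply: (@le_trans _ _ (expR ((D2 + 6 * c)%:R * m%:R) ^+ d.+1)).
  apply: (@le_trans _ _ (((d.+1 * D1 * n ^ 2).*2.+1)%:R ^+ d.+1)); first by rewrite -natrX ler_nat.
  by apply: lerXn2r; rewrite ?nnegrE ?expR_ge0.
rewrite -expRM_natl ler_expR mulrA -!natrX -!natrM ler_nat expnS.
have -> : ((Cd + 1) * (D2 + 6 * c) * (m * m ^ b) = (Cd + 1) * m ^ b * ((D2 + 6 * c)) * m)%N by ring.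
by rewrite !leq_mul2r d1 !orbT.
Qed.

End arith.

Lemma expR_cvg0 (R : realType) (f : nat -> R) (C : R) : 0 < C ->
  f n @[n --> \oo] --> +oo -> expR (- (C * f n)) @[n --> \oo] --> 0.
Proof.
move=> C0 hf; have h : C * f n @[n --> \oo] --> +oo.
  by apply/cvgryPge => A; move/cvgryPge/(_ (A / C)): hf; apply: filterS => n; rewrite ler_pdivrMr // mulrC.
exact: (cvg_comp _ _ h (@cvgr_expR R)).
Qed.

Lemma ereal_quotient_le (R : realType) (x y : \bar R) (s t : R) :
  (0 <= x)%E -> (x <= s%:E)%E -> 0 < t -> (t%:E <= y)%E -> (x / y <= (s / t)%:E)%E.
Proof.
move=> x0 xs t0; case: x x0 xs => [x| |] //; rewrite !lee_fin => x0 xs.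
case: y => [y| |] //.
  rewrite lee_fin => ty; have y0 : 0 < y by exact: lt_le_trans ty.
  rewrite inver gt_eqF // -EFinM lee_fin; apply: ler_pM => //; rewrite ?invr_ge0 ?(ltW y0) //.
  by rewrite lef_pV2.
by move=> _; rewrite invey mule0 lee_fin divr_ge0 ?(le_trans x0 xs) ?(ltW t0).
Qed.

(** * Concentration of the posterior *)

Section core.
Context (R : realType).
Local Notation X := (measurableTypeR R).
Context dE (E : measurableType dE) dT (T : measurableType dT).
Variable mu : {measure set X -> \bar R}.
Hypothesis moments : forall k, (\int[mu]_x (`|x| ^+ k)%:E < +oo)%E.
Hypothesis mu_fin : (mu setT < +oo)%E.
Local Notation J := (poly_int mu setT).
Hypothesis positive : forall P : {poly R}, P != 0 -> (forall x, 0 <= P.[x]) -> 0 < J P.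
Variable q : nat -> {poly R}.
Hypothesis q_size : forall j, size (q j) = j.+1.
Hypothesis q_orth : forall i j, i != j -> J (q i * q j) = 0.
Variables (p : nat) (gt : nat -> R).
Hypothesis p_gt0 : (0 < p)%N.
Hypothesis gt_gt0 : forall j, 0 < gt j.
Hypothesis gt_deriv : forall j, (p <= j)%N ->
  \sum_(i < j) ((J (q i ^+ 2))^-1 * J ((q j)^`(p) * q i)) ^+ 4 * J (q i ^+ 2) <= gt j.
Hypothesis gt_gam : forall i j, (i < j)%N -> j%:R ^+ 4 * J (q i ^+ 2) <= gt j.
Variable a : R.
Hypothesis a0 : 0 < a.
Variables (P : probability T R) (Y : nat -> T -> X).
Hypothesis mY : forall i, measurable_fun setT (Y i).
Variable g0 : X -> R.
Hypothesis dg0 : density mu a g0.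
Hypothesis marginal : forall i (f : X -> R), measurable_fun setT f -> (forall x, 0 <= f x) ->
  (\int[P]_w (f (Y i w))%:E = \int[mu]_x (f x * g0 x)%:E)%E.
Hypothesis iid : forall n (f : X -> R) (c : R), measurable_fun setT f -> (forall x, 0 <= f x) ->
  (\int[mu]_x (f x * g0 x)%:E <= c%:E)%E ->
  (\int[P]_w (\prod_(i < n) f (Y i w))%:E <= (c ^+ n)%:E)%E.
Variable pi : probability E R.
Variable G : E -> X -> R.
Hypothesis mG : measurable_fun setT (fun z : E * X => G z.1 z.2).
Hypothesis G_gt0 : forall e x, 0 < G e x.
Variable Omega : set E.
Hypothesis mOmega : measurable Omega.
Hypothesis dG : forall e, Omega e -> density mu a (G e).
Variable cf : E -> nat -> R.
Hypothesis cf_expand : forall e, Omega e ->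
  (\int[mu]_x ((G e x - \sum_(j < n) cf e j * (q j).[x]) ^+ 2)%:E)%E @[n --> \oo] --> 0%E.
Variable eps : nat -> R.
Hypothesis eps_lower : forall n, (1 <= n)%N -> n%:R `^ (- (p%:R / (2 * p + 1)%:R)) <= eps n.

Local Notation c := (sieve_rate p).
Local Notation b := (sieve_dim p).
Local Notation lratio := (lratio Y g0 G).

(** The window is where the sieve is approximated; the cutoff bounds the root ratios in
    [net_ratio_le]. The complement has mass [O(1 / n ^+ 2)] when [n < m.+1 ^ c], so all [n]
    observations lie inside with probability [1 - O(1 / n)]. *)
Definition core_set (m n : nat) : set X :=
  [set` `[- m%:R, m%:R[%R] `&` [set x | g0 x <= n%:R ^+ 2].

Lemma measurable_core_set m n : measurable (core_set m n).
Proof.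
apply: measurableI; first exact: measurable_itv.
rewrite -[X in measurable X]setTI; have -> : [set x | g0 x <= n%:R ^+ 2] = g0 @^-1` `]-oo, n%:R ^+ 2].
  by apply/seteqP; split => x; rewrite /= in_itv.
exact: (density_meas dg0 measurableT (measurable_itv _)).
Qed.

(** Where [g0 > n ^+ 2], the square integrability of [g0] gives the bound, as
    [g0 <= g0 ^+ 2 / n ^+ 2]. Elsewhere outside the window [g0 <= n ^+ 2], and a moment does. *)
Lemma core_set_tail : exists2 kap : R, 0 <= kap & forall m n, (0 < n)%N -> (n < m.+1 ^ c)%N ->
  (\int[mu]_x (\1_(~` core_set m n) x * g0 x)%:E <= (kap / n%:R ^+ 2)%:E)%E.
Proof.
(* Since [(m + 1) ^ 2 <= 2 * x ^+ 2 + 2] for [|x| >= m], the power [2 * c] yields at least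
   [(m + 1) ^ (4 * c)], which exceeds [n ^ 4]. *)
pose Q : {poly R} := (2 *: 'X^2 + 2%:P) ^+ (2 * c).
have QE x : Q.[x] = (2 * x ^+ 2 + 2) ^+ (2 * c) by rewrite /Q horner_exp hornerD hornerZ hornerXn hornerC.
have sg := density_sq dg0.
have iQ := integrable_horner moments Q.
exists (2 * norm2 mu g0 ^+ 2 + \int[mu]_x Q.[x]) => [|m n n0 nm].
  rewrite addr_ge0 ?mulr_ge0 ?sqr_ge0 ?norm2_ge0 //; apply: Rintegral_ge0 => x _.
  by rewrite QE exprn_ge0 // addr_ge0 // mulr_ge0 // sqr_ge0.
have nR : 0 < n%:R :> R by rewrite ltr0n.
have n2 : 0 < n%:R ^+ 2 :> R by rewrite exprn_gt0.
have i1 := integrable_scale (2 / n%:R ^+ 2) (integrable_sqr sg).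
have i2 := integrable_scale (n%:R ^+ 2)^-1 iQ.
have -> : (2 * norm2 mu g0 ^+ 2 + \int[mu]_x Q.[x]) / n%:R ^+ 2 =
    \int[mu]_x (2 / n%:R ^+ 2 * g0 x ^+ 2 + (n%:R ^+ 2)^-1 * Q.[x]).
  rewrite RintegralD // RintegralZl //; last exact: integrable_sqr.
  by rewrite RintegralZl // Rintegral_sqr; field; rewrite gt_eqF.
apply: ge0_le_Rintegral.
- apply: measurable_funM; last exact: density_meas dg0.
  exact: measurable_indic (measurableC (measurable_core_set _ _)).
- exact: integrable_add.
move=> x; have g00 := density_gt0 a0 x dg0.
have Q0 : 0 <= Q.[x] by rewrite QE exprn_ge0 // addr_ge0 // mulr_ge0 // sqr_ge0.
rewrite mulr_ge0 ?(ltW g00) //=.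
have r1 : 0 <= 2 / n%:R ^+ 2 * g0 x ^+ 2 by rewrite mulr_ge0 ?sqr_ge0 // divr_ge0 // ltW.
have r2 : 0 <= (n%:R ^+ 2)^-1 * Q.[x] by rewrite mulr_ge0 // invr_ge0 ltW.
rewrite indicE in_setC; case: (boolP (x \in core_set m n)) => xC; first by rewrite mul0r addr_ge0.
rewrite mul1r; set s := n%:R ^+ 2 in n2 r1 r2 *; set g := g0 x in g00 r1 *.
case: (ltP s g) => sg'.
  have : g <= 2 / s * g ^+ 2.
    have -> : 2 / s * g ^+ 2 = g * (2 * (g / s)) by ring.
    rewrite ler_peMr ?(ltW g00) //; have : 1 <= g / s by rewrite ler_pdivlMr // mul1r ltW.
    lra.
  lra.
have xm : m%:R <= `|x|.
  rewrite leNgt; apply/negP => xm; move/negP: xC; apply; rewrite inE; split => //=.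
  by move: xm; rewrite in_itv /= ltr_norml => /andP[/ltW -> ->].
have hQ : s ^+ 2 <= Q.[x].
  have h1 : m.+1%:R ^+ 2 <= 2 * x ^+ 2 + 2 :> R.
    rewrite -natr1 -(real_normK (num_real x)).
    have := sqr_ge0 (`|x| - 1); have h0 : 0 <= m%:R :> R by []. 
    nra.
  rewrite QE /s; apply: (@le_trans _ _ ((m.+1%:R ^+ 2) ^+ (2 * c))); last first.
    by apply: lerXn2r h1; rewrite nnegrE ?exprn_ge0 //; have := sqr_ge0 x; lra.
  rewrite -!exprM -!natrX ler_nat; apply: (@leq_trans ((m.+1 ^ c) ^ 4)).
    by rewrite leq_exp2r // ltnW.
  by rewrite -expnM [(c * 4)%N]mulnC mulnA; exact: leqnn.
have : g <= s^-1 * Q.[x].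
  apply: le_trans sg' _; by rewrite mulrC ler_pdivlMr // -expr2.
lra.
Qed.

Let f n := n%:R * eps n ^+ 2.

Lemma f_lower n : (0 < n)%N -> n%:R `^ ((2 * p + 1)%:R^-1) <= f n.
Proof. by move=> n0; apply: rate_lower => //; exact: eps_lower. Qed.

Lemma f_ge1 n : (0 < n)%N -> 1 <= f n.
Proof.
move=> n0; apply: le_trans (f_lower n0); rewrite -{1}(@powRr0 _ n%:R).
by rewrite ler_powR // ler1n.
Qed.

(** The net has size at most [exp (C' * f n)] and each net point has [n]-fold affinity at most
    [exp (- K ^+ 2 * f n / 2)]; the threshold [exp (- K ^+ 2 * f n / 4)] halves this exponent. Both
    kinds of error remain [O(exp (- f n))] once [K ^+ 2 / 4 >= C' + |t0| + 2]. *)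
Lemma test_bound (t0 : R) : exists K1 : R, forall K, K1 <= K -> exists kap : R,
  \forall n \near \oo, forall S : set E, measurable S -> S `<=` Omega ->
  (forall e, S e -> (((K * eps n) ^+ 2)%:E <=
     \int[mu]_x ((Num.sqrt (G e x) - Num.sqrt (g0 x)) ^+ 2)%:E)%E) ->
  (forall e, S e -> forall N, \sum_(j < N) cf e j ^+ 2 * gt j <= 10 * f n) ->
  exists A, [/\ measurable A, (P A <= (kap / n%:R + expR 2 * expR (- f n))%:E)%E &
    forall w, ~ A w -> (\int[pi]_(e in S) (lratio n w e)%:E <= (expR (- (t0 * f n)))%:E)%E].
Proof.
have [Cd hCd] := finite_sieve moments positive q_size q_orth p_gt0 gt_gt0 gt_deriv gt_gam.
have [kap kap_ge0 hkap] := core_set_tail.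
(* With [M ^+ 2 = 10 * f n] this constant gives the radius [delta = sqrt (a / 2) * eps n], for which
   the term [2 * delta ^+ 2 / a] of [net_ratio_le] is [eps n ^+ 2]. *)
have {}hCd := hCd (a / 20) (divr_gt0 a0 (ltr0n _ 20)).
pose D0 := (Num.truncn (2 + total_norm mu * Num.sqrt (a / 2))).+1.
(* With [q' = Q' * n ^ 2], the term [(n / sqrt a + 2) / q'] of [net_ratio_le] is at most [1 / n]. *)
pose Q' := (Num.truncn ((Num.sqrt a)^-1 + 2)).+1.
have c0 : (0 < c)%N by [].
have bc : (b <= c)%N := sieve_dim_le_rate p.
have [C' hC'] := entropy_bound R Cd (D0 * Q') c0 bc.
exists (4 * C'%:R + 4 * `|t0| + 16) => K hK; exists (2 * kap).
have K2 : 2 <= K by have := normr_ge0 t0; have : 0 <= C'%:R :> R by []; lra.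
case: hCd => m1 _ hm1; exists (m1 ^ c)%N.+1 => // n /= hn S mS SO SA Stail.
have n0 : (0 < n)%N by apply: leq_trans hn.
have nR : 0 < n%:R :> R by rewrite ltr0n.
have f1 := f_ge1 n0.
have eps0 : 0 < eps n by apply: lt_le_trans (eps_lower n0); rewrite powR_gt0.
have K0 : 0 <= K by lra.
(* Squared Hellinger distances are at most 2, so [K >= 2] and [eps n > 1] leave [S] empty. In the
   other case [eps n <= 1] lets [D0] be independent of [n]. *)
case: (ltP 1 (eps n)) => eps1.
  exists set0; split => //.
  - by rewrite measure0 lee_fin addr_ge0 ?mulr_ge0 ?expR_ge0 ?invr_ge0 //.
  - have -> : S = set0.
      rewrite -subset0 => e Se; have := affinity_le mu_fin a0 dg0 (dG (SO _ Se)) (SA e Se).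
      have : (0 <= \int[mu]_x (Num.sqrt (G e x * g0 x))%:E)%E.
        by apply: integral_ge0 => x _; rewrite lee_fin sqrtr_ge0.
      move=> /le_trans h /h; rewrite lee_fin exprMn => h'; exfalso.
      have k4 : 4 <= K ^+ 2 by nra.
      have e1 : 1 <= eps n ^+ 2 by nra.
      by have := ler_pM (ler0n _ 4) ler01 k4 e1; lra.
    by move=> w _; rewrite integral_set0 lee_fin expR_ge0.
have [m [m0 mn nm]] := root_index c0 n0.
have mm1 : (m1 <= m)%N.
  rewrite -ltnS -(ltn_exp2r _ _ c0); exact: leq_trans hn (ltnW nm).
have [U [u [Ucard su hu]]] := hm1 m mm1.
pose C := core_set m n; have mC : measurable C := measurable_core_set m n.
pose u' i x := \1_C x * u i x.
pose F e x := \1_C x * G e x.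
pose delta := Num.sqrt (a / 2) * eps n.
pose M := Num.sqrt (10 * f n).
have f10 : 0 < 10 * f n by lra.
have M0 : 0 < M by rewrite sqrtr_gt0.
have M2 : M ^+ 2 = 10 * f n by rewrite sqr_sqrtr // ltW.
have su' i : sq_integrable mu (u' i) by exact: sq_integrable_indic.
have hF e : S e -> [/\ sq_integrable mu (F e), norm1 mu (F e) <= 1 &
     exists y, norm2 mu (fun x => F e x - \sum_i y i * u' i x) <= delta].
  move=> Se; have de := dG (SO _ Se); have sGe := density_sq de.
  have sFe : sq_integrable mu (F e) by exact: sq_integrable_indic.
  split => //.
    rewrite -(density_int de); apply: le_Rintegral => //.
    - exact: (sq_integrable_int mu_fin (sq_integrable_norm sFe)).
    - exact: (density_integrable mu_fin de).
    - move=> x _; have G0 := ltW (G_gt0 e x); rewrite ger0_norm ?mulr_ge0 //.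
      by rewrite ler_piMl // indicE; case: (_ \in _).
  have [|y hy] := hu (G e) (cf e) M M0 sGe (cf_expand (SO _ Se)).
    by move=> N; rewrite M2; exact: Stail.
  exists y; set D := (X in norm2 mu X ^+ 2 <= _) in hy.
  have sD : sq_integrable mu D.
    apply: sq_integrableB; first by apply: sq_integrable_indic => //; exact: measurable_itv.
    by apply: sq_integrable_sum => i _; exact: sq_integrableZ.
  have -> : (fun x => F e x - \sum_i y i * u' i x) = (fun x => \1_C x * D x).
    apply/funext => x; rewrite /D mulrBr mulr_sumr mulrA; congr (_ * _ - _); last first.
      by apply: eq_bigr => i _; rewrite /u'; ring.
    rewrite /C /core_set !indicE in_setI; case: (_ \in _); case: (_ \in _); rewrite /= ?mulr1 ?mulr0 //.
  apply: le_trans (norm2_indic_le mC sD) _.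
  rewrite -ler_sqr ?nnegrE ?norm2_ge0 ?mulr_ge0 ?sqrtr_ge0 ?(ltW eps0) //.
  apply: le_trans hy _; rewrite M2 exprMn sqr_sqrtr ?divr_ge0 ?(ltW a0) //.
  have hn1 : n%:R <= m.+1%:R ^+ c :> R by rewrite -natrX ler_nat ltnW.
  have hp : 0 < m.+1%:R ^+ c :> R by rewrite exprn_gt0 // ltr0n.
  rewrite mulrAC ler_pdivrMr // /f.
  have -> : a / 20 * (10 * (n%:R * eps n ^+ 2)) = a / 2 * eps n ^+ 2 * n%:R by field.
  by rewrite ler_wpM2l // mulr_ge0 ?sqr_ge0 // divr_ge0 // ltW.
pose q' := (Q' * n ^ 2)%N.
have q'0 : (0 < q')%N by rewrite muln_gt0 expn_gt0 n0.
have hD0 : 2 + total_norm mu * delta <= D0%:R.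
  apply: le_trans (ltW (truncnS_gt _)); rewrite lerD2l ler_wpM2l ?norm2_ge0 //.
  by rewrite ler_piMr // sqrtr_ge0.
have [k [x [kN xS xcov]]] := l2_net mu_fin (U := U) (u := u') (A := S) (F := F)
  (D0 := D0) su' isT q'0 hD0 hF.
have hk : k%:R <= expR (C'%:R * f n).
  apply: le_trans (hC' m n k #|U| m0 mn nm Ucard _) _.
    by move: kN; rewrite /q' mulnA -[(_ * D0 * Q')%N]mulnA.
  rewrite ler_expR ler_wpM2l //; apply: le_trans (f_lower n0).
  by apply: pow_root_le mn => //; exact: leqnSn.
pose bb := 1 + 2 * delta ^+ 2 / a + (n%:R / Num.sqrt a + 2) / q'%:R.
pose h := expR (- (K ^+ 2 * eps n ^+ 2 / 2)).
pose kapp := expR (- (K ^+ 2 * f n / 4)).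
have sa0 : 0 < Num.sqrt a by rewrite sqrtr_gt0.
have bb0 : 0 <= bb.
  have h1 : 0 <= 2 * delta ^+ 2 / a by rewrite divr_ge0 ?mulr_ge0 ?sqr_ge0 // ltW.
  have h2 : 0 <= n%:R / Num.sqrt a by rewrite divr_ge0 // ltW.
  have h3 : 0 <= (n%:R / Num.sqrt a + 2) / q'%:R by rewrite divr_ge0 // addr_ge0.
  by rewrite /bb; lra.
have [|||A [mA PA hA]] := test_event a0 mY dg0 marginal iid pi mG G_gt0 n (Omega := Omega)
  (S := S) (C := C) (k := k) (x := x) (b := bb) (h := h) (kap := kapp)
  (t := expR (- (t0 * f n))) (p := kap / n%:R ^+ 2) mS mC SO (fun i => SO _ (xS i))
  (expR_gt0 _) (expR_gt0 _) bb0.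
- exact: hkap.
- move=> i; apply: le_trans (affinity_le mu_fin a0 dg0 (dG (SO _ (xS i))) (SA _ (xS i))) _.
  rewrite lee_fin /h; apply: le_trans (expR_ge1Dx _); rewrite exprMn; lra.
- move=> e Se; have [i [e' [v [se' sv ne' nv [mass ev]]]]] := xcov e Se; exists i.
  apply: (net_ratio_le mu_fin a0 mC dg0 (dG (SO _ Se)) (dG (SO _ (xS i))) se' sv ne' nv mass ev).
  by move=> y [].
exists A; split => //; apply: le_trans PA _; rewrite lee_fin -addrA.
have e1 : 2 * n%:R * (kap / n%:R ^+ 2) = 2 * kap / n%:R by field; rewrite gt_eqF.
rewrite e1 lerD2l.
have C0' : 0 <= C'%:R :> R by [].
have t00 := normr_ge0 t0; have t0n := ler_norm t0.
have Kbig : C'%:R + `|t0| + 2 <= K ^+ 2 / 4 by nra.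
have hpart : k%:R * h ^+ n / kapp <= expR (- f n).
  have -> : h ^+ n = expR (- (K ^+ 2 * f n / 2)).
    by rewrite /h -expRM_natl; congr expR; rewrite /f; ring.
  rewrite /kapp -expRN; apply: (@le_trans _ _ (expR (C'%:R * f n) *
      expR (- (K ^+ 2 * f n / 2)) * expR (- - (K ^+ 2 * f n / 4)))).
    by rewrite ler_pM2r ?expR_gt0 // ler_pM2r ?expR_gt0.
  rewrite -!expRD ler_expR; nra.
have bbn : bb ^+ n <= expR (f n + 1).
  have -> : f n + 1 = n%:R * (eps n ^+ 2 + n%:R^-1) by rewrite /f; field; rewrite gt_eqF.
  rewrite expRM_natl; apply: lerXn2r; rewrite ?nnegrE ?expR_ge0 //.
  apply: le_trans (expR_ge1Dx _); rewrite /bb -addrA lerD2l; apply: lerD.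
    rewrite /delta exprMn sqr_sqrtr ?divr_ge0 ?(ltW a0) //.
    by rewrite le_eqVlt; apply/orP; left; apply/eqP; field; rewrite gt_eqF.
  rewrite ler_pdivrMr ?ltr0n // /q' natrM natrX.
  have -> : n%:R^-1 * (Q'%:R * n%:R ^+ 2) = Q'%:R * n%:R :> R by field; rewrite gt_eqF.
  have hQ' : (Num.sqrt a)^-1 + 2 <= Q'%:R by exact: ltW (truncnS_gt _).
  have n1 : 1 <= n%:R :> R by rewrite ler1n.
  nra.
have bpart : kapp * bb ^+ n / expR (- (t0 * f n)) <= expR 1 * expR (- f n).
  rewrite -expRN; apply: (@le_trans _ _ (kapp * expR (f n + 1) * expR (- - (t0 * f n)))).
    by rewrite ler_pM2r ?expR_gt0 // ler_pM2l ?expR_gt0.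
  rewrite /kapp -!expRD ler_expR; nra.
apply: le_trans (lerD hpart bpart) _.
have e2 : expR 2 = expR 1 * expR 1 :> R by rewrite -expRD.
have e3 : 2 <= expR 1 :> R by have := expR_ge1Dx (1 : R); lra.
have := expR_gt0 (- f n); rewrite e2; set z := expR (- f n); set y := expR 1 in e3 * => z0.
have h2 : 1 + y <= y * y by nra.
by have := ler_wpM2r (ltW z0) h2; lra.
Qed.

Theorem posterior_rate (C3 : R) (B U : nat -> set E) (A : R -> nat -> set E) :
  0 < C3 -> f n @[n --> \oo] --> +oo ->
  (forall n, measurable (B n)) -> (forall n, B n `<=` Omega) ->
  (forall n, measurable (U n)) -> (forall n, U n `<=` Omega) ->
  (forall K n, measurable (A K n)) -> (forall K n, A K n `<=` Omega) ->
  (forall n e, B n e -> norm2 mu (fun x => G e x - g0 x) ^+ 2 <= a * (C3 * eps n ^+ 2)) ->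
  (exists2 r : R, 0 < r & \forall n \near \oo, ((r * expR (- (2 * C3 * f n)))%:E <= pi (B n))%E) ->
  (forall n e, Omega e -> ~ U n e -> forall N,
     \sum_(j < N) cf e j ^+ 2 * gt j <= n%:R `^ ((2 * p + 1)%:R^-1)) ->
  (exists2 r : R, 0 < r & \forall n \near \oo, (pi (U n) <= (r * expR (- (C3 * f n)))%:E)%E) ->
  (forall K n e, 0 <= K -> (1 <= n)%N -> A K n e -> (((K * eps n) ^+ 2)%:E <=
     \int[mu]_x ((Num.sqrt (G e x) - Num.sqrt (g0 x)) ^+ 2)%:E)%E) ->
  exists K1 : R, forall K, K1 <= K -> exists2 r : R, 0 < r & exists Ev : nat -> set T,
    [/\ forall n, measurable (Ev n), P (Ev n) @[n --> \oo] --> 0%E &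
        \forall n \near \oo, forall w, ~ Ev n w ->
          ((\int[pi]_(e in A K n) (lratio n w e)%:E) / (\int[pi]_(e in Omega) (lratio n w e)%:E) <=
           (r * expR (- (4 * C3 * f n)))%:E)%E].
Proof.
move=> C30 finf mB BO mU UO mA AO hB [rB rB0 hBpi] hU [rU rU0 hUpi] hA.
have [K1 hK1] := test_bound (8 * C3).
exists (Num.max 0 K1) => K; rewrite ge_max => /andP[K0 /hK1[kap hkap]].
exists (2 / rB); first by rewrite divr_gt0.
pose bd n := (expR (- (C3 * f n)) + rU * expR (- (C3 * f n))) +
  (kap / n%:R + expR 2 * expR (- f n)).
have lr_meas n w : measurable_fun setT (lratio n w) := lratio_section a0 mY dg0 mG n w.
have lr0 n w e : 0 <= lratio n w e by exact: ltW (lratio_gt0 a0 Y dg0 G_gt0 n w e).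
have main : \forall n \near \oo, exists Ev, [/\ measurable Ev, (P Ev <= (bd n)%:E)%E &
    forall w, ~ Ev w ->
      ((\int[pi]_(e in A K n) (lratio n w e)%:E) / (\int[pi]_(e in Omega) (lratio n w e)%:E) <=
           (2 / rB * expR (- (4 * C3 * f n)))%:E)%E].
  case: hUpi => nU _ hUpi; case: hBpi => nB _ hBpi; case: hkap => nK _ hkap.
  have /cvgryPge/(_ nU%:R)[nF _ fU] := finf.
  exists (nF + (nB + nK)).+1 => // n /= hn.
  have n0 : (1 <= n)%N by exact: leq_trans hn.
  have {}hn := ltnW hn.
  have {}fU : nU%:R <= f n by apply: fU; exact: leq_trans (leq_addr _ _) hn.
  have {}hn := leq_trans (leq_addl _ _) hn.
  have hBn : ((rB * expR (- (2 * C3 * f n)))%:E <= pi (B n))%E.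
    by apply: hBpi; exact: leq_trans (leq_addr _ _) hn.
  have hkapn := hkap n (leq_trans (leq_addl _ _) hn).
  have f1 := f_ge1 n0; have f0 : 0 <= f n by lra.
  (* The sieve is that of sample size [n']: the prior mass of its complement has exponent
     [9 * C3 * f n], and its squared radius is at most [10 * f n]. As [n' >= 9 * f n] exceeds [nU],
     the tail hypothesis is available there. *)
  have [n' [hn1 hn2 hn3]] := @tail_index R (2 * p + 1) (f n) (ltn_addl _ (ltn0Sn 0)) f1.
  have n'U : (nU <= n')%N.
    by rewrite -(ler_nat R); apply: le_trans hn3; lra.
  have n'0 : (1 <= n')%N.
    by rewrite -(ler_nat R); apply: le_trans hn3; lra.
  have hf' : 9 * f n <= f n' by apply: le_trans hn1 (f_lower n'0).
  have ff : n%:R * (C3 * eps n ^+ 2) = C3 * f n by rewrite /f; ring.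
  have c0 : 0 <= C3 * eps n ^+ 2 by rewrite mulr_ge0 ?sqr_ge0 // ltW.
  have piB0 : (0 < pi (B n))%E.
    by apply: lt_le_trans hBn; rewrite lte_fin mulr_gt0 ?expR_gt0.
  have [A1 [mA1 PA1 hA1]] := evidence_event mu_fin a0 mY dg0 iid mG G_gt0 mOmega dG n
    (mB n) (BO n) c0 piB0 (hB n).
  have hUn : (pi (U n') <= (rU * expR (- (9 * C3 * f n)))%:E)%E.
    apply: le_trans (hUpi n' n'U) _; rewrite lee_fin ler_pM2l // ler_expR lerN2.
    by rewrite mulrAC mulrC ler_pM2l.
  have [A2 [mA2 PA2 hA2]] := tail_event mu_fin a0 mY dg0 iid mG G_gt0 dG n
    (mU n') (UO n') (expR_gt0 (- (8 * C3 * f n))) hUn.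
  pose S := A K n `\` U n'.
  have mS : measurable S by exact: measurableD.
  have [|e [Ae _]|e [Ae nU'] N|A3 [mA3 PA3 hA3]] := hkapn S mS.
  - by move=> e [Ae _]; exact: AO Ae.
  - exact: hA n0 Ae.
  - by apply: le_trans hn2; apply: hU nU' _; exact: AO Ae.
  exists (A1 `|` A2 `|` A3); split.
  - by apply: measurableU => //; exact: measurableU.
  - apply: le_trans (measureU2 _ _ _) _ => //; first exact: measurableU.
    rewrite /bd EFinD; apply: leeD => //; apply: le_trans (measureU2 _ _ _) _ => //.
    rewrite EFinD; apply: leeD; first by rewrite ff in PA1.
    apply: le_trans PA2 _; rewrite lee_fin -mulrA -expRN -expRD ler_pM2l // ler_expR; lra.
  move=> w /= /not_orP[/not_orP[n1 n2] n3].
  have num : (\int[pi]_(e in A K n) (lratio n w e)%:E <= (2 * expR (- (8 * C3 * f n)))%:E)%E.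
    have -> : A K n = S `|` (A K n `&` U n') by rewrite /S setUC setUIDK.
    rewrite ge0_integral_setU //; last 4 first.
    - exact: measurableI.
    - by apply/measurable_EFinP/measurable_funTS.
    - by move=> e _; rewrite lee_fin.
    - by apply/disj_setPS => e [[_ nUe] [_ Ue]].
    rewrite mulr_natl mulr2n EFinD; apply: leeD; first exact: hA3.
    apply: le_trans (hA2 w n2); apply: ge0_subset_integral => //.
    + exact: measurableI.
    + by apply/measurable_EFinP/measurable_funTS.
    + by move=> e _; rewrite lee_fin.
  have den : ((rB * expR (- (4 * C3 * f n)))%:E <= \int[pi]_(e in Omega) (lratio n w e)%:E)%E.
    apply: le_trans (hA1 w n1).
    have -> : (rB * expR (- (4 * C3 * f n)))%:E =
        ((rB * expR (- (2 * C3 * f n)))%:E * (expR (- (2 * n%:R * (C3 * eps n ^+ 2))))%:E)%E.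
      by rewrite -EFinM; congr _%:E; rewrite -[RHS]mulrA -expRD; congr (_ * expR _); rewrite /f; ring.
    by apply: lee_wpmul2r => //; rewrite lee_fin expR_ge0.
  have d0 : 0 < rB * expR (- (4 * C3 * f n)) by rewrite mulr_gt0 ?expR_gt0.
  have num0 : (0 <= \int[pi]_(e in A K n) (lratio n w e)%:E)%E.
    by apply: integral_ge0 => e _; rewrite lee_fin.
  apply: le_trans (ereal_quotient_le num0 num d0 den) _; rewrite lee_fin.
  have -> : - (8 * C3 * f n) = - (4 * C3 * f n) + - (4 * C3 * f n) by ring.
  rewrite expRD; have := expR_gt0 (- (4 * C3 * f n)); set z := expR _ => z0.
  by rewrite le_eqVlt; apply/orP; left; apply/eqP; field; rewrite !gt_eqF.
case: main => N0 _ main.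
have /choice[Ev hEv] : forall n, exists Ev, measurable Ev /\ ((N0 <= n)%N ->
    (P Ev <= (bd n)%:E)%E /\ forall w, ~ Ev w ->
      ((\int[pi]_(e in A K n) (lratio n w e)%:E) / (\int[pi]_(e in Omega) (lratio n w e)%:E) <=
           (2 / rB * expR (- (4 * C3 * f n)))%:E)%E).
  move=> n; case: (leqP N0 n) => [Nn|_]; last by exists set0.
  by have [Ev [h1 h2 h3]] := main n Nn; exists Ev.
exists Ev; split.
- by move=> n; have [] := hEv n.
- apply: (@squeeze_cvge _ _ _ _ (fun=> 0%E) _ (fun n => (bd n)%:E)); last 2 first.
  + exact: cvg_cst.
  + apply: cvg_EFin; first by near=> n.
    have e1 := expR_cvg0 C30 finf.
    have e2 : expR (- f n) @[n --> \oo] --> 0.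
      by have := expR_cvg0 ltr01 finf; under eq_fun do rewrite mul1r.
    have e3 : kap / n%:R @[n --> \oo] --> 0.
      rewrite -(mulr0 kap); apply: cvgMl_tmp; apply/gtr0_cvgV0; last exact: cvgr_idn.
      near=> n; rewrite ltr0n; near: n; exact: nbhs_infty_gt.
    rewrite (_ : 0 = (0 + rU * 0) + (0 + expR 2 * 0)); last by ring.
    by apply: cvgD; apply: cvgD => //; exact: cvgMl_tmp.
  + near=> n; rewrite measure_ge0 /=; have [_ /(_ _)[]//] := hEv n.
    by near: n; exact: nbhs_infty_ge.
- by exists N0 => // n /= Nn w; have [_ /(_ Nn)[_]] := hEv n; exact.
Unshelve. all: by end_near.
Qed.
End core.

(** * Weights, coefficients and data *)

Section weight.
Variables (R : realType) (I : interval R) (w : R -> R).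
Hypothesis hw : weight_function I w.
Local Notation X := (measurableTypeR R).
Local Notation leb := (@lebesgue_measure R).

(** Extension by zero turns every integral over [I] into an integral over the line for a single
    measure. *)
Definition weight0 : X -> R := w \_ [set` I].

Lemma weight0E x : weight0 x = if x \in I then w x else 0.
Proof. by rewrite /weight0 patchE mem_setE. Qed.

Lemma weight0_ge0 x : 0 <= weight0 x.
Proof. by rewrite weight0E; case: hw => _ w0 _ _; case: ifP => // /w0. Qed.

Lemma measurable_weight0 : measurable_fun setT weight0.
Proof.
have [mw _ _ _] := hw.
by apply/measurable_restrict => //; rewrite setTI.
Qed.

Definition weight_measure : {measure set X -> \bar R} :=
  density_measure leb measurable_weight0 weight0_ge0.

Lemma ge0_weight_integral (F : R -> R) (h : X -> R) : measurable_fun setT h ->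
  (forall x, 0 <= h x) -> (forall x, x \in I -> h x = F x) ->
  (\int[leb]_(x in [set` I]) (F x * w x)%:E = \int[weight_measure]_x (h x)%:E)%E.
Proof.
move=> mh h0 hF; rewrite (@ge0_integral_density _ X R leb weight0 measurable_weight0 weight0_ge0 weight_measure) //; last exact/measurable_EFinP.
rewrite [LHS]integral_mkcond; apply: eq_integral => x _.
rewrite patchE mem_setE weight0E; case: ifP => xI; last by rewrite mule0.
by rewrite -EFinM hF.
Qed.

Lemma weight_integral (F : R -> R) (h : X -> R) : measurable_fun setT h ->
  (forall x, x \in I -> h x = F x) ->
  (\int[leb]_(x in [set` I]) (F x * w x)%:E = \int[weight_measure]_x (h x)%:E)%E.
Proof.
move=> mh hF; have [_ w0 _ _] := hw.
rewrite integralE [RHS]integralE; congr (_ - _)%E.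
  transitivity (\int[leb]_(x in [set` I]) (Num.max (F x) 0 * w x)%:E)%E.
    apply: eq_integral => x; rewrite mem_setE => xI; rewrite funeposE -EFin_max.
    by rewrite -{1}(mul0r (w x)) maxr_pMl // w0.
  transitivity (\int[weight_measure]_x (Num.max (h x) 0)%:E)%E.
    apply: ge0_weight_integral; first exact: measurable_maxr.
      by move=> x; rewrite le_max lexx orbT.
    by move=> x /hF ->.
  by apply: eq_integral => x _; rewrite funeposE -EFin_max.
transitivity (\int[leb]_(x in [set` I]) (Num.max (- F x) 0 * w x)%:E)%E.
  apply: eq_integral => x; rewrite mem_setE => xI; rewrite funenegE -EFinN -EFin_max.
  by rewrite -mulNr -{1}(mul0r (w x)) maxr_pMl // w0.
transitivity (\int[weight_measure]_x (Num.max (- h x) 0)%:E)%E.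
  apply: ge0_weight_integral; first by apply: measurable_maxr => //; exact: measurableT_comp.
    by move=> x; rewrite le_max lexx orbT.
  by move=> x /hF ->.
by apply: eq_integral => x _; rewrite funenegE -EFinN -EFin_max.
Qed.

Lemma weight_Rintegral (F : R -> R) (h : X -> R) : measurable_fun setT h ->
  (forall x, x \in I -> h x = F x) ->
  \int[leb]_(x in [set` I]) (F x * w x) = \int[weight_measure]_x h x.
Proof. by move=> mh hF; rewrite /Rintegral (weight_integral mh hF). Qed.

Lemma weight_moments k : (\int[weight_measure]_x (`|x| ^+ k)%:E < +oo)%E.
Proof.
have [_ _ _ hm] := hw; apply: le_lt_trans (hm k).
rewrite (ge0_weight_integral (h := fun x => `|x| ^+ k)) //.
by apply: measurable_funX; exact: normr_measurable.
Qed.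

Lemma weight_finite : (weight_measure setT < +oo)%E.
Proof.
rewrite -[X in (X < _)%E]mul1e -integral_cst //.
by apply: le_lt_trans (weight_moments 0); rewrite (eq_integral (cst 1%E)).
Qed.

Lemma weight_mass_gt0 : (0 < weight_measure setT)%E.
Proof.
have [_ _ h _] := hw; apply: lt_le_trans h _.
have -> : (\int[leb]_(x in [set` I]) (w x)%:E = \int[leb]_(x in [set` I]) (1 * w x)%:E)%E.
  by apply: eq_integral => x _; rewrite mul1r.
rewrite (weight_integral (h := cst 1)) //.
by rewrite (eq_integral (cst 1%E)) // integral_cst // mul1e.
Qed.

(** A vanishing integral would concentrate the measure on the zeros of [P], a finite set and hence
    null for a measure with a density; but the total mass is positive. *)
Lemma poly_int_gt0 (P : {poly R}) : P != 0 -> (forall x, 0 <= P.[x]) ->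
  0 < poly_int weight_measure setT P.
Proof.
move=> P0 Pge0; have mP := measurable_horner P.
rewrite lt_neqAle; apply/andP; split; last exact: poly_int_ge0.
apply/negP => /eqP JP.
have := poly_intE weight_moments measurableT (fun x _ => Pge0 x).
rewrite -JP => int0.
have [N [mN N0 subN]] : ae_eq weight_measure setT (fun x => P.[x]%:E) (cst 0%E).
  apply/(ae_eq_integral_abs _ measurableT); first exact/measurable_EFinP.
  by rewrite -[RHS]int0; apply: eq_integral => x _; rewrite gee0_abs // lee_fin.
pose Z : set X := (fun x => P.[x]) @^-1` [set 0].
have mZ : measurable Z by rewrite -[X in measurable X]setTI; exact: mP.
have leb0 : leb Z = 0%E.
  have [s [zs [PE s0]]] := rootless_factor P0.
  apply: countable_lebesgue_measure0; apply: finite_set_countable.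
  apply: (@sub_finite_set _ _ [set` zs]); last exact: finite_seq.
  move=> x /eqP; rewrite PE hornerM mulf_eq0 => /orP[|]; first by have := s0 x; rewrite /root => /negbTE ->.
  by rewrite -/(root _ x) root_prod_XsubC.
have Z0 : weight_measure Z = 0%E.
  apply: null_set_integral => //.
  by apply/measurable_EFinP/measurable_funTS; exact: measurable_weight0.
have h1 : (weight_measure N <= 0)%E by rewrite N0.
have h2 : (weight_measure Z <= 0)%E by rewrite Z0.
suff : (weight_measure setT <= 0 + 0)%E by rewrite adde0 leNgt weight_mass_gt0.
apply: le_trans (leeD h1 h2); apply: le_trans (measureU2 _ mN mZ).
apply: le_measure; rewrite ?inE //; first exact: measurableU.
move=> x _; case: (EM (Z x)) => [Zx|nZ]; [by right|left]; apply: subN => /= h.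
by apply: nZ; apply: EFin_inj; exact: h Logic.I.
Qed.
End weight.

Section orthogonal_system.
Variables (R : realType) (I : interval R) (w : R -> R) (q : nat -> {poly R}).
Hypotheses (hw : weight_function I w) (hq : orthogonal_polynomials I w q).
Local Notation mu := (weight_measure hw).
Local Notation J := (poly_int mu setT).
Local Notation X := (measurableTypeR R).

Lemma weight_poly_int (F : R -> R) (P : {poly R}) : (forall x, F x = P.[x]) ->
  \int[lebesgue_measure]_(x in [set` I]) (F x * w x) = J P.
Proof. by move=> FP; apply: weight_Rintegral => //; exact: measurable_horner. Qed.

Lemma gammaE j : gamma I w q j = J (q j ^+ 2).
Proof. by apply: weight_poly_int => x; rewrite horner_exp. Qed.

Lemma deriv_coefE l i j :
  deriv_coef I w q l i j = (J (q i ^+ 2))^-1 * J ((q j)^`(l) * q i).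
Proof. by rewrite /deriv_coef gammaE; congr (_ * _); apply: weight_poly_int => x; rewrite hornerM. Qed.

Lemma orth_poly_int i j : i != j -> J (q i * q j) = 0.
Proof.
have [_ _ h] := hq; move=> /negbTE ij; have := h i j; rewrite ij mul0r => <-.
by apply/esym/weight_poly_int => x; rewrite hornerM.
Qed.

Lemma gamma_gt0 j : 0 < gamma I w q j.
Proof.
by have [h _ _] := hq; rewrite gammaE; apply: gam_gt0 => //; exact: poly_int_gt0.
Qed.

Lemma le_bigmax_nat0 (n k : nat) (F : nat -> R) : (k < n)%N ->
  F k <= \big[Num.max/0]_(0 <= i < n) F i.
Proof.
move=> kn; rewrite big_mkord -[F k]/(F (Ordinal kn)).
exact: (le_bigmax _ (fun i : 'I_n => F i)).
Qed.

Variables (p : nat) (gammat : nat -> R).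
Hypothesis hgt : admissible_gammat I w q p gammat.

Lemma gammat_gamma i j : (i < j)%N -> j%:R ^+ 4 * J (q i ^+ 2) <= gammat j.
Proof.
move=> ij; have [_ h] := hgt; have j0 : (1 <= j)%N by exact: leq_ltn_trans ij.
have := h j j0; rewrite ge_max => /andP[_]; apply: le_trans.
by rewrite -gammaE ler_wpM2l ?exprn_ge0 //; exact: (le_bigmax_nat0 (gamma I w q)).
Qed.

Lemma gammat_gt0 j : 0 < gammat j.
Proof.
case: j => [|j]; first by have [-> _] := hgt; exact: gamma_gt0.
apply: lt_le_trans (gammat_gamma (ltn0Sn j)).
by rewrite mulr_gt0 ?exprn_gt0 ?ltr0n // -gammaE gamma_gt0.
Qed.

Lemma gammat_deriv j : (0 < p)%N -> (p <= j)%N ->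
  \sum_(i < j) ((J (q i ^+ 2))^-1 * J ((q j)^`(p) * q i)) ^+ 4 * J (q i ^+ 2) <= gammat j.
Proof.
move=> p0 pj; have [_ h] := hgt; have j0 : (1 <= j)%N by exact: leq_trans pj.
have := h j j0; rewrite ge_max => /andP[+ _]; apply: le_trans.
rewrite (minn_idPr pj).
apply: le_trans (le_bigmax_nat0 _ (ltnSn p)); rewrite big_mkord.
rewrite le_eqVlt; apply/orP; left; apply/eqP; apply: eq_bigr => i _.
by rewrite deriv_coefE gammaE.
Qed.

Lemma expands_weight (g : R -> R) (h : X -> R) (eta : nat -> R) n : measurable_fun setT h ->
  (forall x, x \in I -> h x = g x) ->
  (\int[lebesgue_measure]_(x in [set` I]) ((g x - \sum_(j < n) eta j * (q j).[x]) ^+ 2 * w x)%:E =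
   \int[mu]_x ((h x - \sum_(j < n) eta j * (q j).[x]) ^+ 2)%:E)%E.
Proof.
move=> mh hg; apply: weight_integral; last by move=> x /hg ->.
apply: measurable_funX; apply: measurable_funB => //.
by apply: measurable_sum => j; apply: measurable_funM => //; exact: measurable_horner.
Qed.

(** The value [a] keeps the lower bound valid on the whole line, and the complement of [I] carries
    no mass. *)
Definition extend (a : R) (g : R -> R) : X -> R := fun x => if x \in I then g x else a.

Lemma measurable_extend a g : measurable_fun [set` I] g -> measurable_fun setT (extend a g).
Proof.
move=> mg; have -> : extend a g = (fun x => (g \_ [set` I]) x + a * \1_(~` [set` I]) x).
  apply/funext => x; rewrite /extend patchE indicE in_setC mem_setE.
  by case: ifP => _ /=; rewrite ?mulr0 ?mulr1 ?addr0 ?add0r.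
apply: measurable_funD; first by apply/measurable_restrict => //; rewrite setTI.
by apply: measurable_funM => //; apply: measurable_indic; apply: measurableC.
Qed.

Lemma extend_in a g x : x \in I -> extend a g x = g x.
Proof. by rewrite /extend => ->. Qed.

Lemma expands_extend a g eta : measurable_fun [set` I] g -> expands I w q g eta ->
  (\int[mu]_x ((extend a g x - \sum_(j < n) eta j * (q j).[x]) ^+ 2)%:E)%E @[n --> \oo] --> 0%E.
Proof.
move=> mg; rewrite /expands; under eq_fun => n.
  rewrite (expands_weight _ n (measurable_extend a mg)); last by move=> x; exact: extend_in.
  over.
by [].
Qed.

Lemma expands_sq_integrable a g eta : measurable_fun [set` I] g -> expands I w q g eta ->
  sq_integrable mu (extend a g).
Proof.
move=> mg /(expands_extend a mg) /fine_cvgP[[n _ /(_ n (leqnn n))] /= h _].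
have sS : sq_integrable mu (fun x => \sum_(j < n) eta j * (q j).[x]).
  apply: sq_integrable_sum => j _; apply: sq_integrableZ.
  exact: sq_integrable_horner (weight_moments hw) _.
have sD : sq_integrable mu (fun x => extend a g x - \sum_(j < n) eta j * (q j).[x]).
  split; first by apply: measurable_funB; [exact: measurable_extend|case: sS].
  by rewrite ltey_eq h.
have := sq_integrableD sD sS; congr (sq_integrable mu _); apply/funext => x; exact: subrK.
Qed.

Lemma G_density a g : 0 < a -> unique_expansion I w q g -> G_ I w p a g -> density mu a (extend a g).
Proof.
move=> a0 [hexp _] [[mg _] ga g1]; split.
- exact: expands_sq_integrable mg hexp.
- by move=> x; rewrite /extend; case: ifP => // /ga.
- rewrite /Rintegral -(weight_integral hw (F := g)) ?g1 //; first exact: measurable_extend.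
  by move=> x; exact: extend_in.
Qed.

(* Only the inequality is needed, so the series of squared coefficients is
   compared with partial sums and no completeness is used. *)
Lemma parseval_le a g1 g2 eta1 eta2 (c : R) : measurable_fun [set` I] g1 -> measurable_fun [set` I] g2 ->
  expands I w q g1 eta1 -> expands I w q g2 eta2 ->
  (\sum_(0 <= j <oo) ((eta1 j - eta2 j) ^+ 2 * gamma I w q j)%:E <= c%:E)%E ->
  norm2 mu (fun x => extend a g1 x - extend a g2 x) ^+ 2 <= c.
Proof.
move=> m1 m2 e1 e2 hc.
have mom := weight_moments hw.
have s1 := expands_sq_integrable a m1 e1; have s2 := expands_sq_integrable a m2 e2.
have sS (eta : nat -> R) n : sq_integrable mu (fun x => \sum_(j < n) eta j * (q j).[x]).
  by apply: sq_integrable_sum => j _; apply: sq_integrableZ; exact: sq_integrable_horner.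
have part n : norm2 mu (fun x => \sum_(j < n) (eta1 j - eta2 j) * (q j).[x]) ^+ 2 <= c.
  have -> : norm2 mu (fun x => \sum_(j < n) (eta1 j - eta2 j) * (q j).[x]) ^+ 2 =
      \sum_(j < n) (eta1 j - eta2 j) ^+ 2 * gamma I w q j.
    rewrite sqr_norm2 inner_suml; [|by move=> j _; exact: sq_integrable_horner|exact: (sS (fun j => eta1 j - eta2 j))].
    apply: eq_bigr => j _; rewrite innerC inner_suml; [|by move=> i _; exact: sq_integrable_horner|exact: sq_integrable_horner].
    rewrite (bigD1 j) //= inner_horner // big1 ?addr0 => [|i ij].
      by rewrite gammaE expr2 mulrA -expr2.
    by rewrite inner_horner // orth_poly_int ?mulr0.
  rewrite -lee_fin; apply: le_trans hc; rewrite -sumEFin -(big_mkord xpredT (fun j => ((eta1 j - eta2 j) ^+ 2 * gamma I w q j)%:E)).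
  apply: nneseries_lim_ge => j _ _; rewrite lee_fin mulr_ge0 ?sqr_ge0 // ltW //.
  exact: gamma_gt0.
have c0 : 0 <= c by have := part 0%N; apply: le_trans; exact: sqr_ge0.
have close g eta : measurable_fun [set` I] g -> expands I w q g eta -> forall e, 0 < e ->
    \forall n \near \oo, norm2 mu (fun x => extend a g x - \sum_(j < n) eta j * (q j).[x]) <= e.
  move=> mg hg e e0; have sg := expands_sq_integrable a mg hg.
  have /fine_cvgP[_ /cvgrPdist_lt/(_ (e ^+ 2) (exprn_gt0 _ e0))] := expands_extend a mg hg.
  apply: filterS => n /=; rewrite integral_sqr /=; last exact: (sq_integrableB sg (sS eta n)).
  rewrite sub0r normrN ger0_norm ?inner_ge0 // -sqr_norm2 => /ltW h.
  by rewrite -ler_sqr ?nnegrE ?norm2_ge0 // ltW.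
suff h : norm2 mu (fun x => extend a g1 x - extend a g2 x) <= Num.sqrt c.
  by rewrite -[leRHS]sqr_sqrtr // lerXn2r // nnegrE ?norm2_ge0 ?sqrtr_ge0.
apply/ler_addgt0Pr => e e0; have e20 : 0 < e / 2 by rewrite divr_gt0.
have [n [n1 n2]] := filter_ex (filterI (close _ _ m1 e1 _ e20) (close _ _ m2 e2 _ e20)).
have sA := sq_integrableB s1 (sS eta1 n); have sB := sq_integrableB s2 (sS eta2 n).
have sC := sS (fun j => eta1 j - eta2 j) n.
have -> : (fun x => extend a g1 x - extend a g2 x) = (fun x =>
    (extend a g1 x - \sum_(j < n) eta1 j * (q j).[x]) +
    (-1 * (extend a g2 x - \sum_(j < n) eta2 j * (q j).[x]) +
     \sum_(j < n) (eta1 j - eta2 j) * (q j).[x])).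
  apply/funext => x; under [\sum_(j < n) (_ - _) * _]eq_bigr do rewrite mulrBl.
  by rewrite sumrB; ring.
have sB' := sq_integrableZ (-1) sB.
apply: le_trans (norm2D sA (sq_integrableD sB' sC)) _.
have := norm2D sB' sC; rewrite norm2Z // normrN1 mul1r.
have h3 : norm2 mu (fun x => \sum_(j < n) (eta1 j - eta2 j) * (q j).[x]) <= Num.sqrt c.
  by rewrite -ler_sqr ?nnegrE ?norm2_ge0 ?sqrtr_ge0 // [leRHS]sqr_sqrtr //; exact: part.
lra.
Qed.

End orthogonal_system.

(** * Law of the observations *)

Section sample.
Variables (R : realType) (I : interval R) (w : R -> R).
Hypothesis hw : weight_function I w.
Local Notation mu := (weight_measure hw).
Local Notation X := (measurableTypeR R).
Variables (a : R) (g0 : R -> R).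
Hypotheses (a0 : 0 < a) (dg0 : density mu a (extend I a g0)).
Variables (d : measure_display) (T : measurableType d) (P : probability T R)
  (Y : nat -> {RV P >-> R}).
Hypotheses (Yindep : mutually_independent Y) (Ydens : forall i, has_density (Y i) I w g0).

Lemma distributionE i (B : set X) : measurable B ->
  distribution P (Y i) B = (\int[mu]_(x in B) (extend I a g0 x)%:E)%E.
Proof.
move=> mB; rewrite Ydens // [RHS]integral_mkcond.
transitivity (\int[mu]_x (\1_B x * extend I a g0 x)%:E)%E; last first.
  by apply: eq_integral => x _; rewrite patchE indicE; case: ifP => _; rewrite ?mul1r ?mul0r.
rewrite -(ge0_weight_integral hw (F := fun x => \1_B x * g0 x)); last 3 first.
- apply: measurable_funM; [exact: measurable_indic|exact: density_meas dg0].
- by move=> x; rewrite mulr_ge0 // ltW // (density_gt0 a0 x dg0).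
- by move=> x xI; rewrite extend_in.
rewrite setIC integral_mkcondr; apply: eq_integral => x _; rewrite patchE indicE.
by case: ifP => _; rewrite ?mul1r ?mul0r.
Qed.

(* [R] and [measurableTypeR R] carry convertible sigma-algebras but different
   canonical structures; the observations are used in the second one. *)
Definition obs i : T -> X := Y i.

Lemma measurable_obs i : measurable_fun setT (obs i).
Proof. by move=> mT B mB; exact: (@measurable_funPT _ _ _ _ (Y i) mT B mB). Qed.

Lemma marginal i (f : X -> R) : measurable_fun setT f -> (forall x, 0 <= f x) ->
  (\int[P]_t (f (obs i t))%:E = \int[mu]_x (f x * extend I a g0 x)%:E)%E.
Proof.
move=> mf f0; have g00 x : 0 <= extend I a g0 x by rewrite ltW // (density_gt0 a0 x dg0).
have mE := measurable_obs i.
transitivity (\int[pushforward P (obs i)]_x (f x)%:E)%E.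
  rewrite ge0_integral_pushforward //; first exact/measurable_EFinP.
  by move=> y _; rewrite lee_fin.
rewrite [LHS](@ge0_integral_density _ X R mu _ (density_meas dg0) g00) //.
- exact: distributionE.
- exact/measurable_EFinP.
Qed.

Lemma iid_prod n (f : X -> R) (c : R) : measurable_fun setT f -> (forall x, 0 <= f x) ->
  (\int[mu]_x (f x * extend I a g0 x)%:E <= c%:E)%E ->
  (\int[P]_t (\prod_(i < n) f (obs i t))%:E <= (c ^+ n)%:E)%E.
Proof.
move=> mf f0 hc; set m := (\int[mu]_x _)%E in hc.
have m0 : (0 <= m)%E.
  by apply: integral_ge0 => x _; rewrite lee_fin mulr_ge0 // ltW // (density_gt0 a0 x dg0).
have mE : m = (fine m)%:E by rewrite fineK // ge0_fin_numE // (le_lt_trans hc) // ltry.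
rewrite (indep_prod Yindep (h := fun=> f) (m := fun=> fine m)) //; last first.
  by move=> i; rewrite marginal.
rewrite prodr_const card_ord lee_fin; apply: lerXn2r; rewrite ?nnegrE -?lee_fin -?mE //.
exact: le_trans m0 hc.
Qed.

(** Densities and their extensions agree only on [I]; off this null event all the data lie there, so
    the two likelihood ratios coincide. *)
Definition outside : set T := \bigcup_i (Y i @^-1` (~` [set` I])).

Lemma measurable_outside : measurable outside.
Proof.
apply: bigcup_measurable => i _; rewrite -[X in measurable X]setTI; apply: measurable_funPT => //.
by apply: measurableC; exact: measurable_itv.
Qed.

Lemma outside_null : P outside = 0%E.
Proof.
apply: measure_negligible; first exact: measurable_outside.
apply: negligible_bigcup => i; apply/negligibleP.
  rewrite -[X in measurable X]setTI; apply: measurable_funPT => //.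
  by apply: measurableC; exact: measurable_itv.
have := @Ydens i (~` [set` I]) (measurableC (measurable_itv _)).
by rewrite setICl integral_set0.
Qed.

End sample.

Section coefficient_space.
Variables (R : realType) (I : interval R) (w : R -> R) (q : nat -> {poly R}) (p : nat) (a : R).
Local Notation X := (measurableTypeR R).
Local Notation Omega := (Omega_G I w q p a).
Local Notation E := (coef_space Omega).

Lemma measurable_Omega : measurable (Omega : set E).
Proof. by apply: sub_sigma_algebra; left. Qed.

Lemma measurable_coordinate j : measurable_fun setT (fun eta : E => eta j).
Proof.
move=> _ B mB; rewrite setTI; apply: sub_sigma_algebra; right.
by exists j, B.
Qed.

Lemma measurable_weighted_series (f : nat -> R -> R) : (forall j, measurable_fun setT (f j)) ->
  (forall j x, 0 <= f j x) ->
  measurable_fun setT (fun eta : E => (\sum_(0 <= j <oo) (f j (eta j))%:E)%E).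
Proof.
move=> mf f0; apply: ge0_emeasurable_sum => [j eta _ _|j _]; first by rewrite lee_fin.
by apply/measurable_EFinP; exact: (measurableT_comp (mf j) (measurable_coordinate j)).
Qed.

Variable g : (nat -> R) -> R -> R.
Hypothesis hg : density_family I w q p a g.

(** The constant [a] also fills in for parameters outside [Omega_G], which gives one positive,
    jointly measurable function on the whole product. *)
Definition family_ext (e : E) : X -> R := fun x => if e \in Omega then extend I a (g e) x else a.

Lemma family_extE e : Omega e -> family_ext e = extend I a (g e).
Proof. by move=> Oe; apply/funext => x; rewrite /family_ext mem_set. Qed.

Lemma measurable_family_ext : measurable_fun setT (fun z : E * X => family_ext z.1 z.2).
Proof.
have [_ mg] := hg.
pose D : set (E * X) := Omega `*` [set` I].
have mD : measurable D by apply: measurableX; [exact: measurable_Omega|exact: measurable_itv].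
have -> : (fun z : E * X => family_ext z.1 z.2) =
    (fun z => ((fun z => g z.1 z.2) \_ D) z + a * \1_(~` D) z).
  apply/funext => -[e x]; rewrite /family_ext /extend patchE indicE in_setC /=.
  have -> : ((e, x) \in D) = (e \in Omega) && (x \in I).
    apply/idP/andP => [/set_mem[h1 h2]|[/set_mem h1 h2]]; last by apply: mem_set; split.
    by split; [exact: mem_set|exact: h2].
  case: (e \in Omega); case: (x \in I) => /=; rewrite ?mulr0 ?mulr1 ?addr0 ?add0r //.
apply: measurable_funD; first by apply/measurable_restrict => //; rewrite setTI.
by apply: measurable_funM => //; apply: measurable_indic; apply: measurableC.
Qed.

End coefficient_space.

(** Used to see that Hellinger neighbourhoods are events of the coefficient space. The weight is
    moved into the integrand, so that Tonelli is applied to the sigma-finite Lebesgue measure. *)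
Lemma measurable_weight_integral (R : realType) (I : interval R) (w : R -> R)
    (hw : weight_function I w) d (E : measurableType d) (F : E -> measurableTypeR R -> R) :
  measurable_fun setT (fun z : E * measurableTypeR R => F z.1 z.2) -> (forall e x, 0 <= F e x) ->
  measurable_fun setT (fun e => (\int[weight_measure hw]_x (F e x)%:E)%E).
Proof.
move=> mF F0.
have -> : (fun e => (\int[weight_measure hw]_x (F e x)%:E)%E) =
    (fun e => (\int[@lebesgue_measure R]_x (F e x * weight0 I w x)%:E)%E).
  apply/funext => e.
  have me : measurable_fun setT (F e) := measurableT_comp mF (measurable_pair1 e).
  apply: (@ge0_integral_density _ (measurableTypeR R) R lebesgue_measure (weight0 I w)
    (measurable_weight0 hw) (weight0_ge0 hw) (weight_measure hw) (fun x => (F e x)%:E)) => //.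
    exact/measurable_EFinP.
  by move=> x; rewrite lee_fin.
pose H (z : E * measurableTypeR R) := (F z.1 z.2 * weight0 I w z.2)%:E.
have mH : measurable_fun setT H.
  apply/measurable_EFinP; apply: measurable_funM => //.
  exact: (measurableT_comp (measurable_weight0 hw) measurable_snd).
have H0 z : (0 <= H z)%E by rewrite lee_fin mulr_ge0 // weight0_ge0.
have mHH : measurable_fun setT (fun e => \int[@lebesgue_measure R]_x H (e, x))%E.
  exact: measurable_fun_fubini_tonelli_F.
exact: mHH.
Qed.

Theorem theorem3p1 (R : realType) (I : interval R) (w : R -> R)
    (q : nat -> {poly R}) (p : nat) (a : R) (gammat : nat -> R)
    (hw : weight_function I w) (hq : orthogonal_polynomials I w q)
    (ha : 0 < a) (hp : (1 <= p)%N)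
    (hexp : forall h, G_ I w p a h -> unique_expansion I w q h)
    (hgammat : admissible_gammat I w q p gammat)
    (g0 : R -> R) (hg0 : G_ I w p a g0)
    (theta : nat -> R) (htheta : theta = coef I w q g0)
    (g : (nat -> R) -> R -> R) (hg : density_family I w q p a g)
    (pi : probability (coef_space (Omega_G I w q p a)) R)
    (hpi : pi (Omega_G I w q p a) = 1%E)
    (d : measure_display) (T : measurableType d) (P : probability T R)
    (Y : nat -> {RV P >-> R}) (hYindep : mutually_independent Y)
    (hYdens : forall i, has_density (Y i) I w g0)
    (eps : nat -> R)
    (heps : forall n, (1 <= n)%N ->
       n%:R `^ (- (p%:R / (2 * p + 1)%:R)) <= eps n)
    (C3 : R) (hC3 : 0 < C3)
    (hprior_ball :
       gtrsim (fun n => pi [set eta | Omega_G I w q p a eta /\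
                 (\sum_(0 <= j <oo)
                    ((eta j - theta j) ^+ 2 * gamma I w q j)%:E
                  <= (a * C3 * eps n ^+ 2)%:E)%E])
              (fun n => expR (- (2 * C3 * n%:R * eps n ^+ 2))))
    (hprior_tail :
       lesssim (fun n => pi [set eta | Omega_G I w q p a eta /\
                 (\sum_(0 <= j <oo) (eta j ^+ 2 * gammat j)%:E
                  > (n%:R `^ ((2 * p + 1)%:R^-1))%:E)%E])
               (fun n => expR (- (C3 * n%:R * eps n ^+ 2))))
    (hneps : n%:R * eps n ^+ 2 @[n --> \oo] --> +oo) :
  \forall K \near +oo,
    lesssim_whp P
      (fun n omega =>
         posterior pi g0 g (fun i : 'I_n => Y i omega)
           [set eta | Omega_G I w q p a eta /\
                      K * eps n <= hellinger I w (g eta) g0])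
      (fun n => expR (- (n%:R * K ^+ 2 * eps n ^+ 2 / 2)) +
                expR (- (4 * C3 * n%:R * eps n ^+ 2)))
    /\ expR (- (n%:R * K ^+ 2 * eps n ^+ 2 / 2)) +
       expR (- (4 * C3 * n%:R * eps n ^+ 2)) @[n --> \oo] --> 0.
Proof.
pose mu := weight_measure hw.
pose Om := Omega_G I w q p a.
have [q_size _ _] := hq.
have mG_ h : G_ I w p a h -> measurable_fun [set` I] h by case=> -[].
pose gh := extend I a g0; pose Gh := @family_ext R I w q p a g.
have dgh : density mu a gh by exact: (G_density hw ha (hexp _ hg0) hg0).
have hgO (e : coef_space Om) : Om e -> G_ I w p a (g e) /\ coef I w q (g e) = e by case: hg => h _; exact: h.
have dGh (e : coef_space Om) : Om e -> density mu a (Gh e).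
  move=> Oe; rewrite /Gh family_extE //; have [h _] := hgO e Oe.
  exact: (G_density hw ha (hexp _ h) h).
have Gh_gt0 (e : coef_space Om) x : 0 < Gh e x.
  case: (EM (Om e)) => [Oe|nO]; first exact: (density_gt0 ha x (dGh e Oe)).
  by rewrite /Gh /family_ext memNset.
have mGh : measurable_fun setT (fun z : coef_space Om * measurableTypeR R => Gh z.1 z.2).
  exact: measurable_family_ext.
have e_expands (e : coef_space Om) : Om e -> expands I w q (g e) e.
  by move=> Oe; have [h ce] := hgO e Oe; have [h' _] := hexp _ h; rewrite ce in h'.
have theta_expands : expands I w q g0 theta by rewrite htheta; have [] := hexp _ hg0.
have eps_ge0 n : (1 <= n)%N -> 0 <= eps n.
  by move=> n1; apply: le_trans (heps n n1); exact: powR_ge0.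
have mOm : measurable (Om : set (coef_space Om)) := @measurable_Omega R I w q p a.
have gam0 j : 0 <= gamma I w q j by exact: ltW (gamma_gt0 hw hq j).
have gt0 j : 0 <= gammat j by exact: ltW (gammat_gt0 hw hq hgammat j).
have mball : measurable_fun setT (fun e : coef_space Om =>
    (\sum_(0 <= j <oo) ((e j - theta j) ^+ 2 * gamma I w q j)%:E)%E).
  apply: (measurable_weighted_series (f := fun j x => (x - theta j) ^+ 2 * gamma I w q j)) => [j|j x].
    by apply: measurable_funM => //; apply: measurable_funX; exact: measurable_funB.
  by rewrite mulr_ge0 ?sqr_ge0.
have mtail : measurable_fun setT (fun e : coef_space Om =>
    (\sum_(0 <= j <oo) (e j ^+ 2 * gammat j)%:E)%E).
  apply: (measurable_weighted_series (f := fun j x => x ^+ 2 * gammat j)) => [j|j x].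
    by apply: measurable_funM => //; exact: measurable_funX.
  by rewrite mulr_ge0 ?sqr_ge0.
pose B n : set (coef_space Om) := [set eta | Om eta /\ (\sum_(0 <= j <oo) ((eta j - theta j) ^+ 2 * gamma I w q j)%:E
  <= (a * C3 * eps n ^+ 2)%:E)%E].
pose U n : set (coef_space Om) := [set eta | Om eta /\ (\sum_(0 <= j <oo) (eta j ^+ 2 * gammat j)%:E
  > (n%:R `^ ((2 * p + 1)%:R^-1))%:E)%E].
pose A K n : set (coef_space Om) := [set eta | Om eta /\ K * eps n <= hellinger I w (g eta) g0].
have mB n : measurable (B n).
  have -> : B n = Om `\` [set eta | ((a * C3 * eps n ^+ 2)%:E <
      \sum_(0 <= j <oo) ((eta j - theta j) ^+ 2 * gamma I w q j)%:E)%E].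
    apply/seteqP; split => e /= [Oe he]; split => //; first by apply/negP; rewrite -leNgt.
    by rewrite leNgt; exact/negP.
  by apply: measurableD => //; exact: measurable_exceedance.
have mU n : measurable (U n).
  by apply: measurableI => //; exact: measurable_exceedance.
pose S (e : coef_space Om) := (\int[mu]_x ((Num.sqrt (Gh e x) - Num.sqrt (gh x)) ^+ 2)%:E)%E.
have mS : measurable_fun setT S.
  apply: (measurable_weight_integral hw (F := fun e x => (Num.sqrt (Gh e x) - Num.sqrt (gh x)) ^+ 2)).
    apply: measurable_funX; apply: measurable_funB; first exact: measurable_sqrt.
    apply: measurable_sqrt; exact: (measurableT_comp (density_meas dgh) measurable_snd).
  by move=> e x; exact: sqr_ge0.
have S0 e : (0 <= S e)%E by apply: integral_ge0 => x _; rewrite lee_fin sqr_ge0.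
have hellE (e : coef_space Om) : Om e -> hellinger I w (g e) g0 = Num.sqrt (fine (S e)).
  move=> Oe; rewrite /hellinger /Rintegral; congr (Num.sqrt (fine _)).
  apply: ge0_weight_integral.
  - apply: measurable_funX; apply: measurable_funB; apply: measurable_sqrt.
      exact: density_meas (dGh e Oe).
    exact: density_meas dgh.
  - by move=> x; exact: sqr_ge0.
  - by move=> x xI; rewrite /Gh family_extE // /gh !extend_in.
have mA K n : measurable (A K n).
  have -> : A K n = Om `&` ((fun e => Num.sqrt (fine (S e))) @^-1` `[K * eps n, +oo[).
    apply/seteqP; split => e /= [Oe]; rewrite in_itv /= ?andbT => he; split => //.
      by rewrite -hellE.
    by rewrite hellE.
  apply: measurableI => //; rewrite -[X in measurable X]setTI.
  have mfS : measurable_fun setT (fun e => fine (S e)).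
    by apply: (@measurableT_comp _ _ _ _ _ _ (@fine R)) => //.
  exact: (measurable_sqrt mfS measurableT (measurable_itv _)).
have hB n (e : coef_space Om) : B n e -> norm2 mu (fun x => Gh e x - gh x) ^+ 2 <= a * (C3 * eps n ^+ 2).
  move=> [Oe he]; rewrite /Gh family_extE // mulrA; have [Ge _] := hgO e Oe.
  exact: (parseval_le hw hq a (mG_ _ Ge) (mG_ _ hg0) (e_expands e Oe) theta_expands he).
have hU n (e : coef_space Om) : Om e -> ~ U n e -> forall N,
    \sum_(j < N) e j ^+ 2 * gammat j <= n%:R `^ ((2 * p + 1)%:R^-1).
  move=> Oe nU N; rewrite -lee_fin -sumEFin.
  apply: (@le_trans _ _ (\sum_(0 <= j <oo) (e j ^+ 2 * gammat j)%:E)%E); last first.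
    by rewrite leNgt; apply/negP => h; exact: nU.
  rewrite -(big_mkord xpredT (fun j => (e j ^+ 2 * gammat j)%:E)).
  by apply: nneseries_lim_ge => j _ _; rewrite lee_fin mulr_ge0 ?sqr_ge0.
have hA K n (e : coef_space Om) : 0 <= K -> (1 <= n)%N -> A K n e -> (((K * eps n) ^+ 2)%:E <= S e)%E.
  move=> K0 n1 [Oe]; rewrite hellE // => h.
  have h2 : (K * eps n) ^+ 2 <= fine (S e).
    rewrite -[leRHS]sqr_sqrtr ?fine_ge0 // lerXn2r // nnegrE ?sqrtr_ge0 //.
    by rewrite mulr_ge0 // eps_ge0.
  by case: (S e) (S0 e) h2 => [s| |] //= _ h2; rewrite ?lee_fin ?leey.
have hball : exists2 r : R, 0 < r &
    \forall n \near \oo, ((r * expR (- (2 * C3 * (n%:R * eps n ^+ 2))))%:E <= pi (B n))%E.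
  have [r r0 h] := hprior_ball; exists r => //; apply: filterS h => n.
  by rewrite (mulrA (2 * C3)).
have htail : exists2 r : R, 0 < r &
    \forall n \near \oo, (pi (U n) <= (r * expR (- (C3 * (n%:R * eps n ^+ 2))))%:E)%E.
  have [r r0 h] := hprior_tail; exists r => //; apply: filterS h => n.
  by rewrite (mulrA C3).
have cexp (e : coef_space Om) : Om e ->
    (\int[mu]_x ((Gh e x - \sum_(j < n) e j * (q j).[x]) ^+ 2)%:E)%E @[n --> \oo] --> 0%E.
  move=> Oe; rewrite /Gh family_extE //.
  exact: (expands_extend hw a (mG_ _ (proj1 (hgO e Oe))) (e_expands e Oe)).
have [K1 hK1] := posterior_rate (weight_moments hw) (weight_finite hw) (poly_int_gt0 hw) q_size
  (fun i j => @orth_poly_int _ _ _ _ hw hq i j) hp (gammat_gt0 hw hq hgammat)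
  (fun j => @gammat_deriv _ _ _ _ hw _ _ hgammat j hp)
  (fun i j => @gammat_gamma _ _ _ _ hw _ _ hgammat i j) ha (measurable_obs Y) dgh
  (marginal ha dgh hYdens)
  (iid_prod ha dgh hYindep hYdens) (pi := pi) mGh Gh_gt0 mOm dGh
  (cf := fun e : coef_space Om => e) cexp
  heps hC3 hneps mB (fun n e => @proj1 _ _) mU (fun n e => @proj1 _ _) mA (fun K n e => @proj1 _ _)
  hB hball hU htail hA.
have lrE n omega (D : set (coef_space Om)) : D `<=` Om -> ~ outside I Y omega ->
    (\int[pi]_(eta in D) (likelihood_ratio g0 g (fun i : 'I_n => Y i omega) eta)%:E =
     \int[pi]_(eta in D) (lratio (obs Y) gh Gh n omega eta)%:E)%E.
  move=> DO out; apply: eq_integral => eta /set_mem /DO Oeta; congr _%:E.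
  apply: eq_bigr => i _; have YI : Y i omega \in I.
    by apply: contrapT => h; apply: out; exists i.
  by rewrite /Gh family_extE // /gh !extend_in.
exists (Num.max K1 1); split; first exact: num_real.
move=> K; rewrite gt_max => /andP[/ltW/hK1[r r0 [Ev [mEv PEv hEv]]] K1'].
have K0 : 0 < K by lra.
split; last first.
  have h1 : expR (- (K ^+ 2 / 2 * (n%:R * eps n ^+ 2))) @[n --> \oo] --> 0.
    by apply: expR_cvg0 hneps; rewrite divr_gt0 ?exprn_gt0.
  have h2 : expR (- (4 * C3 * (n%:R * eps n ^+ 2))) @[n --> \oo] --> 0.
    by apply: expR_cvg0 hneps; rewrite mulr_gt0.
  have -> : (fun n => expR (- (n%:R * K ^+ 2 * eps n ^+ 2 / 2)) + expR (- (4 * C3 * n%:R * eps n ^+ 2))) =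
      (fun n => expR (- (K ^+ 2 / 2 * (n%:R * eps n ^+ 2))) + expR (- (4 * C3 * (n%:R * eps n ^+ 2)))).
    by apply/funext => n; congr (expR (- _) + expR (- _)); ring.
  by rewrite -(addr0 0); exact: cvgD.
exists r => //; exists (fun n => Ev n `|` outside I Y); split.
- by move=> n; apply: measurableU => //; exact: measurable_outside.
- have -> : (fun n => P (Ev n `|` outside I Y)) = (fun n => P (Ev n)).
    by apply/funext => n; rewrite measureU0 //; [exact: measurable_outside|exact: outside_null hYdens].
  exact: PEv.
apply: filterS hEv => n hEv omega /not_orP[nE nO].
rewrite /posterior (lrE n omega (A K n)) //; last by move=> e [].
rewrite (lrE n omega Om) //; apply: le_trans (hEv omega nE) _.
by rewrite lee_fin ler_pM2l // (mulrA (4 * C3)) lerDr expR_ge0.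
Qed.
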